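(* Let $N$ be a positive integer, let $\mathfrak a$ be a complex vector space of dimension $N$ with positive definite Hermitian form, and let $\mathfrak u=\mathfrak a\oplus\mathfrak a^*$. Then the quadruple $(A(\mathfrak u),Y,\mathbf 1,\Omega_U)$ with $\Omega_U=\{\omega,\jmath\}$ is a self-dual $U(1)$-VOA of rank $N$. The full automorphism group of $(A(\mathfrak u),\Omega_U)$ is $GL(\mathfrak a)$.
   Context: **Vertex algebras.** All spaces are over $\mathbb C$ and may be $\mathbb Z/2$-graded; ''vertex algebra'' and ''VOA'' include the super case. A vertex algebra is $(U,Y,\mathbf 1)$ with $Y(u,z)v=\sum_nu_{(n)}v\,z^{-n-1}$. A VOA $(U,Y,\mathbf 1,\omega)$ has an even $\omega$ such that $L(n)=\omega_{(n+1)}$ satisfy the Virasoro relations with central charge $c$ (the rank), $[L(-1),Y(u,z)]=\frac d{dz}Y(u,z)$, and $L(0)$ is diagonalizable with rational eigenvalues bounded below and finite-dimensional eigenspaces. It is self-dual if its only irreducible module is itself. **Enhanced VOAs.** Let $Tu=u_{(-2)}\mathbf 1$. For $\Omega\subset U$, $[\Omega]$ is the smallest subspace of $U$ containing $\Omega$ and closed under $T$ and all products $u_{(n)}v$, $n\ge0$ (the vertex Lie subalgebra generated by $\Omega$). $(U,Y,\mathbf 1,\Omega)$ is an enhanced VOA if there is a unique $\omega\in[\Omega]$ such that (1) $(U,Y,\mathbf 1,\omega)$ is a VOA and (2) $\omega_{(n)}u=0$ for all $n\ge2$ whenever $u\in[\Omega]$ and $\omega_{(1)}u=u$; rank and self-duality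 refer to this VOA. The automorphism group of $(U,\Omega)$ is the group of vertex algebra automorphisms fixing each element of $\Omega$. The $U(1)$ Virasoro algebra has basis $L_m,J_m$, central $\mathbf c$, with $[L_m,L_n]=(m-n)L_{m+n}+\frac{m^3-m}{12}\delta_{m+n,0}\mathbf c$, $[L_m,J_n]=-nJ_{m+n}$, $[J_m,J_n]=-m\delta_{m+n,0}\mathbf c$. An enhanced VOA is an enhanced $U(1)$-VOA if there is a unique (up to sign) $\jmath\in[\Omega]$ such that, with $Y(\omega,z)=\sum L(m)z^{-m-2}$ and $Y(\jmath,z)=\sum J(m)z^{-m-1}$, $L_m\mapsto L(m)$, $J_m\mapsto J(m)$ gives a representation of the $U(1)$ Virasoro algebra; it is a $U(1)$-VOA if moreover $[\Omega]=[\{\omega,\jmath\}]$. **The VOA $A(\mathfrak u)$.** Let $\{a_i\}_{i\in\Delta}$ be an orthonormal basis of $\mathfrak a$, $\{a_i^*\}$ the dual basis; $\mathfrak u$ carries the symmetric bilinear form with $\langle a_i,a_j^*\rangle=\frac12\delta_{ij}$ and $\mathfrak a,\mathfrak a^*$ isotropic. Let $e_i=a_i+a_i^*$, $e_{i'}=\mathbf i(a_i-a_i^* )$, an orthonormal basis indexed by $\Sigma=\Delta\cup\Delta'$. Clifford algebras satisfy $uv+vu=-2\langle u,v\rangle$. With $u(r)=u\otimes t^r$, $r\in\mathbb Z+\frac12$, and $\langle u(r),v(s)\rangle=\langle u,v\rangle\delta_{r+s,0}$, $A(\mathfrak u)$ is the module over the Clifford algebra generated by all $u(r)$, generated by $\mathbf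 1$ with $u(r)\mathbf 1=0$ for $r>0$. Its vertex operators are $Y(u_1(-m_1-\frac12)\cdots u_k(-m_k-\frac12)\mathbf 1,z)=\,:\!D_z^{(m_1)}u_1(z)\cdots D_z^{(m_k)}u_k(z)\!:$ with $u(z)=\sum_ru(r)z^{-r-1/2}$, $D_z^{(m)}=\frac1{m!}\frac{d^m}{dz^m}$ and fermionic normal ordering. Set $\omega=\frac14\sum_{i\in\Sigma}e_i(-\frac12)e_i(-\frac32)\mathbf 1$ and $\jmath=\frac12\sum_{i\in\Delta}e_i(-\frac12)e_{i'}(-\frac12)\mathbf 1=\mathbf i\sum_{i\in\Delta}a_i^*(-\frac12)a_i(-\frac12)\mathbf 1$. $GL(\mathfrak a)$ acts on $\mathfrak u$ naturally on $\mathfrak a$ and dually on $\mathfrak a^*$, and hence on $A(\mathfrak u)$. *)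

(* Defs.v *)
From HB Require Import structures.
From mathcomp Require Import all_boot all_order all_algebra.
From mathcomp Require Import all_classical reals.
From mathcomp Require Import complex.

Set Implicit Arguments.
Unset Strict Implicit.
Unset Printing Implicit Defensive.
Import Order.TTheory GRing.Theory Num.Theory.
Local Open Scope classical_set_scope.
Local Open Scope quotient_scope.
Local Open Scope ring_scope.
Local Open Scope complex_scope.

Section Linear.
Variables (R : realType) (V : lmodType R[i]).

Definition is_subspace (W : set V) : Prop :=
  W 0 /\ forall (c : R[i]) v w, W v -> W w -> W (c *: v + w).

Definition lspan (X : set V) : set V :=
  [set v | exists2 s : seq (R[i] * V), (forall x, x \in s -> X x.2)
           & v = \sum_(x <- s) x.1 *: x.2].

(* [gr false] is the even part and [gr true] the odd part. *)
Definition is_grading (gr : bool -> set V) : Prop :=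
  [/\ forall p, is_subspace (gr p),
      forall v, exists v0 v1, [/\ gr false v0, gr true v1 & v = v0 + v1]
    & forall v, gr false v -> gr true v -> v = 0].

End Linear.

(* Generalised binomial coefficient x (x - 1) ... (x - j + 1) / j! *)
Definition binz (R : realType) (x : int) (j : nat) : R[i] :=
  (\prod_(i < j) (x - i%:Z)%:~R) / j`!%:R.

(*  [Y u n v] is the product u_(n) v, so Y(u,z)v = sum_n (Y u n v) z^(-n-1).
    Sums of the form [\sum_(j \in [set: nat])] are sums of finitely supported
    families. *)

Section Vertex.
Variables (R : realType) (V : lmodType R[i]) (gr : bool -> set V).
Variables (Y : V -> int -> V -> V) (vac : V).

(* Component form of the (super) Jacobi identity for a module M; the adjoint
   case M = V is the Jacobi identity of the vertex algebra itself. *)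
Definition borcherds_identity (M : lmodType R[i]) (YM : V -> int -> M -> M) :
    Prop :=
  forall (p q : bool) (u v : V) (w : M) (l m n : int), gr p u -> gr q v ->
  \sum_(j \in [set: nat])
     binz R m j *: YM (Y u (l + j%:Z) v) (m + n - j%:Z) w =
  \sum_(j \in [set: nat])
     ((-1) ^+ j * binz R l j) *:
       (YM u (l + m - j%:Z) (YM v (n + j%:Z) w)
        - ((-1) ^ l * (-1) ^+ (p && q)) *:
            YM v (l + n - j%:Z) (YM u (m + j%:Z) w)).

(* No grading of M by conformal weights is required, so ordinary and admissible
   modules are among these; their irreducibility is the one defined below. *)
Record is_vertex_module (M : lmodType R[i]) (grM : bool -> set M)
    (YM : V -> int -> M -> M) : Prop := {
  vm_grading : is_grading grM;
  vm_linearl : forall n w, linear (fun v => YM v n w);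
  vm_linearr : forall v n, linear (YM v n);
  vm_parity : forall p q v n w,
    gr p v -> grM q w -> grM (p (+) q) (YM v n w);
  vm_truncation : forall v w, exists n0 : int,
    forall n, n0 <= n -> YM v n w = 0;
  vm_vacuum : forall n w, YM vac n w = if n == -1 then w else 0;
  vm_borcherds : borcherds_identity YM
}.

Record is_vertex_algebra : Prop := {
  va_adjoint : is_vertex_module gr Y;
  va_vacuum_even : gr false vac;
  va_creation : forall v n, 0 <= n -> Y v n vac = 0;
  va_creationN1 : forall v, Y v (-1) vac = v
}.

Definition is_vertex_submodule (M : lmodType R[i]) (grM : bool -> set M)
    (YM : V -> int -> M -> M) (W : set M) : Prop :=
  [/\ is_subspace W,
      forall w0 w1, grM false w0 -> grM true w1 -> W (w0 + w1) -> W w0 /\ W w1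
    & forall v n w, W w -> W (YM v n w)].

Definition is_irreducible (M : lmodType R[i]) (grM : bool -> set M)
    (YM : V -> int -> M -> M) : Prop :=
  (exists w : M, w <> 0) /\
  forall W, is_vertex_submodule grM YM W ->
    (forall w, W w -> w = 0) \/ (forall w, W w).

(* The isomorphism may be even (p = false) or odd (p = true): the parity
   reversal of a module is not regarded as a different module. *)
Definition self_dual : Prop :=
  is_irreducible gr Y /\
  forall (M : lmodType R[i]) (grM : bool -> set M) (YM : V -> int -> M -> M),
    is_vertex_module grM YM -> is_irreducible grM YM ->
    exists (p : bool) (f : V -> M),
      [/\ linear f, bijective f,
          forall q v, gr q v -> grM (p (+) q) (f v)
        & forall u n v, f (Y u n v) = YM u n (f v)].

Definition vir (omega : V) (n : int) : V -> V := Y omega (n + 1).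

Definition eigenspace_of (f : V -> V) (x : R[i]) : set V :=
  [set v | f v = x *: v].

Record is_VOA (omega : V) (c : R[i]) : Prop := {
  voa_vertex : is_vertex_algebra;
  voa_even : gr false omega;
  voa_virasoro : forall (m n : int) (v : V),
    vir omega m (vir omega n v) - vir omega n (vir omega m v) =
    (m - n)%:~R *: vir omega (m + n) v
    + (if m + n == 0 then ((m ^+ 3 - m)%:~R / 12%:R * c) *: v else 0);
  voa_derivative : forall (u v : V) (n : int),
    vir omega (-1) (Y u n v) - Y u n (vir omega (-1) v) =
    (- n%:~R) *: Y u (n - 1) v;
  voa_diagonalizable : forall v,
    lspan [set w | exists x, eigenspace_of (vir omega 0) x w] v;
  voa_eigenvalues : exists q0 : rat, forall x v, v <> 0 ->
    eigenspace_of (vir omega 0) x v -> exists2 q : rat, q0 <= q & x = ratr q;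
  voa_finite_dim : forall x, exists s : seq V,
    eigenspace_of (vir omega 0) x `<=` lspan [set w | w \in s]
}.

Inductive vertex_lie (Omega : set V) : V -> Prop :=
| VL_gen u : Omega u -> vertex_lie Omega u
| VL_zero : vertex_lie Omega 0
| VL_lin (c : R[i]) u v :
    vertex_lie Omega u -> vertex_lie Omega v -> vertex_lie Omega (c *: u + v)
| VL_T u : vertex_lie Omega u -> vertex_lie Omega (Y u (-2) vac)
| VL_prod u v (n : int) : 0 <= n ->
    vertex_lie Omega u -> vertex_lie Omega v -> vertex_lie Omega (Y u n v).

Definition is_conformal (Omega : set V) (omega : V) : Prop :=
  [/\ vertex_lie Omega omega,
      exists c, is_VOA omega c
    & forall u, vertex_lie Omega u -> Y omega 1 u = u ->
      forall n : int, 2 <= n -> Y omega n u = 0].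

Definition is_enhanced_VOA (Omega : set V) : Prop :=
  exists! omega, is_conformal Omega omega.

Definition has_rank (Omega : set V) (c : R[i]) : Prop :=
  exists2 omega, is_conformal Omega omega & is_VOA omega c.

(* K is the image of the central element of the U(1) Virasoro algebra. *)
Definition is_U1_virasoro_rep (L J : int -> V -> V) : Prop :=
  exists K : V -> V,
  [/\ linear K /\ (forall m v, K (L m v) = L m (K v) /\ K (J m v) = J m (K v)),
      forall (m n : int) v, L m (L n v) - L n (L m v) =
        (m - n)%:~R *: L (m + n) v
        + (if m + n == 0 then ((m ^+ 3 - m)%:~R / 12%:R) *: K v else 0),
      forall (m n : int) v,
        L m (J n v) - J n (L m v) = (- n%:~R) *: J (m + n) v
    & forall (m n : int) v,
        J m (J n v) - J n (J m v) =
        (if m + n == 0 then (- m%:~R) *: K v else 0)].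

Definition is_U1_vector (Omega : set V) (omega j : V) : Prop :=
  vertex_lie Omega j /\ is_U1_virasoro_rep (vir omega) (Y j).

Definition is_U1_pair (Omega : set V) (omega j : V) : Prop :=
  [/\ is_conformal Omega omega, is_U1_vector Omega omega j
    & forall j', is_U1_vector Omega omega j' -> j' = j \/ j' = - j].

Definition is_enhanced_U1_VOA (Omega : set V) : Prop :=
  is_enhanced_VOA Omega /\ exists omega j, is_U1_pair Omega omega j.

Definition is_U1_VOA (Omega : set V) : Prop :=
  is_enhanced_U1_VOA Omega /\
  exists omega j, is_U1_pair Omega omega j /\
    vertex_lie Omega = vertex_lie [set omega; j].

Definition is_automorphism (Omega : set V) (phi : V -> V) : Prop :=
  [/\ linear phi /\ bijective phi,
      forall p v, gr p v -> gr p (phi v),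
      phi vac = vac,
      forall u n v, phi (Y u n v) = Y (phi u) n (phi v)
    & forall x, Omega x -> phi x = x].

End Vertex.

(*  For a space U with bilinear form B, the mode [FAct u n] stands for u(r) with
    r = n + 1/2, so that u(z) = sum_r u(r) z^(-r-1/2) = sum_n u(n+1/2) z^(-n-1).
    The module is presented by generators and relations: [fexpr] are the formal
    expressions in the vacuum, the vector space operations and the modes, and
    [feq] is the smallest congruence containing the vector space axioms, the
    linearity of the modes, the Clifford relations
      u(r)v(s) + v(s)u(r) = - 2 B(u,v) delta_{r+s,0}
    and u(r) 1 = 0 for r > 0. *)

Section CliffordModule.
Variables (R : realType) (U : lmodType R[i]) (B : U -> U -> R[i]).

Inductive fexpr : Type :=
| FVac
| FZero
| FAdd of fexpr & fexpr
| FScale of R[i] & fexpr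
| FAct of U & int & fexpr.

Inductive feq : fexpr -> fexpr -> Prop :=
| feq_refl x : feq x x
| feq_sym x y : feq x y -> feq y x
| feq_trans x y z : feq x y -> feq y z -> feq x z
| feq_add x x' y y' : feq x x' -> feq y y' -> feq (FAdd x y) (FAdd x' y')
| feq_scale c x x' : feq x x' -> feq (FScale c x) (FScale c x')
| feq_act u n x x' : feq x x' -> feq (FAct u n x) (FAct u n x')
| feq_addA x y z : feq (FAdd x (FAdd y z)) (FAdd (FAdd x y) z)
| feq_addC x y : feq (FAdd x y) (FAdd y x)
| feq_add0 x : feq (FAdd FZero x) x
| feq_addN x : feq (FAdd (FScale (-1) x) x) FZero
| feq_scaleA c d x : feq (FScale c (FScale d x)) (FScale (c * d) x)
| feq_scale1 x : feq (FScale 1 x) x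
| feq_scaleDr c x y :
    feq (FScale c (FAdd x y)) (FAdd (FScale c x) (FScale c y))
| feq_scaleDl c d x :
    feq (FScale (c + d) x) (FAdd (FScale c x) (FScale d x))
| feq_act_linr u n c x y :
    feq (FAct u n (FAdd (FScale c x) y))
        (FAdd (FScale c (FAct u n x)) (FAct u n y))
| feq_act_linl c u v n x :
    feq (FAct (c *: u + v) n x) (FAdd (FScale c (FAct u n x)) (FAct v n x))
| feq_clifford u v m n x :
    feq (FAdd (FAct u m (FAct v n x)) (FAct v n (FAct u m x)))
        (if m + n + 1 == 0 then FScale (- 2%:R * B u v) x else FZero)
| feq_vac u (n : int) : 0 <= n -> feq (FAct u n FVac) FZero.

HB.instance Definition _ := gen_eqMixin fexpr.
HB.instance Definition _ := gen_choiceMixin fexpr.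

Definition feqb (x y : fexpr) : bool := `[< feq x y >].

Lemma feqb_refl : reflexive feqb.
Proof. by move=> x; apply/asboolP; exact: feq_refl. Qed.

Lemma feqb_sym : symmetric feqb.
Proof. by move=> x y; apply/asboolP/asboolP; exact: feq_sym. Qed.

Lemma feqb_trans : transitive feqb.
Proof.
move=> y x z /asboolP xy /asboolP yz; apply/asboolP; exact: feq_trans xy yz.
Qed.

Canonical feqb_equiv := EquivRel feqb feqb_refl feqb_sym feqb_trans.

Definition fock : Type := {eq_quot feqb_equiv}.
HB.instance Definition _ := Choice.on fock.
HB.instance Definition _ := EqQuotient.on fock.

Lemma fock_pi (x y : fexpr) : \pi_fock x = \pi_fock y <-> feq x y.
Proof.
split=> [/eqP|xy]; first by rewrite eqmodE => /asboolP.
by apply/eqP; rewrite eqmodE; apply/asboolP.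
Qed.

Lemma fock_repr (x : fexpr) : feq (repr (\pi_fock x)) x.
Proof. by apply/fock_pi; rewrite reprK. Qed.

Definition fock_vac : fock := \pi_fock FVac.
Definition fock_zero : fock := \pi_fock FZero.
Definition fock_add (x y : fock) : fock := \pi_fock (FAdd (repr x) (repr y)).
Definition fock_scale (c : R[i]) (x : fock) : fock := \pi_fock (FScale c (repr x)).
Definition fock_act (u : U) (n : int) (x : fock) : fock :=
  \pi_fock (FAct u n (repr x)).

Lemma fock_addE x y : fock_add (\pi_fock x) (\pi_fock y) = \pi_fock (FAdd x y).
Proof. by apply/fock_pi; apply: feq_add; exact: fock_repr. Qed.

Lemma fock_scaleE c x : fock_scale c (\pi_fock x) = \pi_fock (FScale c x).
Proof. by apply/fock_pi; apply: feq_scale; exact: fock_repr. Qed.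

Lemma fock_actE u n x : fock_act u n (\pi_fock x) = \pi_fock (FAct u n x).
Proof. by apply/fock_pi; apply: feq_act; exact: fock_repr. Qed.

Lemma fock_ind (P : fock -> Prop) : (forall x, P (\pi_fock x)) -> forall x, P x.
Proof. by move=> Ppi x; rewrite -(reprK x). Qed.

Lemma fock_addA : associative fock_add.
Proof.
elim/fock_ind=> x; elim/fock_ind=> y; elim/fock_ind=> z.
by rewrite !fock_addE; apply/fock_pi; exact: feq_addA.
Qed.

Lemma fock_addC : commutative fock_add.
Proof.
elim/fock_ind=> x; elim/fock_ind=> y.
by rewrite !fock_addE; apply/fock_pi; exact: feq_addC.
Qed.

Lemma fock_add0 : left_id fock_zero fock_add.
Proof.
by elim/fock_ind=> x; rewrite fock_addE; apply/fock_pi; exact: feq_add0.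
Qed.

Lemma fock_addN : left_inverse fock_zero (fock_scale (-1)) fock_add.
Proof.
elim/fock_ind=> x; rewrite fock_scaleE fock_addE.
by apply/fock_pi; exact: feq_addN.
Qed.

HB.instance Definition _ :=
  GRing.isZmodule.Build fock fock_addA fock_addC fock_add0 fock_addN.

Lemma fock_addrE (x y : fexpr) :
  \pi_fock x + \pi_fock y = \pi_fock (FAdd x y).
Proof. exact: fock_addE. Qed.

Lemma fock_scaleA c d x : fock_scale c (fock_scale d x) = fock_scale (c * d) x.
Proof.
elim/fock_ind: x => x; rewrite !fock_scaleE.
by apply/fock_pi; exact: feq_scaleA.
Qed.

Lemma fock_scale1 : left_id 1 fock_scale.
Proof.
by elim/fock_ind=> x; rewrite fock_scaleE; apply/fock_pi; exact: feq_scale1.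
Qed.

Lemma fock_scaleDr : right_distributive fock_scale +%R.
Proof.
move=> c; elim/fock_ind=> x; elim/fock_ind=> y.
rewrite fock_addrE !fock_scaleE fock_addrE.
by apply/fock_pi; exact: feq_scaleDr.
Qed.

Lemma fock_scaleDl (x : fock) : {morph fock_scale^~ x : c d / c + d}.
Proof.
move=> c d; elim/fock_ind: x => x.
rewrite !fock_scaleE fock_addrE.
by apply/fock_pi; exact: feq_scaleDl.
Qed.

HB.instance Definition _ := GRing.Zmodule_isLmodule.Build R[i] fock
  fock_scaleA fock_scale1 fock_scaleDr fock_scaleDl.

Lemma fock_scalerE c (x : fexpr) : c *: \pi_fock x = \pi_fock (FScale c x).
Proof. exact: fock_scaleE. Qed.

Lemma fock_act_linear u n : linear (fock_act u n).
Proof.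
move=> c; elim/fock_ind=> x; elim/fock_ind=> y.
rewrite fock_scalerE fock_addrE !fock_actE fock_scalerE fock_addrE.
by apply/fock_pi; exact: feq_act_linr.
Qed.

Lemma fock_act_linearl n x : linear (fun u => fock_act u n x).
Proof.
move=> c u v; elim/fock_ind: x => x.
rewrite !fock_actE fock_scalerE fock_addrE.
by apply/fock_pi; exact: feq_act_linl.
Qed.

Lemma fock_clifford u v (m n : int) (x : fock) :
  fock_act u m (fock_act v n x) + fock_act v n (fock_act u m x) =
  if m + n + 1 == 0 then (- 2%:R * B u v) *: x else 0.
Proof.
elim/fock_ind: x => x; rewrite !fock_actE fock_addrE.
have /fock_pi -> := feq_clifford u v m n x.
by case: ifP => // _; rewrite fock_scalerE.
Qed.

Lemma fock_act_vac u (n : int) : 0 <= n -> fock_act u n fock_vac = 0.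
Proof. by move=> n0; rewrite fock_actE; apply/fock_pi; exact: feq_vac. Qed.

Definition fock_word (s : seq (U * int)) : fock :=
  foldr (fun x v => fock_act x.1 x.2 v) fock_vac s.

Definition fock_gr (p : bool) : set fock :=
  lspan [set v | exists2 s, odd (size s) = p & v = fock_word s].

(* The vector u_1(-m_1-1/2) ... u_k(-m_k-1/2) 1. *)
Definition fock_monomial (s : seq (U * nat)) : fock :=
  fock_word [seq (x.1, - (x.2%:Z) - 1) | x <- s].

(* [normal_product s n] is the coefficient of z^(-n-1) in
     : D^(m_1)u_1(z) ... D^(m_k)u_k(z) :   for s = [:: (u_1,m_1);..;(u_k,m_k)].
   Here D^(m)u(z) = sum_p binz (-p-1) m u(p+1/2) z^(-p-1-m), and fermionic
   normal ordering keeps the creation modes (p < 0) on the left and moves the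
   annihilation modes (p >= 0) to the right, with a sign -1 for each mode
   passed.  The sum over p is finitely supported. *)
Fixpoint normal_product (s : seq (U * nat)) (n : int) (w : fock) : fock :=
  match s with
  | [::] => if n == -1 then w else 0
  | (u, m) :: s' =>
      \sum_(p \in [set: int]) binz R (- p - 1) m *:
        (if p < 0 then fock_act u p (normal_product s' (n - p - m%:Z - 1) w)
         else (-1) ^+ size s' *:
                normal_product s' (n - p - m%:Z - 1) (fock_act u p w))
  end.

(* The vertex operator map of the Clifford module: linear in the state and
   given on monomials by normally ordered products. *)
Definition is_fock_vertex_operator (Y : fock -> int -> fock -> fock) : Prop :=
  (forall n w, linear (fun v => Y v n w)) /\
  forall s n w, Y (fock_monomial s) n w = normal_product s n w.

Fixpoint fexpr_map (h : U -> U) (x : fexpr) : fexpr :=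
  match x with
  | FVac => FVac
  | FZero => FZero
  | FAdd y z => FAdd (fexpr_map h y) (fexpr_map h z)
  | FScale c y => FScale c (fexpr_map h y)
  | FAct u n y => FAct (h u) n (fexpr_map h y)
  end.

Definition fock_map (h : U -> U) (x : fock) : fock :=
  \pi_fock (fexpr_map h (repr x)).

Section IsometryAction.
Variable h : U -> U.
Hypotheses (h_lin : linear h) (h_iso : forall u v, B (h u) (h v) = B u v).

Lemma feq_map x y : feq x y -> feq (fexpr_map h x) (fexpr_map h y).
Proof.
elim=> {x y} /=; try by move=> *; constructor.
- by move=> x y z _ xy _ yz; exact: feq_trans xy yz.
- by move=> c u v n x; rewrite h_lin; constructor.
- move=> u v m n x; have := feq_clifford (h u) (h v) m n (fexpr_map h x).
  by rewrite h_iso; case: ifP.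
Qed.

Lemma fock_mapE x : fock_map h (\pi_fock x) = \pi_fock (fexpr_map h x).
Proof. by apply/fock_pi; apply: feq_map; exact: fock_repr. Qed.

Lemma fock_map_linear : linear (fock_map h).
Proof.
move=> c; elim/fock_ind=> x; elim/fock_ind=> y.
by rewrite fock_scalerE fock_addrE !fock_mapE fock_scalerE fock_addrE.
Qed.

Lemma fock_map_vac : fock_map h fock_vac = fock_vac.
Proof. by rewrite fock_mapE. Qed.

Lemma fock_map_act u n x :
  fock_map h (fock_act u n x) = fock_act (h u) n (fock_map h x).
Proof. by elim/fock_ind: x => x; rewrite fock_mapE !fock_actE fock_mapE. Qed.

End IsometryAction.

End CliffordModule.

Section Au.
Variables (R : realType) (a : vectType R[i]).

Definition uspace : Type := (a * 'Hom(a, R[i]^o))%type.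
HB.instance Definition _ := Vector.on uspace.

Definition uform (x y : uspace) : R[i] :=
  2%:R^-1 * ((x.2 y.1 : R[i]) + (y.2 x.1 : R[i])).

Definition Au : lmodType R[i] := fock uform.

Definition GL : {pred 'End(a)} := [pred g | lker g == 0%VS].

Definition GL_uspace (g : 'End(a)) (x : uspace) : uspace :=
  (g x.1, (x.2 \o g^-1)%VF).

Definition GL_Au (g : 'End(a)) : Au -> Au := fock_map (GL_uspace g).

Lemma GL_uspace_linear g : linear (GL_uspace g).
Proof.
move=> c [x f] [y k]; congr (_, _); rewrite /= ?linearP //.
by rewrite comp_lfunDl comp_lfunZl.
Qed.

Lemma GL_uspace_isometry g : g \in GL ->
  forall x y, uform (GL_uspace g x) (GL_uspace g y) = uform x y.
Proof.
by move=> /lker0_lfunK gK x y; rewrite /uform /= !comp_lfunE /= !gK.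
Qed.

Variables (N : nat) (b : N.-tuple a).

Definition ua (i : 'I_N) : uspace := (tnth b i, 0).

(* The functional dual to the i-th vector of the basis b. *)
Definition ua_dual (i : 'I_N) : uspace :=
  (0, linfun (coord b i : a -> R[i]^o)).

(* The orthonormal basis of u: [inl i] stands for i and [inr i] for i'. *)
Definition ue (k : 'I_N + 'I_N) : uspace :=
  match k with
  | inl i => ua i + ua_dual i
  | inr i => 'i *: (ua i - ua_dual i)
  end.

(* In monomials the exponent m of [(u, m)] stands for the mode u(-m-1/2). *)
Definition Au_omega : Au :=
  4%:R^-1 *: \sum_k fock_monomial uform [:: (ue k, 0%N); (ue k, 1%N)].

Definition Au_j : Au :=
  2%:R^-1 *:
    \sum_(i < N) fock_monomial uform [:: (ue (inl i), 0%N); (ue (inr i), 0%N)].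

Definition Au_Omega : set Au := [set Au_omega; Au_j].

End Au.

(* The group of all maps satisfying [aut] is isomorphic to GL(a) through rho. *)
Definition is_iso_from_GL (R : realType) (a : vectType R[i]) (T : Type)
    (rho : 'End(a) -> T -> T) (aut : set (T -> T)) : Prop :=
  [/\ {in GL (a := a), forall g, aut (rho g)},
      {in GL (a := a) &, forall g h x, rho (g \o h)%VF x = rho g (rho h x)},
      {in GL (a := a) &, injective rho}
    & forall phi, aut phi -> exists2 g, g \in GL (a := a) & rho g = phi].

(* Main.v *)
Require Import Defs.
From HB Require Import structures.
From mathcomp Require Import all_boot all_order all_algebra.
From mathcomp Require Import all_classical reals.
From mathcomp Require Import complex.
From mathcomp Require Import zify ring.
Set Implicit Arguments.
Unset Strict Implicit.
Unset Printing Implicit Defensive.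
Import Order.TTheory GRing.Theory Num.Theory.
Local Open Scope classical_set_scope.
Local Open Scope ring_scope.
Local Open Scope complex_scope.

(** The Clifford module is spanned by the monomials in the creation operators, and
    a linear map out of it may be prescribed by choosing the image of the vacuum
    and mutually anticommuting images of the creation operators
    ([creation_universal]). Everything rests on these two facts.

    - _Vertex operators._ Forming normally ordered products with the fields
      [D^(m)u(z)] gives anticommuting operators on the space of fields
      ([nprod_anti]); prescribing them as the images of the creation operators
      yields the map [Y], which is unique because monomials span.

    - _Vertex algebra._ For a creation mode [u_(l)], normal ordering is the iterate
      formula for [u_(l) x] ([normally_ordered_iterate]). Induction on the state
      turns it into the commutator formula with the generating modes
      ([act_commutator]), and the two together give skew-symmetry
      ([skew_symmetry]). The Borcherds identity is proved by induction on the total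
      length of the two states. It follows for all indices from the planes [m = 0]
      and [n = 0] ([borcherds_from_planes]). On the first plane both sides have the
      same commutators with the generating modes, since these involve only shorter
      states, and they agree on the vacuum ([associates_covariant]); the second
      plane is the mirror image of the first under skew-symmetry ([skew_plane]).

    - _Conformal structure._ The generating fields are primary of weight 1/2 for
      [omega] ([omega_act]). This determines the products of [omega] and [charge],
      hence the Virasoro relations with central charge [N], and makes every monomial
      homogeneous. A vector killed by all annihilation modes is killed by [omega_(1)],
      so it has weight 0 and is a multiple of the vacuum ([annihilated_vac]).

    - _Uniqueness of [omega] and [j]._ The vacuum and the iterated translates of
      [omega] and [charge] span a space closed under all the products, so [[Omega]]
      is small: its part of weight 1 is spanned by [charge] and that of weight 2 by
      [omega] and [T charge]. The axioms on a conformal vector leave only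
      [omega] ([conformal_unique]), and the commutator of the modes of [j] fixes the
      square of its coefficient on [charge] ([U1_vector_unique]).

    - _Self-duality._ On an irreducible module the annihilation modes anticommute and
      only finitely many of them act nontrivially on a given vector, so there is a
      nonzero vector which they all kill ([vacuum_vector]). The universal property
      sends the vacuum to it, and the resulting morphism is an isomorphism
      ([module_isomorphism]).

    - _Automorphisms._ An automorphism preserves the space of weight 1/2, which is
      the direct sum [u] of [a] and [a^*]; it acts there by an isometry commuting with
      [charge_(0)], that is, preserving [a] and [a^*], and such an isometry is given
      by an element of [GL(a)] acting dually on [a^*] ([automorphism_isometry],
      [isometry_GL]). Conversely every such isometry extends to an automorphism
      ([isometry_automorphism]). *)
(** * Finitely supported sums *)

Section LinearMaps.
Variables (K : pzRingType) (V W : lmodType K) (f : V -> W).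
Hypothesis f_lin : linear f.

Lemma lin0 : f 0 = 0.
Proof. by have := f_lin (-1) 0 0; rewrite scaler0 addr0 scaleN1r addNr. Qed.

Lemma linD x y : f (x + y) = f x + f y.
Proof. by have := f_lin 1 x y; rewrite !scale1r. Qed.

Lemma linZ c x : f (c *: x) = c *: f x.
Proof. by have := f_lin c x 0; rewrite !addr0 lin0 addr0. Qed.

Lemma linN x : f (- x) = - f x.
Proof. by rewrite -scaleN1r linZ scaleN1r. Qed.

Lemma linB x y : f (x - y) = f x - f y.
Proof. by rewrite linD linN. Qed.

Lemma lin_sum (I : Type) (r : seq I) (P : pred I) (F : I -> V) :
  f (\sum_(i <- r | P i) F i) = \sum_(i <- r | P i) f (F i).
Proof. by apply: (big_morph f linD lin0). Qed.

End LinearMaps.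

Lemma subrACA (V : zmodType) (x y z t : V) : x - y - (z - t) = x - z - (y - t).
Proof. by rewrite !(opprD, opprK) addrACA. Qed.

Section FiniteSums.
Variables (K : pzRingType) (V : lmodType K).
Implicit Types F G : nat -> V.

Definition fsum F : V := \sum_(j \in [set: nat]) F j.

Definition evz F := exists N : nat, forall j, (N <= j)%N -> F j = 0.

Lemma fsumE N F : (forall j, (N <= j)%N -> F j = 0) -> fsum F = \sum_(j < N) F j.
Proof.
move=> F0; rewrite /fsum fsbig_ord; symmetry.
apply: fsbig_widen => //= j [_ /= jN].
by apply: F0; rewrite leqNgt; apply/negP => /jN.
Qed.

Lemma eq_fsum F G : F =1 G -> fsum F = fsum G.
Proof. by move=> /funext ->. Qed.

Lemma fsum_eq0 F : (forall j, F j = 0) -> fsum F = 0.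
Proof. by move=> F0; rewrite (@fsumE 0) ?big_ord0. Qed.

Lemma fsum_single k F : (forall j, j != k -> F j = 0) -> fsum F = F k.
Proof.
move=> F0; rewrite (@fsumE k.+1) => [|j kj]; last first.
  by apply: F0; rewrite gtn_eqF.
by rewrite big_ord_recr /= big1 ?add0r // => i _; apply: F0; rewrite ltn_eqF.
Qed.

Lemma evz_eq F G : F =1 G -> evz F -> evz G.
Proof. by move=> /funext ->. Qed.

Lemma evz0 F : (forall j, F j = 0) -> evz F.
Proof. by exists 0%N. Qed.

Lemma evzD F G : evz F -> evz G -> evz (fun j => F j + G j).
Proof.
move=> [M FM] [N GN]; exists (maxn M N) => j.
by rewrite geq_max => /andP[jM jN]; rewrite FM ?GN ?addr0.
Qed.

Lemma evzZ (c : nat -> K) F : evz F -> evz (fun j => c j *: F j).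
Proof. by move=> [M FM]; exists M => j jM; rewrite FM ?scaler0. Qed.

Lemma evzN F : evz F -> evz (fun j => - F j).
Proof. by move=> [M FM]; exists M => j jM; rewrite FM ?oppr0. Qed.

Lemma evzB F G : evz F -> evz G -> evz (fun j => F j - G j).
Proof. by move=> hF hG; apply: evzD => //; apply: evzN. Qed.

Lemma evz_succ F : evz F -> evz (fun j => F j.+1).
Proof. by move=> [M FM]; exists M => j jM; apply/FM/leqW. Qed.

Lemma fsumD F G : evz F -> evz G -> fsum (fun j => F j + G j) = fsum F + fsum G.
Proof.
move=> [M FM] [N GN].
have le1 j : (maxn M N <= j)%N -> F j = 0 by rewrite geq_max => /andP[/FM].
have le2 j : (maxn M N <= j)%N -> G j = 0 by rewrite geq_max => /andP[_ /GN].
rewrite (fsumE le1) (fsumE le2) -big_split /=; apply: fsumE => j jMN.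
by rewrite le1 ?le2 ?addr0.
Qed.

Lemma fsumN F : evz F -> fsum (fun j => - F j) = - fsum F.
Proof.
move=> [M FM]; rewrite (fsumE FM) (@fsumE M) ?sumrN // => j jM.
by rewrite FM ?oppr0.
Qed.

Lemma fsumB F G : evz F -> evz G -> fsum (fun j => F j - G j) = fsum F - fsum G.
Proof. by move=> hF hG; rewrite fsumD ?fsumN //; apply: evzN. Qed.

Lemma fsumZ c F : evz F -> fsum (fun j => c *: F j) = c *: fsum F.
Proof.
move=> [M FM]; rewrite (fsumE FM) (@fsumE M) ?scaler_sumr // => j jM.
by rewrite FM ?scaler0.
Qed.

Lemma fsum_recl F : evz F -> fsum F = F 0%N + fsum (fun j => F j.+1).
Proof.
move=> [M FM].
rewrite (@fsumE M.+1) => [|j /ltnW/FM//].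
by rewrite (@fsumE M (fun j => F j.+1)) => [|j /leqW/FM//]; rewrite big_ord_recl.
Qed.

Lemma fsum_shift m F : evz F -> (forall j, (j < m)%N -> F j = 0) ->
  fsum F = fsum (fun j => F (j + m)%N).
Proof.
elim: m F => [|m IH] F hF F0; first by apply: eq_fsum => j; rewrite addn0.
rewrite fsum_recl // F0 // add0r IH; last by move=> j jm; apply: F0.
  by apply: eq_fsum => j; rewrite addnS.
exact: evz_succ.
Qed.

Lemma fsum_exchange N (F : nat -> nat -> V) :
  (forall i j, (N <= i)%N || (N <= j)%N -> F i j = 0) ->
  fsum (fun i => fsum (F i)) = fsum (fun j => fsum (F^~ j)).
Proof.
move=> F0; transitivity (\sum_(i < N) \sum_(j < N) F i j).
  rewrite (@fsumE N) => [|i Ni].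
    by apply: eq_bigr => i _; apply: fsumE => j Nj; rewrite F0 ?Nj ?orbT.
  by apply: fsum_eq0 => j; rewrite F0 ?Ni.
rewrite exchange_big /= (@fsumE N) => [|j Nj].
  by apply: eq_bigr => j _; symmetry; apply: fsumE => i Ni; rewrite F0 ?Ni.
by apply: fsum_eq0 => i; rewrite F0 ?Nj ?orbT.
Qed.

Lemma big_triangle n (G : nat -> nat -> V) :
  \sum_(i < n) \sum_(h < i.+1) G h (i - h)%N =
  \sum_(h < n) \sum_(t < n - h) G h t.
Proof.
elim: n => [|n IH]; first by rewrite !big_ord0.
rewrite big_ord_recr /= IH [RHS]big_ord_recr /= subSnn big_ord1.
rewrite big_ord_recr /= subnn addrA -big_split /=; congr (_ + _).
by apply: eq_bigr => h _; rewrite subSn ?big_ord_recr // ltnW.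
Qed.

(** With [G h t] the coefficient of the product of two expansions, the left-hand
    side collects the terms of equal total order. *)
Lemma fsum_triangle N (G : nat -> nat -> V) :
  (forall h t, (N <= h + t)%N -> G h t = 0) ->
  fsum (fun i => \sum_(h < i.+1) G h (i - h)%N) =
  fsum (fun h => fsum (G h)).
Proof.
move=> G0; rewrite (@fsumE N) => [|i Ni]; last first.
  by apply: big1 => h _; rewrite G0 // subnKC // -ltnS.
rewrite big_triangle (@fsumE N) => [|h Nh]; last first.
  by apply: fsum_eq0 => t; rewrite G0 // (leq_trans Nh) ?leq_addr.
apply: eq_bigr => h _; symmetry; apply: fsumE => t; rewrite leq_subLR.
exact: G0.
Qed.

(** Separates the annihilation modes from the creation modes, which [n => - n - 1]
    indexes by the natural numbers. *)
Lemma fsum_int (F : int -> V) :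
  evz (fun j => F j%:Z) -> evz (fun j => F (- j%:Z - 1)) ->
  \sum_(p \in [set: int]) F p =
  fsum (fun j => F (- j%:Z - 1)) + fsum (fun j => F j%:Z).
Proof.
move=> [M FM] [N FN].
pose A := [set` [seq - j%:Z - 1 | j <- iota 0 N] ++ [seq j%:Z | j <- iota 0 M]].
rewrite (fsumE FM) (fsumE FN) (_ : \sum_(p \in [set: int]) F p = \sum_(p \in A) F p).
  rewrite -fsbig_seq.
    rewrite big_cat !big_map /=.
    by rewrite -[X in iota 0 X]subn0 -[X in _ + \sum_(j <- iota 0 X) _]subn0 !big_mkord.
  rewrite cat_uniq !map_inj_uniq ?iota_uniq /=; last 2 first.
  - by move=> x y [].
  - by move=> x y; lia.
  rewrite andbT; apply/hasPn => x /mapP[j _ ->]; apply/mapP => -[k _]; lia.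
symmetry; apply: fsbig_widen => //= p [_ /=]; rewrite /A /= => /negP; rewrite mem_cat.
rewrite negb_or => /andP[/mapP pN /mapP pM].
case: (lerP 0 p) => p0.
- have -> : p = `|p|%N%:Z by lia.
  apply: FM; rewrite leqNgt; apply/negP => h; apply: pM.
  by exists `|p|%N; rewrite ?mem_iota //; lia.
- have -> : p = - (`|p|%N.-1)%:Z - 1 by lia.
  apply: FN; rewrite leqNgt; apply/negP => h; apply: pN.
  by exists `|p|%N.-1; rewrite ?mem_iota //; lia.
Qed.

End FiniteSums.

Section FiniteSumsLinear.
Variables (K : pzRingType) (V W : lmodType K) (f : V -> W).
Hypothesis f_lin : linear f.

Lemma evz_lin F : evz F -> evz (fun j => f (F j)).
Proof. by move=> [M FM]; exists M => j jM; rewrite FM ?(lin0 f_lin). Qed.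

Lemma lin_fsum F : evz F -> f (fsum F) = fsum (fun j => f (F j)).
Proof.
move=> [M FM]; rewrite (fsumE FM) (@fsumE _ _ M) ?(lin_sum f_lin) // => j jM.
by rewrite FM ?(lin0 f_lin).
Qed.

End FiniteSumsLinear.

(** * Generalised binomial coefficients *)

Section Binomials.
Variable R : realType.
Implicit Types (x : int) (j m n : nat).
Local Notation C := R[i].
Local Notation bin x j := (binz R x j).

Lemma i_neq0 : 'i != 0 :> C.
Proof. by rewrite -sqrf_eq0 sqr_i oppr_eq0 oner_eq0. Qed.

Lemma natC_neq0 n : n.+1%:R != 0 :> C.
Proof. by rewrite pnatr_eq0. Qed.

Lemma binz0 x : bin x 0 = 1.
Proof. by rewrite /binz big_ord0 fact0 divr1. Qed.

Lemma binz_absorb x j : j.+1%:R * bin x j.+1 = (x - j%:Z)%:~R * bin x j.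
Proof.
rewrite /binz big_ord_recr factS natrM /= invfM.
by rewrite mulrCA mulVKf ?natC_neq0 // mulrAC mulrC.
Qed.

Lemma binz_absorb1 x j : j.+1%:R * bin x j.+1 = x%:~R * bin (x - 1) j.
Proof.
rewrite /binz big_ord_recl factS natrM /= invfM subr0.
rewrite mulrCA mulVKf ?natC_neq0 // mulrA; congr (_ * _ / _).
by apply: eq_bigr => i _; congr (_%:~R); rewrite /bump /=; lia.
Qed.

Lemma binz_pascal x j : bin (x + 1) j.+1 = bin x j.+1 + bin x j.
Proof.
apply: (mulfI (natC_neq0 j)).
rewrite mulrDr binz_absorb1 binz_absorb addrK -mulrDl; congr (_ * _).
by rewrite -[j.+1%:R]/(j.+1%:Z%:~R) -intrD; congr (_%:~R); lia.
Qed.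

Lemma binz_nat n j : bin n%:Z j = 'C(n, j)%:R.
Proof.
elim: n j => [|n IH] [|j]; rewrite ?binz0 ?bin0 //.
  by apply: (mulfI (natC_neq0 j)); rewrite binz_absorb1 bin0n /= mul0r mulr0.
have -> : n.+1%:Z = n%:Z + 1 by lia.
by rewrite binz_pascal !IH binS natrD.
Qed.

Lemma binz_neg x j : bin (- x - 1) j = (-1) ^+ j * bin (x + j%:Z) j.
Proof.
elim: j => [|j IH] in x *; first by rewrite !binz0 mulr1.
apply: (mulfI (natC_neq0 j)); rewrite binz_absorb1 [RHS]mulrCA binz_absorb.
rewrite -opprD IH exprS.
have -> : x + j.+1%:Z - j%:Z = x + 1 by lia.
have -> : x + j.+1%:Z = x + 1 + j%:Z by lia.
by rewrite rmorphN /=; ring.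
Qed.

Lemma binz_sym m j : bin (m + j)%N%:Z j = bin (m + j)%N%:Z m.
Proof. by rewrite !binz_nat -(bin_sub (leq_addl m j)) addnK. Qed.

Lemma binz_small n j : (n < j)%N -> bin n%:Z j = 0.
Proof. by move=> nj; rewrite binz_nat bin_small. Qed.

(** Choosing [i] and then [h] among them is choosing [h] and then the rest. *)
Lemma binz_trinomial x h t :
  bin x (h + t) * bin (h + t)%N%:Z h = bin x h * bin (x - h%:Z) t.
Proof.
elim: t => [|t IH].
  by rewrite addn0 binz_nat binn !binz0 !mulr1.
apply: (mulfI (natC_neq0 t)); rewrite addnS.
have := binz_absorb x (h + t); have := binz_absorb (x - h%:Z) t.
have -> : x - h%:Z - t%:Z = x - (h + t)%N%:Z by lia.
have e : t.+1%:R * bin (h + t).+1%:Z h = (h + t).+1%:R * bin (h + t)%N%:Z h.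
  rewrite !binz_nat -!natrM; congr (_%:R).
  by have := mul_bin_down (h + t).+1 h; rewrite /= subSn ?leq_addr // addKn.
move=> e1 e2.
rewrite [RHS]mulrCA e1 [RHS]mulrCA -IH [LHS]mulrCA e.
rewrite mulrCA mulrA e2; ring.
Qed.

Lemma sign_add (l : int) (j : nat) : (-1) ^ (l + j%:Z) = (-1) ^ l * (-1) ^+ j :> C.
Proof. by rewrite exprzDr ?unitrN1. Qed.

Lemma sign_sub (l : int) (j : nat) : (-1) ^ (l - j%:Z) = (-1) ^ l * (-1) ^+ j :> C.
Proof. by rewrite exprzDr ?unitrN1 // -exprnN -signr_odd invr_sign. Qed.

Lemma sign_sqr (l : int) : (-1) ^ l * (-1) ^ l = 1 :> C.
Proof. by rewrite -exprMz_comm // ?unitrN1 // mulrNN mulr1 exp1rz. Qed.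

Lemma sign_sqrn (l : nat) : (-1) ^+ l * (-1) ^+ l = 1 :> C.
Proof. by rewrite -exprD -signr_odd oddD addbb. Qed.

Lemma sign_pred m : (-1) ^ (- m%:Z - 1) = - (-1) ^+ m :> C.
Proof.
rewrite -opprD -PoszD addn1 -exprnN exprS mulN1r invrN.
by rewrite -signr_odd invr_sign.
Qed.

Lemma binz_pred m j : (-1) ^+ j * bin (- m%:Z - 1) j = bin (m + j)%N%:Z m.
Proof. by rewrite binz_neg mulrA sign_sqrn mul1r -PoszD binz_sym. Qed.

End Binomials.
(** * Spans and the parity of the Fock space *)

Section Spans.
Variables (R : realType) (V : lmodType R[i]).
Implicit Types (X : set V) (Q : V -> Prop).

Lemma subspace0 Q : is_subspace Q -> Q 0.
Proof. by case. Qed.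

Lemma subspaceD Q x y : is_subspace Q -> Q x -> Q y -> Q (x + y).
Proof. by move=> [_ Ql] Qx Qy; rewrite -[x]scale1r; apply: Ql. Qed.

Lemma subspaceZ Q c x : is_subspace Q -> Q x -> Q (c *: x).
Proof. by move=> [Q0 Ql] Qx; rewrite -[_ *: _]addr0; apply: Ql. Qed.

Lemma subspaceN Q x : is_subspace Q -> Q x -> Q (- x).
Proof. by move=> Qs; rewrite -scaleN1r; apply: subspaceZ. Qed.

Lemma subspaceB Q x y : is_subspace Q -> Q x -> Q y -> Q (x - y).
Proof. by move=> Qs Qx Qy; apply: subspaceD => //; apply: subspaceN. Qed.

Lemma subspace_sum Q (I : Type) (r : seq I) (F : I -> V) :
  is_subspace Q -> (forall i, Q (F i)) -> Q (\sum_(i <- r) F i).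
Proof.
move=> Qs QF; elim/big_ind: _ => //; first exact: subspace0.
by move=> x y; apply: subspaceD.
Qed.

Lemma lspan_subspace X : is_subspace (lspan X).
Proof.
split=> [|c v w [s sX ->] [t tX ->]]; first by exists [::]; rewrite ?big_nil.
exists ([seq (c * x.1, x.2) | x <- s] ++ t).
  move=> x; rewrite mem_cat => /orP[/mapP[y ys ->]|/tX //]; exact: sX ys.
rewrite big_cat big_map scaler_sumr /=; congr (_ + _).
by apply: eq_bigr => i _; rewrite scalerA.
Qed.

Lemma lspan_gen X x : X x -> lspan X x.
Proof.
move=> Xx; exists [:: (1, x)]; last by rewrite big_seq1 scale1r.
by move=> y; rewrite inE => /eqP ->.
Qed.

Lemma lspan_min X Q : is_subspace Q -> (forall x, X x -> Q x) ->
  forall x, lspan X x -> Q x.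
Proof.
move=> Qs XQ _ [s sX ->]; elim: s sX => [|y s IH] sX.
  by rewrite big_nil; apply: subspace0.
rewrite big_cons; case: Qs => Q0 Ql; apply: Ql.
  by apply: XQ; apply: sX; rewrite mem_head.
by apply: IH => z zs; apply: sX; rewrite in_cons zs orbT.
Qed.

Lemma lspan_sub X X' : X `<=` X' -> lspan X `<=` lspan X'.
Proof. by move=> XX' x [s sX ->]; exists s => // y /sX /XX'. Qed.

(** Solution spaces of linear equations, the subspaces used in inductions over
    a spanning set. *)
Lemma subspace_eq (W : lmodType R[i]) (f g : V -> W) :
  linear f -> linear g -> is_subspace (fun v => f v = g v).
Proof.
move=> fl gl; split; first by rewrite !lin0.
by move=> c v w fv fw; rewrite fl gl fv fw.
Qed.

Lemma subspace_all (T : Type) (Q : T -> V -> Prop) :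
  (forall t, is_subspace (Q t)) -> is_subspace (fun v => forall t, Q t v).
Proof.
move=> Qs; split=> [t|c v w Qv Qw t]; first by case: (Qs t).
by case: (Qs t) => _; apply.
Qed.

End Spans.

Section LinearCombinators.
Variables (K : comPzRingType) (U V W : lmodType K).

Lemma linear_comp (f : V -> W) (g : U -> V) :
  linear f -> linear g -> linear (fun x => f (g x)).
Proof. by move=> fl gl c x y; rewrite gl fl. Qed.

Lemma linear_id : linear (fun x : V => x).
Proof. by []. Qed.

Lemma linear_zero : linear (fun _ : U => 0 : V).
Proof. by move=> c x y; rewrite scaler0 addr0. Qed.

Lemma linear_add (f g : U -> V) :
  linear f -> linear g -> linear (fun x => f x + g x).
Proof. by move=> fl gl c x y; rewrite fl gl scalerDr addrACA. Qed.

Lemma linear_scale a (f : U -> V) : linear f -> linear (fun x => a *: f x).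
Proof. by move=> fl c x y; rewrite fl scalerDr !scalerA mulrC. Qed.

Lemma linear_opp (f : U -> V) : linear f -> linear (fun x => - f x).
Proof. by move=> fl c x y; rewrite fl opprD scalerN. Qed.

Lemma linear_sub (f g : U -> V) :
  linear f -> linear g -> linear (fun x => f x - g x).
Proof. by move=> fl gl; apply: linear_add => //; apply: linear_opp. Qed.

Lemma linear_fsum (f : nat -> U -> V) :
  (forall j, linear (f j)) -> (forall x, evz (f^~ x)) ->
  linear (fun x => fsum (f^~ x)).
Proof.
move=> fl fz c x y; rewrite -fsumZ // -fsumD //; last exact: evzZ.
by apply: eq_fsum => j; rewrite fl.
Qed.

End LinearCombinators.

Section FockSpace.
Variables (R : realType) (U : lmodType R[i]) (B : U -> U -> R[i]).
Local Notation C := R[i].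
Local Notation V := (fock B).
Local Notation act := (@fock_act R U B).
Local Notation vac := (fock_vac B).
Local Notation mono := (@fock_monomial R U B).
Local Notation bin x j := (binz R x j).
Local Notation sbin l j := ((-1) ^+ j * binz R l j).

Lemma fock_gen_ind (Q : V -> Prop) : is_subspace Q -> Q vac ->
  (forall u n x, Q x -> Q (act u n x)) -> forall x, Q x.
Proof.
move=> Qs Qvac Qact; elim/fock_ind; elim.
- exact: Qvac.
- exact: (subspace0 Qs).
- by move=> x Qx y Qy; rewrite -fock_addrE; apply: subspaceD.
- by move=> c x Qx; rewrite -fock_scalerE; apply: subspaceZ.
- by move=> u n x Qx; rewrite -fock_actE; apply: Qact.
Qed.

Lemma act_linear u n : linear (act u n). Proof. exact: fock_act_linear. Qed.
Lemma actDr u n : {morph act u n : x y / x + y}.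
Proof. exact: linD (act_linear u n). Qed.
Lemma actZr u n c x : act u n (c *: x) = c *: act u n x.
Proof. exact: linZ (act_linear u n) c x. Qed.
Lemma actNr u n x : act u n (- x) = - act u n x.
Proof. exact: linN (act_linear u n) x. Qed.
Lemma act0r u n : act u n 0 = 0.
Proof. exact: lin0 (act_linear u n). Qed.

Lemma act_swap u v m n x : act u m (act v n x) =
  (if m + n + 1 == 0 then (- 2%:R * B u v) *: x else 0) - act v n (act u m x).
Proof. by apply/eqP; rewrite -fock_clifford addrK. Qed.

Lemma monoE u m s : mono ((u, m) :: s) = act u (- m%:Z - 1) (mono s).
Proof. by []. Qed.

(** Spanned by the monomials of length [k]. Annihilation modes lower the length by
    one and creation modes raise it, which is what the inductions on states use. *)
Definition level (k : nat) : set V :=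
  lspan [set v | exists2 s : seq (U * nat), size s = k & v = mono s].

Lemma level_subspace k : is_subspace (level k).
Proof. exact: lspan_subspace. Qed.

Lemma level_mono s : level (size s) (mono s).
Proof. by apply: lspan_gen; exists s. Qed.

Lemma level_min k (Q : V -> Prop) : is_subspace Q ->
  (forall s, size s = k -> Q (mono s)) -> forall x, level k x -> Q x.
Proof. by move=> Qs Qm; apply: (lspan_min Qs) => _ [s sk ->]; apply: Qm. Qed.

Lemma level_zero k : level k 0.
Proof. exact: (subspace0 (level_subspace k)). Qed.

Lemma level_lin k c x y : level k x -> level k y -> level k (c *: x + y).
Proof. by case: (level_subspace k) => _; apply. Qed.

Lemma level_create k u (m : nat) x :
  level k x -> level k.+1 (act u (- m%:Z - 1) x).
Proof.
move: x; apply: level_min => [|s <-].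
  split; first by rewrite act0r; apply: level_zero.
  by move=> c v w; rewrite fock_act_linear; apply: level_lin.
by apply: lspan_gen; exists ((u, m) :: s).
Qed.

Lemma level_ind (Q : nat -> V -> Prop) : (forall k, is_subspace (Q k)) ->
  Q 0%N vac ->
  (forall k u (m : nat) x, level k x -> Q k x -> Q k.+1 (act u (- m%:Z - 1) x)) ->
  forall k x, level k x -> Q k x.
Proof.
move=> Qs Q0 QS k; apply: level_min => // s <-; elim: s => [//|[u m] s IH].
by rewrite monoE /=; apply: QS => //; apply: level_mono.
Qed.

(** Moving the annihilation mode to the right removes one creation operator at a
    time and finally meets the vacuum. *)
Lemma level_annihilate k u (n : int) x : 0 <= n ->
  level k x -> (if k is k'.+1 then level k' else eq^~ 0) (act u n x).
Proof.
move=> n0; move: k x; apply: level_ind.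
- case=> [|k]; split; rewrite ?act0r //; try exact: level_zero.
    by move=> c v w; rewrite fock_act_linear => -> ->; rewrite scaler0 addr0.
  by move=> c v w; rewrite fock_act_linear; apply: level_lin.
- exact: fock_act_vac.
- move=> k v m x xk IH; rewrite act_swap; apply: subspaceB.
  + exact: level_subspace.
  + case: ifP => _; last exact: level_zero.
    by apply: subspaceZ => //; apply: level_subspace.
  + case: k xk IH => [_ ->|k _]; last exact: level_create.
    by rewrite act0r; apply: level_zero.
Qed.

Lemma act_level_ge0 k u (n : nat) x : level k.+1 x -> level k (act u n x).
Proof. exact: (@level_annihilate k.+1 u n x isT). Qed.

Lemma act_level0 u (n : nat) x : level 0 x -> act u n x = 0.
Proof. exact: (@level_annihilate 0 u n x isT). Qed.

Definition monomials : set V := [set v | exists s, v = mono s].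

Lemma level_monomials k x : level k x -> lspan monomials x.
Proof. by apply: lspan_sub => _ [s _ ->]; exists s. Qed.

Lemma monomials_min (Q : V -> Prop) : is_subspace Q ->
  (forall s, Q (mono s)) -> forall x, lspan monomials x -> Q x.
Proof. by move=> Qs Qm; apply: (lspan_min Qs) => _ [s ->]; apply: Qm. Qed.

Lemma monomials_span x : lspan monomials x.
Proof.
move: x; apply: fock_gen_ind; first exact: lspan_subspace.
- by apply: lspan_gen; exists [::].
- move=> u n; apply: monomials_min.
    split; first by rewrite act0r; apply: (subspace0 (lspan_subspace _)).
    move=> c v w; rewrite fock_act_linear.
    by case: (lspan_subspace monomials) => _; apply.
  move=> s; case: n => n.
    have := level_annihilate u (isT : 0 <= n%:Z) (level_mono s).
    case: (size s) => [->|k]; first exact: (subspace0 (lspan_subspace _)).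
    exact: level_monomials.
  have -> : Negz n = - n%:Z - 1 by lia.
  by apply: lspan_gen; exists ((u, n) :: s).
Qed.

Lemma fock_ind_levels (Q : V -> Prop) : is_subspace Q ->
  (forall k x, level k x -> Q x) -> forall x, Q x.
Proof.
move=> Qs Ql x; apply: monomials_min (monomials_span x) => // s.
exact/Ql/level_mono.
Qed.

Lemma act_truncation x : exists N : nat, forall u (n : int), N%:Z <= n ->
  act u n x = 0.
Proof.
move: x; apply: fock_gen_ind.
- split; first by exists 0%N => u n _; rewrite act0r.
  move=> c v w [M vM] [N wN]; exists (maxn M N) => u n n0.
  by rewrite fock_act_linear vM ?wN ?scaler0 ?addr0 //; lia.
- by exists 0%N => u n n0; rewrite fock_act_vac.
- move=> u n x [N xN]; exists (maxn N `|n|.+1) => v m m0.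
  rewrite act_swap xN ?act0r ?subr0; last by lia.
  by rewrite ifF //; lia.
Qed.

(** The map [-1] of [U] is an isometry; the action it induces is the parity
    involution. Signs are obtained by conjugating with it rather than by
    splitting vectors into homogeneous parts. *)
Definition parity : V -> V := fock_map (@GRing.opp U).

Hypothesis B_linl : forall c u v w, B (c *: u + v) w = c * B u w + B v w.
Hypothesis B_sym : forall u v, B u v = B v u.

Lemma B_Nl u v : B (- u) v = - B u v.
Proof.
have B0 : B 0 v = 0.
  by have := B_linl (-1) 0 0 v; rewrite scaler0 addr0 mulN1r addNr.
by have := B_linl (-1) u 0 v; rewrite scaleN1r addr0 B0 addr0 mulN1r.
Qed.

Lemma B_Nr u v : B u (- v) = - B u v.
Proof. by rewrite B_sym B_Nl B_sym. Qed.

Let opp_linear : linear (@GRing.opp U).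
Proof. by move=> c u v; rewrite opprD scalerN. Qed.

Let opp_iso u v : B (- u) (- v) = B u v.
Proof. by rewrite B_Nl B_Nr opprK. Qed.

Lemma parity_linear : linear parity.
Proof. exact: fock_map_linear. Qed.

Lemma parity_vac : parity vac = vac.
Proof. exact: fock_map_vac. Qed.

Lemma parity_act u n x : parity (act u n x) = - act u n (parity x).
Proof.
rewrite /parity fock_map_act // -scaleN1r.
by have := fock_act_linearl n (parity x) (-1) u 0; rewrite addr0 scaleN1r => ->;
  rewrite (lin0 (fock_act_linearl n (parity x))) addr0.
Qed.

Lemma parityK x : parity (parity x) = x.
Proof.
move: x; apply: fock_gen_ind => [||u n x IH].
- by apply: subspace_eq => //; apply: linear_comp; apply: parity_linear.
- by rewrite !parity_vac.
- by rewrite !parity_act (linN parity_linear) parity_act opprK IH.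
Qed.

Lemma level_parity k x : level k x -> parity x = (-1) ^+ k *: x.
Proof.
move: k x; apply: level_ind.
- move=> k; apply: subspace_eq; first exact: parity_linear.
  exact/linear_scale/linear_id.
- by rewrite parity_vac scale1r.
- by move=> k u m x _ IH; rewrite parity_act IH actZr exprS mulN1r scaleNr.
Qed.

Lemma word_parity s :
  parity (fock_word B s) = (-1) ^+ odd (size s) *: fock_word B s.
Proof.
elim: s => [|[u n] s IH] /=; first by rewrite parity_vac scale1r.
rewrite parity_act IH actZr -scaleNr; congr (_ *: _).
by case: odd; rewrite ?expr0 ?expr1 ?opprK.
Qed.

Lemma parity_levels (Q : V -> Prop) p : is_subspace Q ->
  (forall k x, level k x -> odd k = p -> Q x) ->
  forall x, parity x = (-1) ^+ p *: x -> Q x.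
Proof.
move=> Qs Ql x px.
have -> : x = 2%:R^-1 *: (x + (-1) ^+ p *: parity x).
  rewrite px scalerA -expr2 sqrr_sign scale1r -mulr2n -[x *+ 2]scaler_nat.
  by rewrite scalerA mulVf ?scale1r // pnatr_eq0.
apply: subspaceZ => //.
move: x {px}; apply: fock_ind_levels => [|k x xk].
  split; first by rewrite (lin0 parity_linear) scaler0 addr0; apply: subspace0.
  move=> c v w Qv Qw; rewrite parity_linear !scalerDr addrACA.
  rewrite [(-1) ^+ p *: (c *: _)]scalerA mulrC -scalerA -scalerDr.
  by case: Qs => _; apply.
rewrite (level_parity xk); case: (odd k =P p) => [kp|kp].
  rewrite -kp signr_odd scalerA -expr2 -exprM mulnC exprM sqrrN expr1n expr1n.
  rewrite scale1r -mulr2n -[_ *+ 2]scaler_nat.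
  by apply: subspaceZ => //; apply: Ql xk _.
rewrite -(signr_odd _ k) scalerA -signr_addb (_ : p (+) odd k = true).
  by rewrite expr1 scaleN1r subrr; apply: subspace0.
by move: kp; case: (odd k); case: (p) => // kp; case: kp.
Qed.

Lemma grP p x : fock_gr p x <-> parity x = (-1) ^+ p *: x.
Proof.
split=> [|px].
  move: x; apply: (@lspan_min _ _ _ (fun x => parity x = (-1) ^+ p *: x)); last first.
    by move=> _ [s <- ->]; apply: word_parity.
  apply: subspace_eq; first exact: parity_linear.
  exact/linear_scale/linear_id.
have gs : is_subspace (@fock_gr R U B p) by apply: lspan_subspace.
apply: parity_levels px => // k {}x xk kp; move: x xk.
apply: lspan_sub => _ [s sk ->].
by exists [seq (x.1, - (x.2%:Z) - 1) | x <- s]; rewrite ?size_map ?sk.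
Qed.

Lemma level_gr k x : level k x -> fock_gr (odd k) x.
Proof. by move=> /level_parity px; apply/grP; rewrite px signr_odd. Qed.

Lemma fock_gr_grading : is_grading (@fock_gr R U B).
Proof.
split=> [p|v|v /grP v0 /grP].
- exact: lspan_subspace.
- exists (2%:R^-1 *: (v + parity v)), (2%:R^-1 *: (v - parity v)); split.
  + apply/grP; rewrite (linZ parity_linear) (linD parity_linear) parityK.
    by rewrite scale1r addrC.
  + apply/grP; rewrite (linZ parity_linear) (linB parity_linear) parityK.
    by rewrite expr1 scaleN1r -scalerN opprB.
  + rewrite -scalerDr addrACA subrr addr0 -mulr2n -[v *+ 2]scaler_nat.
    by rewrite scalerA mulVf ?scale1r // pnatr_eq0.
- rewrite v0 expr0 expr1 scale1r scaleN1r => /eqP.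
  rewrite -addr_eq0 -mulr2n -[v *+ 2]scaler_nat scaler_eq0 pnatr_eq0 /=.
  by move=> /eqP.
Qed.

(** * Universal properties of the Fock space *)

Section CliffordModules.
Variables (W : lmodType C) (A : U -> int -> W -> W) (P : W -> Prop) (w0 : W).
Hypotheses (P_sub : is_subspace P) (P_w0 : P w0).
Hypothesis P_A : forall u n x, P x -> P (A u n x).
Hypothesis A_linr : forall u n c x y, P x -> P y ->
  A u n (c *: x + y) = c *: A u n x + A u n y.
Hypothesis A_linl : forall c u v n x, P x ->
  A (c *: u + v) n x = c *: A u n x + A v n x.
Hypothesis A_clifford : forall u v m n x, P x ->
  A u m (A v n x) + A v n (A u m x) =
  if m + n + 1 == 0 then (- 2%:R * B u v) *: x else 0.
Hypothesis A_w0 : forall u (n : int), 0 <= n -> A u n w0 = 0.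

Fixpoint interp (x : fexpr U) : W :=
  match x with
  | FVac => w0
  | FZero => 0
  | FAdd y z => interp y + interp z
  | FScale c y => c *: interp y
  | FAct u n y => A u n (interp y)
  end.

Lemma interpP x : P (interp x).
Proof.
elim: x => //= [|x Px y Py|c x Px|u n x Px].
- exact: (subspace0 P_sub).
- exact: subspaceD.
- exact: subspaceZ.
- exact: P_A.
Qed.

Lemma feq_interp x y : feq B x y -> interp x = interp y.
Proof.
elim=> //= {x y}.
- by move=> x y z _ -> _ ->.
- by move=> x x' y y' _ -> _ ->.
- by move=> c x x' _ ->.
- by move=> u n x x' _ ->.
- by move=> x y z; rewrite addrA.
- by move=> x y; rewrite addrC.
- by move=> x; rewrite add0r.
- by move=> x; rewrite scaleN1r addNr.
- by move=> c d x; rewrite scalerA.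
- by move=> x; rewrite scale1r.
- by move=> c x y; rewrite scalerDr.
- by move=> c d x; rewrite scalerDl.
- by move=> u n c x y; apply: A_linr; apply: interpP.
- by move=> c u v n x; apply: A_linl; apply: interpP.
- move=> u v m n x; rewrite A_clifford; last exact: interpP.
  by case: ifP.
Qed.

(** Maps out of the Fock space are interpretations of the formal expressions;
    the relations are only ever used on the vectors satisfying [P]. *)
Lemma clifford_universal : exists phi : V -> W,
  [/\ linear phi, phi vac = w0,
      forall u n x, phi (act u n x) = A u n (phi x) & forall x, P (phi x)].
Proof.
pose phi (x : V) := interp (repr x).
have phiE x : phi (\pi_(fock B)%qT x) = interp x.
  exact/feq_interp/fock_repr.
exists phi; split.
- move=> c; elim/fock_ind=> x; elim/fock_ind=> y.
  by rewrite fock_scalerE fock_addrE !phiE.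
- by rewrite phiE.
- by move=> u n; elim/fock_ind=> x; rewrite fock_actE !phiE.
- by move=> x; apply: interpP.
Qed.

End CliffordModules.

Section CreationModules.
Variables (W : lmodType C) (c : U -> nat -> W -> W) (P : W -> Prop) (w0 : W).
Hypotheses (P_sub : is_subspace P) (P_w0 : P w0).
Hypothesis P_c : forall u m x, P x -> P (c u m x).
Hypothesis c_linr : forall u m a x y, P x -> P y ->
  c u m (a *: x + y) = a *: c u m x + c u m y.
Hypothesis c_linl : forall a u v m x, P x ->
  c (a *: u + v) m x = a *: c u m x + c v m x.
Hypothesis c_anti : forall u v m n x, P x ->
  c u m (c v n x) + c v n (c u m x) = 0.

Local Notation letter := (U * nat)%type.
Local Notation fam := (seq letter -> W).

(** A vector [x] of the module coinduced from [W] is recorded by the family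
    sending a word [d_1 ... d_k] of annihilation operators to the component in
    [W] of [d_k ... d_1 x]. The recursion below moves a creation operator
    through the word. *)
Definition ann (d : letter) (f : fam) : fam := fun s => f (d :: s).

Definition pairing (d e : letter) : C :=
  if d.2 == e.2 then - 2%:R * B d.1 e.1 else 0.

Fixpoint create (u : U) (m : nat) (s : seq letter) (f : fam) : W :=
  if s is d :: s' then
    pairing d (u, m) *: f s' - create u m s' (ann d f)
  else c u m (f [::]).

Definition cre u m (f : fam) : fam := fun s => create u m s f.

Definition coinduced (f : fam) : Prop :=
  [/\ forall s, P (f s),
      forall s1 s2 d e, f (s1 ++ d :: e :: s2) = - f (s1 ++ e :: d :: s2)
    & forall s1 s2 a u v k, f (s1 ++ (a *: u + v, k) :: s2) =
        a *: f (s1 ++ (u, k) :: s2) + f (s1 ++ (v, k) :: s2)].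

Lemma coinduced_subspace : is_subspace coinduced.
Proof.
split.
  split=> [s|s1 s2 d e|s1 s2 a u v k]; first exact: (subspace0 P_sub).
    by rewrite -[LHS]/(0 : W) -[X in - X]/(0 : W) oppr0.
  by rewrite -[LHS]/(0 : W) -[X in _ *: X + _]/(0 : W)
    -[X in _ + X]/(0 : W) scaler0 addr0.
move=> a f g [fP fa fl] [gP ga gl]; split=> [s|s1 s2 d e|s1 s2 b u v k].
- by case: P_sub => _; apply.
- by rewrite !fctE /= fa ga opprD scalerN.
- rewrite !fctE /= fl gl !scalerDr !scalerA [a * b]mulrC.
  by rewrite addrACA.
Qed.

Lemma coinduced_ann d f : coinduced f -> coinduced (ann d f).
Proof.
move=> [fP fa fl]; split=> [s|s1 s2|s1 s2]; first exact: fP.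
  exact: (fa (d :: s1)).
exact: (fl (d :: s1)).
Qed.

Lemma create_lin u m s a f g : (forall s, P (f s)) -> (forall s, P (g s)) ->
  create u m s (a *: f + g) = a *: create u m s f + create u m s g.
Proof.
elim: s f g => [|d s IH] f g fP gP /=; first exact: c_linr.
rewrite -[ann d _]/(a *: ann d f + ann d g) IH; last 2 first.
- by move=> t; apply: fP.
- by move=> t; apply: gP.
rewrite -[(a *: f + g) s]/(a *: f s + g s) opprD scalerBr scalerDr !scalerA.
by rewrite [a * _]mulrC addrACA.
Qed.

Lemma create0 u m s : create u m s (fun=> 0) = 0.
Proof.
elim: s => [|d s IH] /=; last by rewrite IH scaler0 subr0.
by have := c_linr u m (-1) P_w0 P_w0; rewrite !scaleN1r !addNr.
Qed.

Lemma create_opp u m s f : (forall s, P (f s)) ->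
  create u m s (fun t => - f t) = - create u m s f.
Proof.
move=> fP; have -> : (fun t => - f t) = (-1) *: f + (fun=> 0).
  by apply/funext => t; rewrite -[RHS]/(-1 *: f t + 0) addr0 scaleN1r.
rewrite create_lin ?create0 ?addr0 ?scaleN1r // => t; exact: (subspace0 P_sub).
Qed.

Lemma createP u m s f : (forall t, P (f t)) -> P (create u m s f).
Proof.
elim: s f => [|d s IH] f fP /=; first exact: P_c.
apply: subspaceB => //; first exact: subspaceZ.
by apply: IH => t; apply: fP.
Qed.

Lemma pairing_linl a u v k e :
  pairing (a *: u + v, k) e = a * pairing (u, k) e + pairing (v, k) e.
Proof.
rewrite /pairing /=; case: ifP => _; last by rewrite mulr0 addr0.
by rewrite B_linl mulrDr mulrCA.
Qed.

Lemma pairing_linr a u v k e :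
  pairing e (a *: u + v, k) = a * pairing e (u, k) + pairing e (v, k).
Proof.
rewrite /pairing /=; case: ifP => _; last by rewrite mulr0 addr0.
by rewrite B_sym B_linl mulrDr mulrCA !(B_sym e.1).
Qed.

Lemma coinduced_cre u m f : coinduced f -> coinduced (cre u m f).
Proof.
move=> fc; split=> [s|s1 s2 d e|s1 s2 a v w k].
- by apply: createP; case: fc.
- rewrite /cre; elim: s1 f fc => [|x s1 IH] f fc /=; last first.
    have [_ fa _] := fc; rewrite fa IH; last exact: coinduced_ann.
    by rewrite scalerN opprD.
  have -> : ann e (ann d f) = (fun t => - ann d (ann e f) t).
    by apply/funext => t; case: fc => _ fa _; apply: (fa [::]).
  rewrite create_opp; last by case: fc => fP _ _ t; apply: fP.
  rewrite /ann /=; set X := _ *: f (e :: _); set Y := _ *: f (d :: _).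
  by rewrite opprK [RHS]opprB opprD addrA addrAC.
- rewrite /cre; elim: s1 f fc => [|x s1 IH] f fc /=; last first.
    have [_ _ fl] := fc; rewrite fl IH; last exact: coinduced_ann.
    by rewrite scalerDr scalerBr opprD !scalerA [a * _]mulrC addrACA.
  rewrite pairing_linl scalerDl -scalerA.
  have -> : ann (a *: v + w, k) f = a *: ann (v, k) f + ann (w, k) f.
    by apply/funext => t; case: fc => _ _ fl; apply: (fl [::]).
  rewrite create_lin; first by rewrite scalerBr opprD addrACA.
  + by case: fc => fP _ _ t; apply: fP.
  + by case: fc => fP _ _ t; apply: fP.
Qed.

Lemma create_linl a u v m s f : coinduced f ->
  create (a *: u + v) m s f = a *: create u m s f + create v m s f.
Proof.
elim: s f => [|d s IH] f fc /=; first by apply: c_linl; case: fc.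
rewrite IH; last exact: coinduced_ann.
by rewrite pairing_linr scalerDl -scalerA scalerBr opprD addrACA.
Qed.

Lemma ann_cre u m d f : ann d (cre u m f) = pairing d (u, m) *: f - cre u m (ann d f).
Proof. by []. Qed.

Lemma create_anti u v m n s f : coinduced f ->
  create u m s (cre v n f) + create v n s (cre u m f) = 0.
Proof.
elim: s f => [|d s IH] f fc /=; first by apply: c_anti; case: fc.
have dfc := coinduced_ann d fc.
have E w k (g : fam) a : coinduced g ->
    create w k s (a *: f - g) = a *: create w k s f - create w k s g.
  move=> [gP _ _]; case: (fc) => fP _ _.
  rewrite create_lin //; last by move=> t; apply: subspaceN.
  by congr (_ + _); apply: create_opp.
rewrite !ann_cre !E; try exact: coinduced_cre.
have cancel (x y p q : W) : p + q = 0 -> x - (y - p) + (y - (x - q)) = 0.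
  by move=> pq; rewrite !opprB !addrA subrK -[x + p + q]addrA pq addr0 subrr.
exact/cancel/IH.
Qed.

(** The coinduced module is a Clifford module because the creation operators of [W]
    anticommute; the map out of the Fock space that it receives is followed by the
    evaluation at the empty word. *)
Lemma creation_universal : exists phi : V -> W,
  [/\ linear phi, phi vac = w0,
      forall u (m : nat) x, phi (act u (- m%:Z - 1) x) = c u m (phi x)
    & forall x, P (phi x)].
Proof.
pose A u (n : int) (f : fam) : fam :=
  match n with Posz k => ann (u, k) f | Negz m => cre u m f end.
pose F0 : fam := fun s => if s is [::] then w0 else 0.
have F0c : coinduced F0.
  split=> [[|d s]|s1 s2 d e|s1 s2 a u v k] //; first exact: (subspace0 P_sub).
    by case: s1 => [|? ?]; rewrite oppr0.
  by case: s1 => [|? ?]; rewrite scaler0 addr0.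
have [phi [phil phi0 phiA phiP]] : exists phi : V -> fam,
    [/\ linear phi, phi vac = F0,
      forall u n x, phi (act u n x) = A u n (phi x) & forall x, coinduced (phi x)].
  apply: clifford_universal => //.
  - exact: coinduced_subspace.
  - by move=> u [n|n] x xc; [apply: coinduced_ann | apply: coinduced_cre].
  - move=> u [n|n] a x y [xP _ _] [yP _ _] //=.
    by apply/funext => s; apply: create_lin.
  - move=> a u v [n|n] x xc; apply/funext => s /=.
      by case: xc => _ _ xl; apply: (xl [::]).
    exact: create_linl.
  - have pairC w w' k k' : pairing (w, k) (w', k') =
        if k%:Z + Negz k' + 1 == 0 then - 2%:R * B w w' else 0.
      by rewrite /pairing /=; congr (if _ then _ else _); lia.
    have fctD (f g : fam) s : (f + g) s = f s + g s by [].
    move=> u v [m|m] [n|n] x xc; apply/funext => s; rewrite fctD.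
    + rewrite ifF; last by lia.
      case: xc => _ xa _.
      by rewrite -[LHS]/(x [:: (v, n), (u, m) & s] + x [:: (u, m), (v, n) & s])
        (xa [::]) addNr.
    + rewrite -[A u m _ s]/((pairing (u, m%N) (v, n) *: x -
        cre v n (ann (u, m%N) x)) s) subrK pairC.
      by case: ifP => _ //; rewrite scale0r.
    + rewrite [LHS]addrC -[A v n _ s]/((pairing (v, n%N) (u, m) *: x -
        cre u m (ann (v, n%N) x)) s) subrK pairC.
      rewrite B_sym [Negz m + _]addrC.
      by case: ifP => _ //; rewrite scale0r.
    + exact: create_anti.
  - by move=> u [n|n] // _; apply/funext => -[|d s].
exists (fun x => phi x [::]); split.
- by move=> a x y; rewrite phil.
- by rewrite phi0.
- move=> u m x; rewrite phiA (_ : - m%:Z - 1 = Negz m) //; lia.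
- by move=> x; case: (phiP x).
Qed.

End CreationModules.

Lemma fock_coefficient : exists phi : V -> C^o,
  [/\ linear phi, phi vac = 1 &
      forall u (m : nat) x, phi (act u (- m%:Z - 1) x) = 0].
Proof.
have [] := @creation_universal C^o (fun _ _ _ => 0) (fun=> True) 1.
all: try by move=> *; rewrite ?scaler0 ?addr0.
by move=> phi [? ? ? _]; exists phi.
Qed.

(** The presentation does not collapse: letting every creation operator act by
    zero on the scalars gives a functional that is [1] on the vacuum. *)
Lemma vac_neq0 : vac != 0 :> V.
Proof.
have [phi [phil phi1 _]] := fock_coefficient.
by apply: contra_eq_neq phi1 => ->; rewrite (lin0 phil) eq_sym oner_eq0.
Qed.

(** * Normally ordered products *)

Section NormalOrdering.

Implicit Types X : int -> V -> V.

(** Fields are stored by their modes, [X n] being the coefficient of [z^(-n-1)]. *)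
Definition is_field X := (forall n, linear (X n)) /\
  forall w, exists N : nat, forall n : int, N%:Z <= n -> X n w = 0.

Definition twist X : int -> V -> V := fun n w => parity (X n (parity w)).

Lemma twist_field X : is_field X -> is_field (twist X).
Proof.
move=> [Xl Xt]; split=> [n|w].
  by apply: linear_comp; [exact: parity_linear|apply: linear_comp; [|exact: parity_linear]].
have [N XN] := Xt (parity w); exists N => n /XN; rewrite /twist => ->.
exact: lin0 parity_linear.
Qed.

Lemma twistK X n w : twist (twist X) n w = X n w.
Proof. by rewrite /twist !parityK. Qed.

Lemma field_modes X v w : is_field X ->
  exists N : nat, forall (n : int) (j : nat), N%:Z <= n -> X n (act v j w) = 0.
Proof.
move=> [Xl Xt]; have [M wM] := act_truncation w.
suff [N XN] : exists N : nat, forall (n : int) (j : nat), (j < M)%N ->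
    N%:Z <= n -> X n (act v j w) = 0.
  exists N => n j nN; case: (ltnP j M) => jM; first exact: XN.
  by rewrite wM ?(lin0 (Xl n)).
elim: M {wM} => [|M [N IH]]; first by exists 0%N.
have [K XK] := Xt (act v M w); exists (maxn N K) => n j; rewrite ltnS leq_eqVlt.
move=> /predU1P[->|jM] nN; first by apply: XK; lia.
by apply: IH => //; lia.
Qed.

(** The field [: D^(m)u(z) X(z) :]. Conjugating [X] by the parity produces the
    sign that an annihilation mode picks up when it moves past [X]. *)
Definition creations u m X (n : int) w : V :=
  fsum (fun j => bin j%:Z m *: act u (- j%:Z - 1) (X (n + j%:Z - m%:Z) w)).

Definition annihilations u m X (n : int) w : V :=
  fsum (fun j => bin (- j%:Z - 1) m *:
    twist X (n - j%:Z - m%:Z - 1) (act u j w)).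

Definition nprod u m X : int -> V -> V := fun n w =>
  creations u m X n w + annihilations u m X n w.

Lemma creations_evz u m X n w : is_field X ->
  evz (fun j => bin j%:Z m *: act u (- j%:Z - 1) (X (n + j%:Z - m%:Z) w)).
Proof.
move=> [_ /(_ w)[N XN]]; exists (N + `|n|.+1 + m)%N => j jN.
by rewrite XN ?act0r ?scaler0 //; lia.
Qed.

Lemma annihilations_evz u m X n w : is_field X ->
  evz (fun j => bin (- j%:Z - 1) m *: X (n - j%:Z - m%:Z - 1) (act u j w)).
Proof.
move=> [Xl _]; have [N wN] := act_truncation w; exists N => j jN.
by rewrite wN ?(lin0 (Xl _)) ?scaler0 //; lia.
Qed.

Hint Resolve creations_evz annihilations_evz twist_field : core.

Lemma nprod_field u m X : is_field X -> is_field (nprod u m X).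
Proof.
move=> Xf; have [Xl Xt] := Xf; have [tXl _] := twist_field Xf.
split=> [n|w].
  apply: linear_add; apply: linear_fsum => [j|w]; auto.
    by apply/linear_scale/linear_comp => //; apply: act_linear.
  apply/linear_scale/linear_comp => //; exact: act_linear.
have [M wM] := act_truncation w.
have [N XN] := Xt w; have [K XK] := field_modes u w (twist_field Xf).
exists (maxn N (M + K + m).+1) => n nN.
rewrite /nprod /creations /annihilations !fsum_eq0 ?addr0 // => j.
  case: (ltnP j M) => jM; first by rewrite XK ?scaler0 //; lia.
  by rewrite wM ?(lin0 (tXl _)) ?scaler0 //; lia.
case: (ltnP j m) => jm; first by rewrite binz_small ?scale0r.
by rewrite XN ?act0r ?scaler0 //; lia.
Qed.

Lemma nprod_linr u m a X X' : is_field X -> is_field X' ->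
  nprod u m (a *: X + X') = a *: nprod u m X + nprod u m X'.
Proof.
move=> Xf Xf'; apply/funext => n; apply/funext => w.
rewrite -[RHS]/(a *: nprod u m X n w + nprod u m X' n w) /nprod.
rewrite scalerDr addrACA; congr (_ + _).
- rewrite /creations -fsumZ; auto.
  rewrite -fsumD; auto; last by apply: evzZ; auto.
  apply: eq_fsum => j; rewrite -[(a *: X + X') _ w]/(a *: X _ w + X' _ w).
  by rewrite act_linear scalerDr !scalerA mulrC.
- rewrite /annihilations -fsumZ; auto.
  rewrite -fsumD; auto; last by apply: evzZ; auto.
  apply: eq_fsum => j; rewrite /twist.
  rewrite -[(a *: X + X') _ _]/(a *: X _ _ + X' _ _) parity_linear.
  by rewrite scalerDr !scalerA mulrC.
Qed.

Lemma act_lin2 a u v n x : act (a *: u + v) n x = a *: act u n x + act v n x.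
Proof. exact: fock_act_linearl. Qed.

Lemma nprod_linl a u v m X : is_field X ->
  nprod (a *: u + v) m X = a *: nprod u m X + nprod v m X.
Proof.
move=> Xf; apply/funext => n; apply/funext => w.
rewrite -[RHS]/(a *: nprod u m X n w + nprod v m X n w) /nprod.
rewrite scalerDr addrACA; congr (_ + _).
- rewrite /creations -fsumZ; auto.
  rewrite -fsumD; auto; last by apply: evzZ; auto.
  by apply: eq_fsum => j; rewrite act_lin2 scalerDr !scalerA mulrC.
- rewrite /annihilations -fsumZ; auto.
  rewrite -fsumD; auto; last by apply: evzZ; auto.
  apply: eq_fsum => j; have [tXl _] := twist_field Xf.
  by rewrite act_lin2 tXl scalerDr !scalerA mulrC.
Qed.

Lemma twist_nprod u m X n w : is_field X ->
  twist (nprod u m X) n w = - nprod u m (twist X) n w.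
Proof.
move=> Xf; have tf := twist_field Xf.
rewrite -[LHS]/(parity (nprod u m X n (parity w))) /nprod (linD parity_linear).
rewrite opprD; congr (_ + _).
- rewrite /creations (lin_fsum parity_linear); auto.
  rewrite -fsumN; last exact: creations_evz.
  by apply: eq_fsum => j; rewrite (linZ parity_linear) parity_act scalerN.
- rewrite /annihilations (lin_fsum parity_linear); last exact: annihilations_evz.
  rewrite -fsumN; last by apply/annihilations_evz/twist_field.
  apply: eq_fsum => j; rewrite (linZ parity_linear) -scalerN; congr (_ *: _).
  rewrite twistK /twist parityK parity_act parityK.
  by rewrite (linN (Xf.1 _)).
Qed.

Section Anticommutation.
Variables (X : int -> V -> V) (n : int) (w : V).
Hypothesis Xf : is_field X.

Let CC u m v k := fsum (fun i => fsum (fun j => (bin i%:Z m * bin j%:Z k) *: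
  act u (- i%:Z - 1) (act v (- j%:Z - 1) (X (n + i%:Z + j%:Z - m%:Z - k%:Z) w)))).
Let CA u m v k := fsum (fun i => fsum (fun j =>
  (bin i%:Z m * bin (- j%:Z - 1) k) *: act u (- i%:Z - 1)
    (twist X (n + i%:Z - j%:Z - m%:Z - k%:Z - 1) (act v j w)))).
Let AA u m v k := fsum (fun i => fsum (fun j =>
  (bin (- i%:Z - 1) m * bin (- j%:Z - 1) k) *:
    X (n - i%:Z - j%:Z - m%:Z - k%:Z - 2) (act v j (act u i w)))).

Let nprod_nprod u m v k : nprod u m (nprod v k X) n w =
  (CC u m v k + CA u m v k) - (CA v k u m + AA u m v k).
Proof.
have tf := twist_field Xf.
have CAx : CA v k u m = fsum (fun i => fsum (fun j =>
    (bin (- i%:Z - 1) m * bin j%:Z k) *: act v (- j%:Z - 1)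
      (twist X (n - i%:Z + j%:Z - m%:Z - k%:Z - 1) (act u i w)))).
  have [N XN] := field_modes u w tf; have [M wM] := act_truncation w.
  rewrite /CA (@fsum_exchange _ _ (N + M + m + k + `|n|).+2).
    apply: eq_fsum => i; apply: eq_fsum => j; rewrite mulrC; congr (_ *: _).
    by congr (act _ _ (twist X _ _)); lia.
  move=> i j ij; case: (ltnP j M) => jM; last first.
    by rewrite wM ?(lin0 (tf.1 _)) ?act0r ?scaler0 //; lia.
  by rewrite XN ?act0r ?scaler0 //; lia.
rewrite [LHS]/nprod; congr (_ + _).
- rewrite /creations -fsumD.
  + apply: eq_fsum => i; rewrite /nprod actDr scalerDr /creations /annihilations.
    rewrite !(lin_fsum (act_linear _ _)); auto.
    rewrite -!fsumZ; try by apply: (evz_lin (act_linear _ _)); auto.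
    congr (_ + _); apply: eq_fsum => j; rewrite actZr scalerA; congr (_ *: _).
      by congr (act _ _ (act _ _ (X _ _))); lia.
    by congr (act _ _ (twist X _ _)); lia.
  + have [N XN] := Xf.2 w; exists (N + m + k + `|n|)%N => i iN.
    by apply: fsum_eq0 => j; rewrite XN ?act0r ?scaler0 //; lia.
  + have [N XN] := field_modes v w tf; have [M wM] := act_truncation w.
    exists (N + M + m + k + `|n|).+1 => i iN.
    apply: fsum_eq0 => j; case: (ltnP j M) => jM; last first.
      by rewrite wM ?(lin0 (tf.1 _)) ?act0r ?scaler0 //; lia.
    by rewrite XN ?act0r ?scaler0 //; lia.
- rewrite CAx -fsumD.
  + rewrite -fsumN; last first.
      have [M wM] := act_truncation w; exists M => i iM.
      rewrite !fsum_eq0 ?addr0 // => j; rewrite wM ?act0r; try lia.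
        by rewrite (lin0 (Xf.1 _)) scaler0.
      by rewrite (lin0 (tf.1 _)) act0r scaler0.
    apply: eq_fsum => i; rewrite twist_nprod // scalerN /nprod scalerDr.
    congr (- (_ + _)); rewrite -fsumZ; auto.
      apply: eq_fsum => j; rewrite scalerA; congr (_ *: act _ _ (twist X _ _)).
      by lia.
    apply: eq_fsum => j; rewrite scalerA twistK; congr (_ *: X _ _); lia.
  + have [M wM] := act_truncation w; exists M => i iM.
    apply: fsum_eq0 => j; rewrite wM; last by lia.
    by rewrite (lin0 (tf.1 _)) act0r scaler0.
  + have [M wM] := act_truncation w; exists M => i iM.
    apply: fsum_eq0 => j; rewrite wM; last by lia.
    by rewrite act0r (lin0 (Xf.1 _)) scaler0.
Qed.

(** In the expansion of both orders, terms with two creation or two annihilation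
    modes cancel by anticommutation, and the mixed terms appear once in each order
    with opposite signs. *)
Lemma nprod_anti u v m k :
  nprod u m (nprod v k X) n w + nprod v k (nprod u m X) n w = 0.
Proof.
rewrite !nprod_nprod.
have CCx : CC u m v k = - CC v k u m.
  have [N XN] := Xf.2 w.
  rewrite {1}/CC (@fsum_exchange _ _ (N + m + k + `|n|)%N); last first.
    by move=> i j ij; rewrite XN ?act0r ?scaler0 //; lia.
  rewrite -fsumN; last first.
    exists (N + m + k + `|n|)%N => i iN.
    by apply: fsum_eq0 => j; rewrite XN ?act0r ?scaler0 //; lia.
  apply: eq_fsum => j; rewrite -fsumN; last first.
    exists (N + m + k + `|n|)%N => i iN.
    by rewrite XN ?act0r ?scaler0 //; lia.
  apply: eq_fsum => i; rewrite act_swap ifF; last by lia.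
  rewrite sub0r scalerN mulrC; congr (- (_ *: act _ _ (act _ _ (X _ _)))); lia.
have AAx : AA u m v k = - AA v k u m.
  have [M wM] := act_truncation w.
  have z a b (i j : nat) : (M <= i)%N || (M <= j)%N -> act a j (act b i w) = 0.
    case/orP => h; first by rewrite (wM b) ?act0r //; lia.
    by rewrite act_swap ifF ?wM ?act0r ?subr0 //; lia.
  rewrite {1}/AA (@fsum_exchange _ _ M); last first.
    by move=> i j ij; rewrite z // (lin0 (Xf.1 _)) scaler0.
  rewrite -fsumN; last first.
    exists M => i iM; apply: fsum_eq0 => j.
    by rewrite z ?iM // (lin0 (Xf.1 _)) scaler0.
  apply: eq_fsum => j; rewrite -fsumN; last first.
    exists M => i iM.
    by rewrite z ?iM ?orbT // (lin0 (Xf.1 _)) scaler0.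
  apply: eq_fsum => i; rewrite act_swap ifF; last by lia.
  rewrite sub0r (linN (Xf.1 _)) scalerN mulrC; congr (- (_ *: X _ _)); lia.
have cancel (a b c d : V) : - a + b - (c - d) + (a + c - (b + d)) = 0.
  apply/eqP; rewrite addr_eq0 !opprB opprD.
  by rewrite [- a + b]addrC addrACA.
by rewrite CCx AAx cancel.
Qed.

End Anticommutation.

End NormalOrdering.

(** * The vertex operator map *)

(** The recursive form of a normally ordered product, free of the explicit sum over
    words; it is equivalent to the definition on monomials by
    [fock_vertex_operatorP]. *)
Definition normally_ordered (Y : V -> int -> V -> V) : Prop :=
  [/\ forall n w, linear (fun v => Y v n w),
      forall n w, Y vac n w = if n == -1 then w else 0
    & forall u m x n w, Y (act u (- m%:Z - 1) x) n w = nprod u m (Y x) n w].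

Lemma is_field_subspace : is_subspace is_field.
Proof.
split.
  split=> [n c v w|w]; last by exists 0%N.
  by rewrite -[LHS]/(0 : V) -[RHS]/(c *: (0 : V) + 0) scaler0 addr0.
move=> c X X' [Xl Xt] [X'l X't]; split=> [n|w].
  by apply: linear_add => //; apply: linear_scale.
have [N XN] := Xt w; have [N' X'N] := X't w; exists (maxn N N') => n nN.
rewrite -[LHS]/(c *: X n w + X' n w) XN; last by lia.
by rewrite X'N ?scaler0 ?addr0 //; lia.
Qed.

(** The fields form a space on which the normal ordering operators act and
    anticommute, so the universal property applies to it. *)
Lemma normally_ordered_exists : exists Y, normally_ordered Y.
Proof.
pose X0 (n : int) (w : V) := if n == -1 then w else 0.
have [] := @creation_universal (int -> V -> V)
  nprod is_field X0.
- exact: is_field_subspace.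
- rewrite /X0; split=> [n c v w|w].
    by case: ifP => _ //; rewrite scaler0 addr0.
  by exists 0%N => n n0; rewrite ifF //; lia.
- by move=> u m X; apply: nprod_field.
- by move=> u m a X X'; apply: nprod_linr.
- by move=> a u v m X; apply: nprod_linl.
- by move=> u v m n X Xf; apply/funext => k; apply/funext => w; apply: nprod_anti.
move=> Y [Yl Y0 YS _]; exists Y; split=> [n w c v v'|n w|u m x n w].
- by rewrite Yl.
- by rewrite Y0.
- by rewrite YS.
Qed.

Lemma creation_ind (Q : V -> Prop) : is_subspace Q -> Q vac ->
  (forall u (m : nat) x, Q x -> Q (act u (- m%:Z - 1) x)) -> forall x, Q x.
Proof.
move=> Qs Q0 QS; apply: fock_ind_levels => // k x.
by move: k x; apply: level_ind => // k u m x _; apply: QS.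
Qed.

Section NormallyOrdered.
Variable Y : V -> int -> V -> V.
Hypothesis Y_no : normally_ordered Y.

Lemma normally_ordered_field x : is_field (Y x).
Proof.
have [Yl Y0 YS] := Y_no; move: x; apply: creation_ind => [||u m x IH].
- split=> [|c v w [vl vt] [wl wt]]; split=> [n|w'].
  + by move=> c v w; rewrite !(lin0 (Yl _ _)) scaler0 addr0.
  + by exists 0%N => n _; rewrite (lin0 (Yl _ _)).
  + by move=> d y z; rewrite !Yl vl wl !scalerDr !scalerA mulrC addrACA.
  + have [N vN] := vt w'; have [N' wN] := wt w'.
    exists (maxn N N') => n nN; rewrite Yl vN ?wN ?scaler0 ?addr0 //; lia.
- split=> [n|w]; last by exists 0%N => n n0; rewrite Y0 ifF //; lia.
  by move=> c v w; rewrite !Y0; case: ifP => _ //; rewrite scaler0 addr0.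
- have [nl nt] := nprod_field u m IH; split=> [n|w].
    by move=> c v w; rewrite !YS nl.
  by have [N nN] := nt w; exists N => n /nN; rewrite YS.
Qed.

Lemma normally_ordered_twist x n w :
  parity (Y x n (parity w)) = Y (parity x) n w.
Proof.
have [Yl Y0 YS] := Y_no; move: x n w; apply: creation_ind => [||u m x IH] /=.
- apply: subspace_all => n; apply: subspace_all => w; apply: subspace_eq.
    exact: (linear_comp parity_linear (Yl _ _)).
  exact: (linear_comp (Yl _ _) parity_linear).
- move=> n w; rewrite parity_vac // !Y0; case: ifP => _; first exact: parityK.
  exact: lin0 parity_linear.
- move=> n w; rewrite YS parity_act (linN (Yl n w)) YS.
  rewrite -[LHS]/(twist (nprod u m (Y x)) n w) twist_nprod //.
    by congr (- nprod _ _ _ _ _); apply/funext => k; apply/funext => v; apply: IH.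
  exact: normally_ordered_field.
Qed.

Lemma normally_orderedE s n w : Y (mono s) n w = normal_product s n w.
Proof.
have [Yl Y0 YS] := Y_no.
elim: s n w => [|[u m] s IH] n w /=; first exact: Y0.
have Xf := normally_ordered_field (mono s).
pose F p : V := bin (- p - 1) m *: (if p < 0 then act u p (normal_product s (n - p - m%:Z - 1) w)
         else (-1) ^+ size s *:
                normal_product s (n - p - m%:Z - 1) (act u p w)).
have tY k v : twist (Y (mono s)) k v = (-1) ^+ size s *: Y (mono s) k v.
  rewrite /twist normally_ordered_twist.
  by rewrite (level_parity (level_mono s)) (linZ (Yl k v)).
have F1 j : F (- j%:Z - 1) =
    bin j%:Z m *: act u (- j%:Z - 1) (Y (mono s) (n + j%:Z - m%:Z) w).
  rewrite /F ifT ?IH; last by lia.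
  by congr (bin _ _ *: act _ _ (normal_product _ _ _)); lia.
have F2 (j : nat) : F j = bin (- j%:Z - 1) m *:
    twist (Y (mono s)) (n - j%:Z - m%:Z - 1) (act u j w).
  by rewrite tY IH /F (_ : (j%:Z < 0) = false) //; lia.
rewrite -[RHS]/(\sum_(p \in [set: int]) F p) fsum_int.
- rewrite monoE YS /nprod /creations /annihilations.
  by congr (_ + _); apply: eq_fsum => j; rewrite ?F1 ?F2.
- apply: evz_eq (annihilations_evz u m n w (twist_field Xf)) => j.
  by rewrite F2.
- by apply: evz_eq (creations_evz u m n w Xf) => j; rewrite F1.
Qed.

End NormallyOrdered.

Lemma linear_mono_eq (W : lmodType C) (f g : V -> W) : linear f -> linear g ->
  (forall s, f (mono s) = g (mono s)) -> forall x, f x = g x.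
Proof.
move=> fl gl fg x; move: x (monomials_span x); apply: monomials_min => //.
exact: subspace_eq.
Qed.

Lemma fock_vertex_operator_eq Y Z :
  is_fock_vertex_operator Y -> normally_ordered Z -> Y = Z.
Proof.
move=> [Yl Ym] Zno; have [Zl _ _] := Zno.
apply/funext => x; apply/funext => n; apply/funext => w.
apply: (linear_mono_eq (Yl n w) (Zl n w)) => s.
by rewrite Ym normally_orderedE.
Qed.

Lemma fock_vertex_operatorP Y : is_fock_vertex_operator Y <-> normally_ordered Y.
Proof.
split=> [Yvo|Yno]; last by split=> [|s n w]; [case: Yno | apply: normally_orderedE].
by have [Z Zno] := normally_ordered_exists; rewrite (fock_vertex_operator_eq Yvo Zno).
Qed.

Lemma fock_vertex_operator_unique : exists! Y, is_fock_vertex_operator (B := B) Y.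
Proof.
have [Y Yno] := normally_ordered_exists; exists Y; split.
  exact/fock_vertex_operatorP.
by move=> Z /fock_vertex_operator_eq/(_ Yno) ->.
Qed.

(** The normally ordered product is the [l]-th product of the fields [u(z)] and
    [Y(x,z)], for [l < 0]. *)
Lemma normally_ordered_iterate Y u (m : nat) x n w : normally_ordered Y ->
  let l := - m%:Z - 1 in
  Y (act u l x) n w = fsum (fun j => ((-1) ^+ j * bin l j) *:
    (act u (l - j%:Z) (Y x (n + j%:Z) w)
     - (-1) ^ l *: Y (parity x) (l + n - j%:Z) (act u j w))).
Proof.
move=> Yno /=; have Xf := normally_ordered_field Yno x.
have [_ _ YS] := Yno; rewrite YS /nprod.
rewrite sign_pred; under [RHS]eq_fsum => j do rewrite binz_pred scaleNr opprK scalerDr scalerA.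
rewrite [RHS]fsumD; last 2 first.
- have [N XN] := Xf.2 w; exists (N + `|n|)%N => j jN.
  by rewrite XN ?act0r ?scaler0 //; lia.
- have Xf' := normally_ordered_field Yno (parity x).
  have [N wN] := act_truncation w; exists N => j jN.
  by rewrite wN ?(lin0 (Xf'.1 _)) ?scaler0 //; lia.
congr (_ + _).
- rewrite /creations (@fsum_shift _ _ m).
  + apply: eq_fsum => j; rewrite [(m + j)%N]addnC; congr (_ *: act _ _ (Y _ _ _)); lia.
  + exact: creations_evz.
  + by move=> j jm; rewrite binz_small ?scale0r.
- apply: eq_fsum => j; rewrite /twist normally_ordered_twist //.
  congr (_ *: Y _ _ _); last by lia.
  by rewrite binz_neg mulrC -PoszD addnC.
Qed.

(** * Commutators with the generators, and translation *)

Variable Y : V -> int -> V -> V.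
Hypothesis Y_no : normally_ordered Y.

Lemma Y_linl n w : linear (fun v => Y v n w). Proof. by case: Y_no. Qed.
Lemma Y_linr v n : linear (Y v n).
Proof. exact: (normally_ordered_field Y_no v).1. Qed.
Lemma Y_trunc v w : exists N : nat, forall n : int, N%:Z <= n -> Y v n w = 0.
Proof. exact: (normally_ordered_field Y_no v).2. Qed.
Lemma Y_vac n w : Y vac n w = if n == -1 then w else 0.
Proof. by case: Y_no. Qed.
Lemma Y_parity v n w : parity (Y v n w) = Y (parity v) n (parity w).
Proof. by rewrite -(normally_ordered_twist Y_no) parityK. Qed.

Lemma Y0l n w : Y 0 n w = 0. Proof. exact: lin0 (Y_linl n w). Qed.
Lemma Y0r v n : Y v n 0 = 0. Proof. exact: lin0 (Y_linr v n). Qed.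
Lemma YZl c v n w : Y (c *: v) n w = c *: Y v n w.
Proof. exact: linZ (Y_linl n w) c v. Qed.
Lemma YZr c v n w : Y v n (c *: w) = c *: Y v n w.
Proof. exact: linZ (Y_linr v n) c w. Qed.
Lemma YNl v n w : Y (- v) n w = - Y v n w.
Proof. exact: linN (Y_linl n w) v. Qed.
Lemma YNr v n w : Y v n (- w) = - Y v n w.
Proof. exact: linN (Y_linr v n) w. Qed.
Lemma YDl v v' n w : Y (v + v') n w = Y v n w + Y v' n w.
Proof. exact: linD (Y_linl n w) v v'. Qed.
Lemma YDr v n w w' : Y v n (w + w') = Y v n w + Y v n w'.
Proof. exact: linD (Y_linr v n) w w'. Qed.
Lemma YBl v v' n w : Y (v - v') n w = Y v n w - Y v' n w.
Proof. by rewrite YDl YNl. Qed.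
Lemma YBr v n w w' : Y v n (w - w') = Y v n w - Y v n w'.
Proof. by rewrite YDr YNr. Qed.
Lemma Yfsuml F n w : evz F -> Y (fsum F) n w = fsum (fun j => Y (F j) n w).
Proof. exact: lin_fsum (Y_linl n w) F. Qed.
Lemma Yfsumr v n F : evz F -> Y v n (fsum F) = fsum (fun j => Y v n (F j)).
Proof. exact: lin_fsum (Y_linr v n) F. Qed.

(** A bound that is uniform in the family makes double sums finitely supported in
    both indices, so that they may be exchanged. *)
Lemma Y_trunc_l (z : nat -> V) w : evz z ->
  exists K : nat, forall (i : nat) (n : int), K%:Z <= n -> Y (z i) n w = 0.
Proof.
move=> [I zI]; suff [K YK] : exists K : nat, forall (i : nat) (n : int),
    (i < I)%N -> K%:Z <= n -> Y (z i) n w = 0.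
  exists K => i n nK; case: (ltnP i I) => iI; first exact: YK.
  by rewrite zI ?Y0l.
elim: I {zI} => [|I [K IH]]; first by exists 0%N.
have [N YN] := Y_trunc (z I) w; exists (maxn K N) => i n.
rewrite ltnS leq_eqVlt => /predU1P[->|iI] nK; first by apply: YN; lia.
by apply: IH => //; lia.
Qed.

Lemma evz_act u x : evz (fun j : nat => act u j x).
Proof. by have [N xN] := act_truncation x; exists N => j jN; apply: xN. Qed.

Lemma evz_Y v w n : evz (fun j : nat => Y v (n + j%:Z) w).
Proof.
have [N wN] := Y_trunc v w; exists (N + `|n|)%N => j jN; apply: wN; lia.
Qed.

Lemma act_iterate u (l : int) x n w : l < 0 ->
  Y (act u l x) n w = fsum (fun j => sbin l j *:
    (act u (l - j%:Z) (Y x (n + j%:Z) w)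
     - (-1) ^ l *: Y (parity x) (l + n - j%:Z) (act u j w))).
Proof.
move=> l0; have -> : l = - (`|l|.-1)%N%:Z - 1 by lia.
exact: normally_ordered_iterate.
Qed.

Lemma iterate_evz_l u x n w (c : nat -> C) (k : nat -> int) :
  evz (fun j : nat => c j *: act u (k j) (Y x (n + j%:Z) w)).
Proof.
by have [N wN] := evz_Y x w n; exists N => j /wN ->; rewrite act0r scaler0.
Qed.

Lemma iterate_evz_r u x w (c : nat -> C) (k : nat -> int) :
  evz (fun j : nat => c j *: Y x (k j) (act u j w)).
Proof.
by have [N wN] := evz_act u w; exists N => j /wN ->; rewrite Y0r scaler0.
Qed.

Lemma act_iterate2 u (l : int) x n w : l < 0 ->
  Y (act u l x) n w =
  fsum (fun j => sbin l j *: act u (l - j%:Z) (Y x (n + j%:Z) w)) -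
  fsum (fun j => (sbin l j * (-1) ^ l) *:
    Y (parity x) (l + n - j%:Z) (act u j w)).
Proof.
move=> l0; rewrite act_iterate // -fsumB.
- by apply: eq_fsum => j; rewrite scalerBr scalerA.
- exact: iterate_evz_l.
- exact: iterate_evz_r.
Qed.

Lemma Y_generator u n w : Y (act u (-1) vac) n w = act u n w.
Proof.
have [_ _ YS] := Y_no; have := YS u 0%N vac n w; rewrite oppr0 add0r => ->.
rewrite /nprod /creations /annihilations.
have tv k v : twist (Y vac) k v = if k == -1 then v else 0.
  by rewrite /twist normally_ordered_twist // parity_vac // Y_vac.
case: (ltrP n 0) => n0.
- rewrite (@fsum_single _ _ (`|n|.-1)) => [|j jn]; last first.
    by rewrite Y_vac ifF ?act0r ?scaler0 //; lia.
  rewrite fsum_eq0 => [|j]; last by rewrite tv ifF ?scaler0 //; lia.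
  rewrite binz0 scale1r Y_vac ifT ?addr0; last by lia.
  by congr (act _ _ _); lia.
- rewrite fsum_eq0 => [|j]; last by rewrite Y_vac ifF ?act0r ?scaler0 //; lia.
  rewrite (@fsum_single _ _ `|n|%N) => [|j jn]; last first.
    by rewrite tv ifF ?scaler0 //; lia.
  rewrite binz0 scale1r tv ifT ?add0r; last by lia.
  by congr (act _ _ _); lia.
Qed.

Lemma act_iterate_pred u (l n : int) x w : l < 0 ->
  Y (act u l x) (n - 1) w =
  fsum (fun j => sbin l j *: act u (l - j%:Z) (Y x (n + j%:Z - 1) w)) -
  fsum (fun j => sbin l j *: ((-1) ^ l *:
    Y (parity x) (l + n - j%:Z - 1) (act u j w))).
Proof.
move=> l0; rewrite act_iterate2 //; congr (_ - _); apply: eq_fsum => j.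
  by congr (_ *: act _ _ (Y _ _ _)); lia.
by rewrite scalerA; congr (_ *: Y _ _ _); lia.
Qed.

(** The pairing of [u_(m)] with the modes of [v] meets at most one term of each of
    the two sums, in the first when [m >= 0] and in the second when [m < 0]. *)
Lemma delta_sum u v (m n : int) k x w : let l := - k%:Z - 1 in
  fsum (fun j => sbin l j *: (if m + (l - j%:Z) + 1 == 0
     then (- 2%:R * B u v) *: Y x (n + j%:Z) w else 0)) -
  fsum (fun j => (sbin l j * (-1) ^ l) *: (if m + j%:Z + 1 == 0
     then (- 2%:R * B u v) *: Y x (l + n - j%:Z) w else 0)) =
  (bin m k * (- 2%:R * B u v)) *: Y x (m + n - k%:Z) w.
Proof.
move=> l; set b := - 2%:R * B u v.
case: (ltrP m 0) => m0.
- rewrite fsum_eq0 => [|j]; last by rewrite ifF ?scaler0 //; lia.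
  rewrite (@fsum_single _ _ (`|m|.-1)) => [|j jn]; last first.
    by rewrite ifF ?scaler0 //; lia.
  rewrite ifT; last by lia.
  rewrite sub0r scalerA -[LHS]scaleNr.
  congr (_ *: Y _ _ _); last by lia.
  have -> : m = - (`|m|.-1)%N%:Z - 1 by lia.
  rewrite binz_pred sign_pred binz_neg -PoszD [(k + _)%N]addnC.
  have -> : `|- (`|m|.-1)%N%:Z - 1|%N.-1 = `|m|.-1%N by lia.
  set p := bin _ _; set e := (-1) ^+ k; ring.
- rewrite [X in _ - X]fsum_eq0 => [|j]; last by rewrite ifF ?scaler0 //; lia.
  rewrite subr0; case: (leqP k `|m|) => km.
    rewrite (@fsum_single _ _ (`|m| - k)%N) => [|j jn]; last first.
      by rewrite ifF ?scaler0 //; lia.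
    rewrite ifT ?scalerA; last by lia.
    congr (_ *: Y _ _ _); last by lia.
    by rewrite binz_pred; congr (binz _ _ _ * _); lia.
  rewrite fsum_eq0 => [|j]; last by rewrite ifF ?scaler0 //; lia.
  have -> : m = `|m|%N by lia.
  by rewrite binz_small // mul0r scale0r.
Qed.

Lemma commutator_evz u x (m n : int) w (c : nat -> C) :
  evz (fun j : nat => c j *: Y (act u j x) (m + n - j%:Z) w).
Proof.
by have [N xN] := evz_act u x; exists N => j /xN ->; rewrite Y0l scaler0.
Qed.

(** The commutator formula with a generating field. Passing a creation operator
    of the state through, the Clifford relation contributes the two delta sums
    that combine in [delta_sum]. *)
Lemma act_commutator u (m : int) x n w :
  act u m (Y x n w) = Y (parity x) n (act u m w) +
    fsum (fun j => bin m j *: Y (act u j x) (m + n - j%:Z) w).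
Proof.
move: x n w; apply: creation_ind => [||v k x IH].
- apply: subspace_all => n; apply: subspace_all => w; apply: subspace_eq.
    exact: (linear_comp (act_linear _ _) (Y_linl _ _)).
  apply: linear_add; first exact: (linear_comp (Y_linl _ _) parity_linear).
  apply: linear_fsum => [j|x]; last exact: commutator_evz.
  apply: linear_scale; exact: (linear_comp (Y_linl _ _) (act_linear _ _)).
- move=> n w; rewrite parity_vac // !Y_vac fsum_eq0 ?addr0 => [|j].
    by case: ifP => // _; rewrite act0r.
  by rewrite fock_act_vac // Y0l scaler0.
move=> n w; set l := - k%:Z - 1; have l0 : l < 0 by rewrite /l; lia.
rewrite act_iterate2 // parity_act YNl act_iterate2 // parityK.
rewrite (linB (act_linear u m)).
rewrite (lin_fsum (act_linear u m)); last exact: iterate_evz_l.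
rewrite (lin_fsum (act_linear u m)); last exact: iterate_evz_r.
pose b := - 2%:R * B u v.
(* The index 1 marks the pairing of [u] with [v], the index 2 the term in which
   [u_(m)] reaches [w], and the index 3 the terms given by the induction hypothesis;
   [P] and [Q] belong to the two halves of the iterate formula. *)
pose P1 j := sbin l j *: (if m + (l - j%:Z) + 1 == 0 then b *: Y x (n + j%:Z) w else 0).
pose P2 j := sbin l j *: act v (l - j%:Z) (Y (parity x) (n + j%:Z) (act u m w)).
pose P3 (i j : nat) := (bin m i * sbin l j) *:
  act v (l - j%:Z) (Y (act u i x) (m + n - i%:Z + j%:Z) w).
pose Q1 j := (sbin l j * (-1) ^ l) *: (if m + j%:Z + 1 == 0 then b *: Y x (l + n - j%:Z) w else 0).
pose Q2 j := (sbin l j * (-1) ^ l) *: Y x (l + n - j%:Z) (act v j (act u m w)).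
pose Q3 (i j : nat) := (bin m i * (sbin l j * (-1) ^ l)) *:
  Y (parity (act u i x)) (l + (m + n - i%:Z) - j%:Z) (act v j w).
have [I uI] := evz_act u x.
have [K uK] := Y_trunc_l w (evz_act u x).
have [J vJ] := evz_act v w.
pose N := (I + K + J + `|m| + `|n|)%N.
have P30 i j : (N <= i)%N || (N <= j)%N -> P3 i j = 0.
  move=> ij; rewrite /P3; case: (ltnP i I) => iI; last first.
    by rewrite uI // Y0l act0r scaler0.
  by rewrite uK ?act0r ?scaler0 //; move: ij; rewrite /N; lia.
have Q30 i j : (N <= i)%N || (N <= j)%N -> Q3 i j = 0.
  move=> ij; rewrite /Q3; case: (ltnP i I) => iI; last first.
    by rewrite uI // (lin0 parity_linear) Y0l scaler0.
  by rewrite vJ ?Y0r ?scaler0 //; move: ij; rewrite /N; lia.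
have evzP1 : evz P1.
  have [M xM] := evz_Y x w n; exists M => j /xM; rewrite /P1 => ->.
  by rewrite scaler0 if_same scaler0.
have evzP2 : evz P2 by apply: iterate_evz_l.
have evzP3 : evz (fun j => fsum (fun i => P3 i j)).
  by exists N => j jN; apply: fsum_eq0 => i; rewrite P30 ?jN ?orbT.
have evzQ1 : evz Q1.
  exists `|m|.+1 => j jm; rewrite /Q1 ifF ?scaler0 //; lia.
have evzQ2 : evz Q2 by apply: iterate_evz_r.
have evzQ3 : evz (fun j => fsum (fun i => Q3 i j)).
  by exists N => j jN; apply: fsum_eq0 => i; rewrite Q30 ?jN ?orbT.
have -> : fsum (fun j => act u m (sbin l j *: act v (l - j%:Z) (Y x (n + j%:Z) w))) =
    fsum P1 - fsum P2 - fsum (fun j => fsum (fun i => P3 i j)).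
  rewrite -fsumB // -fsumB //; last exact: evzB.
  apply: eq_fsum => j; rewrite actZr act_swap IH actDr scalerBr scalerDr -[RHS]addrA -[in RHS]opprD.
  congr (_ - (_ + _)).
  rewrite (lin_fsum (act_linear _ _)); last exact: commutator_evz.
  rewrite -fsumZ; last by apply: (evz_lin (act_linear _ _)); exact: commutator_evz.
  apply: eq_fsum => i; rewrite actZr scalerA mulrC /P3.
  by congr (_ *: act _ _ (Y _ _ _)); lia.
have -> : fsum (fun j => act u m ((sbin l j * (-1) ^ l) *: Y (parity x) (l + n - j%:Z) (act v j w))) =
    fsum Q1 - fsum Q2 - fsum (fun j => fsum (fun i => Q3 i j)).
  rewrite -fsumB // -fsumB //; last exact: evzB.
  apply: eq_fsum => j; rewrite actZr.
  have -> : act u m (Y (parity x) (l + n - j%:Z) (act v j w)) =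
      Y x (l + n - j%:Z) (act u m (act v j w)) -
      fsum (fun i : nat => bin m i *: Y (parity (act u i x)) (m + (l + n - j%:Z) - i%:Z) (act v j w)).
    set q := l + n - j%:Z; set z := act v j w.
    have -> : act u m (Y (parity x) q z) = - parity (act u m (Y x q (parity z))).
      by rewrite parity_act Y_parity parityK opprK.
    rewrite IH (linD parity_linear) Y_parity parityK parity_act parityK YNr opprD opprK.
    congr (_ - _).
    rewrite (lin_fsum parity_linear); last exact: commutator_evz.
    apply: eq_fsum => i; rewrite (linZ parity_linear) Y_parity; congr (_ *: _).
    by rewrite parityK.
  rewrite act_swap YBr !scalerBr; congr (_ - _ - _).
    rewrite /Q1; case: ifP => _; last by rewrite Y0r.
    by rewrite YZr.
  rewrite -fsumZ; last first.
    exists I => i iI; rewrite uI // (lin0 parity_linear) Y0l scaler0 //.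
  apply: eq_fsum => i; rewrite scalerA mulrC /Q3.
  by congr (_ *: Y _ _ _); lia.
have -> : fsum (fun i => bin m i *: Y (act u i (act v l x)) (m + n - i%:Z) w) =
  (bin m k * b) *: Y x (m + n - k%:Z) w -
  (fsum (fun j => fsum (fun i => P3 i j)) - fsum (fun j => fsum (fun i => Q3 i j))).
  rewrite -(fsum_exchange P30) -(fsum_exchange Q30) -fsumB; last 2 first.
  - by exists N => i iN; apply: fsum_eq0 => j; rewrite P30 ?iN.
  - by exists N => i iN; apply: fsum_eq0 => j; rewrite Q30 ?iN.
  have -> : (bin m k * b) *: Y x (m + n - k%:Z) w =
    fsum (fun i : nat => bin m i *: (if i%:Z + l + 1 == 0 then b *: Y x (m + n - i%:Z) w else 0)).
    rewrite (@fsum_single _ _ k) => [|i ik]; last by rewrite ifF ?scaler0 // /l; lia.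
    by rewrite ifT ?scalerA // /l; lia.
  rewrite -fsumB; last 2 first.
  - by exists k.+1 => i ik; rewrite ifF ?scaler0 // /l; lia.
  - exists N => i iN; rewrite !fsum_eq0 ?subr0 // => j; by rewrite ?P30 ?Q30 ?iN.
  apply: eq_fsum => i; rewrite act_swap YBl scalerBr; congr (_ - _).
    by case: ifP => _; rewrite ?YZl ?Y0l.
  rewrite act_iterate2 // scalerBr -!fsumZ; [|exact: iterate_evz_r|exact: iterate_evz_l].
  congr (_ - _); apply: eq_fsum => j; rewrite scalerA //.
have := delta_sum u v m n k x w; rewrite /= -/l -/b -/P1 -/Q1 => <-.
rewrite -/(fsum P2) -/(fsum Q2).
have cancel (a1 b1 c d e f : V) :
    a1 - b1 - c - (d - e - f) = - (b1 - e) + (a1 - d - (c - f)).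
  by rewrite subrACA [a1 - b1 - _]subrACA addrAC addrC.
exact: cancel.
Qed.

Lemma act_state u (l n : int) x : l < 0 ->
  Y (act u l x) n vac =
  fsum (fun j => sbin l j *: act u (l - j%:Z) (Y x (n + j%:Z) vac)).
Proof.
move=> l0; rewrite act_iterate //; apply: eq_fsum => j.
by rewrite fock_act_vac // Y0r scaler0 subr0.
Qed.

Lemma Y_creation v (n : int) : 0 <= n -> Y v n vac = 0.
Proof.
move=> n0; move: v n n0; apply: creation_ind => [||u k x IH].
- do 2![apply: subspace_all => ?]; apply: subspace_eq; first exact: Y_linl.
  exact: linear_zero.
- by move=> n n0; rewrite Y_vac ifF //; lia.
- move=> n n0; rewrite act_state; last by lia.
  by apply: fsum_eq0 => j; rewrite IH ?act0r ?scaler0 //; lia.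
Qed.

(** In the iterate formula on the vacuum only the leading creation mode survives. *)
Lemma Y_creationN1 v : Y v (-1) vac = v.
Proof.
move: v; apply: creation_ind => [||u k x IH].
- apply: subspace_eq; [exact: Y_linl | exact: linear_id].
- by rewrite Y_vac.
- rewrite act_state; last by lia.
  rewrite (@fsum_single _ _ 0%N) => [|j j0].
    by rewrite binz0 mulr1 scale1r addr0 subr0 IH.
  by rewrite Y_creation ?act0r ?scaler0 //; lia.
Qed.

Definition T (x : V) : V := Y x (-2) vac.

Lemma T_linear : linear T. Proof. exact: Y_linl. Qed.

Lemma T_vac : T vac = 0. Proof. by rewrite /T Y_vac. Qed.

Lemma T_parity x : parity (T x) = T (parity x).
Proof. by rewrite /T Y_parity parity_vac. Qed.

Lemma binz1 (x : int) : bin x 1 = x%:~R.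
Proof. by rewrite /binz big_ord1 subr0 factS fact0 divr1. Qed.

(** For a creation mode this reads off the second term of the iterate formula on the
    vacuum; for an annihilation mode it follows by moving it through the state. *)
Lemma T_act u (k : int) x :
  T (act u k x) = act u k (T x) - k%:~R *: act u (k - 1) x.
Proof.
have neg v (l : int) y : l < 0 ->
    T (act v l y) = act v l (T y) - l%:~R *: act v (l - 1) y.
  move=> l0; rewrite /T act_state // fsum_recl; last exact: iterate_evz_l.
  rewrite binz0 mulr1 scale1r subr0 addr0; congr (_ + _).
  rewrite (@fsum_single _ _ 0%N) => [|j j0].
    by rewrite binz1 expr1 mulN1r scaleNr Y_creationN1.
  by rewrite Y_creation ?act0r ?scaler0 //; lia.
case: (ltrP k 0) => [|k0]; first exact: neg.
move: x k k0; apply: creation_ind => [||v p x IH].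
- do 2![apply: subspace_all => ?]; apply: subspace_eq.
    exact: (linear_comp T_linear (act_linear _ _)).
  apply: linear_sub; first exact: (linear_comp (act_linear _ _) T_linear).
  exact/linear_scale/act_linear.
- move=> k k0; rewrite T_vac act0r sub0r fock_act_vac // (lin0 T_linear).
  have [->|k1] := eqVneq k 0; first by rewrite scale0r oppr0.
  by rewrite fock_act_vac ?scaler0 ?oppr0 //; lia.
move=> k k0; set l := - p%:Z - 1; have l0 : l < 0 by rewrite /l; lia.
rewrite !(act_swap u v) !(linB T_linear) !(neg v) // IH //.
rewrite !(actDr, actNr, actZr) !(act_swap u v).
have -> : k + (l - 1) + 1 = k + l by lia.
have -> : k - 1 + l + 1 = k + l by lia.
set b := - 2%:R * B u v; set d := if k + l == 0 then b *: x else 0.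
have kd : l%:~R *: d = - (k%:~R *: d).
  rewrite -scaleNr /d; case: eqP => [kl|_]; last by rewrite !scaler0.
  by congr (_ *: _); rewrite -rmorphN; congr (_%:~R); lia.
have -> : T (if k + l + 1 == 0 then b *: x else 0) =
    if k + l + 1 == 0 then b *: T x else 0.
  by case: ifP => _; rewrite ?(linZ T_linear) ?(lin0 T_linear).
rewrite !scalerBr kd !(opprD, opprK) !addrA.
rewrite [LHS]addrAC; congr (_ + _).
by rewrite [RHS]addrAC -[X in _ = X + _]addrA subrr addr0.
Qed.

(** Reindexing a sum against the absorption identity for binomials. *)
Lemma sbin_shift (l : int) (F : nat -> V) : evz F ->
  fsum (fun j => (sbin l j * (l - j%:Z)%:~R) *: F j.+1) =
  - fsum (fun j => (sbin l j * j%:R) *: F j).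
Proof.
move=> Fz; rewrite [in RHS]fsum_recl; last exact: evzZ.
rewrite mulr0 scale0r add0r -fsumN; last first.
  by apply: (evzZ (fun j => sbin l j.+1 * j.+1%:R)); apply: evz_succ.
apply: eq_fsum => j; rewrite -scaleNr; congr (_ *: _).
rewrite -[in RHS]mulrA [binz _ _ _ * _]mulrC binz_absorb exprS.
ring.
Qed.

Lemma sbin_down (l : int) j :
  l%:~R * sbin (l - 1) j = sbin l j * (l - j%:Z)%:~R.
Proof. by rewrite mulrCA -binz_absorb1 binz_absorb -mulrA [_%:~R * _]mulrC. Qed.

(** In [Y(u_(l) x)], translating [u] and translating [x] shift the summation
    index in opposite directions, which leaves the factor [- n]. *)
Lemma Y_translate_state x (n : int) w :
  Y (T x) n w = - n%:~R *: Y x (n - 1) w.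
Proof.
move: x n w; apply: creation_ind => [||u k x IH].
- do 2![apply: subspace_all => ?]; apply: subspace_eq.
    exact: (linear_comp (Y_linl _ _) T_linear).
  exact/linear_scale/Y_linl.
- move=> n w; rewrite T_vac Y0l Y_vac; case: eqP => n1; last by rewrite scaler0.
  have -> : n = 0 by lia.
  by rewrite oppr0 scale0r.
move=> n w; set l := - k%:Z - 1; have l0 : l < 0 by rewrite /l; lia.
clearbody l.
have IHp q z : Y (parity (T x)) q z = - q%:~R *: Y (parity x) (q - 1) z.
  by rewrite -[z]parityK -Y_parity IH (linZ parity_linear) Y_parity.
have -> : T (act u l x) = act u l (T x) - l%:~R *: act u (l - 1) x by exact: T_act.
rewrite YBl YZl act_iterate_pred // !act_iterate2 //; last by lia.
pose F j := act u (l - j%:Z) (Y x (n + j%:Z - 1) w).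
pose G j := (-1) ^ l *: Y (parity x) (l + n - j%:Z - 1) (act u j w).
have Fz : evz F.
  have [N wN] := evz_Y x w (n - 1); exists N => j jN.
  by rewrite /F (_ : n + j%:Z - 1 = n - 1 + j%:Z) ?wN ?act0r //; lia.
have Gz : evz G.
  by have [N wN] := evz_act u w; exists N => j /wN; rewrite /G => ->; rewrite Y0r scaler0.
have sz c H : evz H -> evz (fun j => (c j : C) *: H j : V) by apply: evzZ.
have sz2 (e : C) c H : evz H -> evz (fun j => e *: ((c j : C) *: H j) : V).
  by move=> Hz; apply: (sz (fun=> e)); apply: sz.
have -> : fsum (fun j => sbin l j *: act u (l - j%:Z) (Y (T x) (n + j%:Z) w)) =
    - n%:~R *: fsum (fun j => sbin l j *: F j) - fsum (fun j => (sbin l j * j%:R) *: F j).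
  rewrite -fsumZ; last exact: sz.
  rewrite -fsumB; [|exact: sz2|exact: sz].
  apply: eq_fsum => j; rewrite IH actZr !scalerA -scalerBl.
  by congr (_ *: _); rewrite rmorphD /=; ring.
have -> : fsum (fun j => (sbin l j * (-1) ^ l) *: Y (parity (T x)) (l + n - j%:Z) (act u j w)) =
    - n%:~R *: fsum (fun j => sbin l j *: G j) - fsum (fun j => (sbin l j * (l - j%:Z)%:~R) *: G j).
  rewrite -fsumZ; last exact: sz.
  rewrite -fsumB; [|exact: sz2|exact: sz].
  apply: eq_fsum => j; rewrite IHp /G !scalerA -scalerBl.
  congr (_ *: _); rewrite !(rmorphD, rmorphN) /=; ring.
rewrite scalerBr.
have -> : l%:~R *: fsum (fun j => sbin (l - 1) j *: act u (l - 1 - j%:Z) (Y x (n + j%:Z) w)) =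
    - fsum (fun j => (sbin l j * j%:R) *: F j).
  rewrite -sbin_shift // -fsumZ; last exact: iterate_evz_l.
  apply: eq_fsum => j; rewrite scalerA sbin_down.
  by congr (_ *: act _ _ (Y _ _ _)); lia.
have -> : l%:~R *: fsum (fun j => (sbin (l - 1) j * (-1) ^ (l - 1)) *:
      Y (parity x) (l - 1 + n - j%:Z) (act u j w)) =
    - fsum (fun j => (sbin l j * (l - j%:Z)%:~R) *: G j).
  rewrite -fsumN; last exact: sz.
  rewrite -fsumZ; last exact: iterate_evz_r.
  apply: eq_fsum => j; rewrite scalerA mulrA sbin_down -[RHS]scaleNr /G scalerA.
  congr (_ *: Y _ _ _); last by lia.
  by rewrite exprzDr ?unitrN1 // exprN1 invrN1; set e := (-1) ^ l; ring.
by rewrite !scalerBr subrACA opprK subrK opprK subrK.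
Qed.

(** Applying [T_act] to either half of the iterate formula yields, besides the terms
    in [n], two sums that cancel by [sbin_shift]. *)
Lemma T_Y x (n : int) w : T (Y x n w) = Y x n (T w) - n%:~R *: Y x (n - 1) w.
Proof.
move: x n w; apply: creation_ind => [||u k x IH].
- do 2![apply: subspace_all => ?]; apply: subspace_eq.
    exact: (linear_comp T_linear (Y_linl _ _)).
  by apply: linear_sub; [exact: Y_linl|exact/linear_scale/Y_linl].
- move=> n w; rewrite !Y_vac; case: eqP => [->|n1].
    by rewrite -[-1 - 1 == -1]/false scaler0 subr0.
  rewrite (lin0 T_linear) sub0r; case: eqP => [n0|_]; last by rewrite scaler0 oppr0.
  have -> : n = 0 by lia.
  by rewrite scale0r oppr0.
move=> n w; set l := - k%:Z - 1; have l0 : l < 0 by rewrite /l; lia.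
clearbody l.
have IHp q z : T (Y (parity x) q z) =
    Y (parity x) q (T z) - q%:~R *: Y (parity x) (q - 1) z.
  rewrite -[z]parityK -Y_parity -T_parity IH (linB parity_linear).
  by rewrite (linZ parity_linear) Y_parity T_parity Y_parity.
rewrite act_iterate_pred // !act_iterate2 //.
pose F j := act u (l - j%:Z) (Y x (n + j%:Z - 1) w).
pose G j := (-1) ^ l *: Y (parity x) (l + n - j%:Z - 1) (act u j w).
(* [G] with its index shifted down, to which [sbin_shift] applies. *)
pose H j := (-1) ^ l *: Y (parity x) (l + n - j%:Z) (act u (j%:Z - 1) w).
have Fz : evz F.
  have [N wN] := evz_Y x w (n - 1); exists N => j jN.
  by rewrite /F (_ : n + j%:Z - 1 = n - 1 + j%:Z) ?wN ?act0r //; lia.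
have Gz : evz G.
  by have [N wN] := evz_act u w; exists N => j /wN; rewrite /G => ->; rewrite Y0r scaler0.
have Hz : evz H.
  have [N wN] := act_truncation w; exists N.+1 => j jN.
  by rewrite /H wN ?Y0r ?scaler0 //; lia.
have sz c E : evz E -> evz (fun j => (c j : C) *: E j : V) by apply: evzZ.
have sz2 (e : C) c E : evz E -> evz (fun j => e *: ((c j : C) *: E j) : V).
  by move=> Ez; apply: (sz (fun=> e)); apply: sz.
rewrite (linB T_linear) (lin_fsum T_linear); last exact: iterate_evz_l.
rewrite (lin_fsum T_linear); last exact: iterate_evz_r.
have -> : fsum (fun j => T (sbin l j *: act u (l - j%:Z) (Y x (n + j%:Z) w))) =
    fsum (fun j => sbin l j *: act u (l - j%:Z) (Y x (n + j%:Z) (T w))) -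
    n%:~R *: fsum (fun j => sbin l j *: F j).
  rewrite -fsumZ; last exact: sz.
  have E : fsum (fun j => (sbin l j * j%:R) *: F j) +
           fsum (fun j => (sbin l j * (l - j%:Z)%:~R) *: F j.+1) = 0.
    by rewrite sbin_shift // addrN.
  rewrite -fsumB; [|exact: iterate_evz_l|exact: sz2].
  rewrite -[RHS]subr0 -E -fsumD; [|exact: sz|apply: sz; exact: evz_succ].
  rewrite -fsumB; last 2 first.
  + apply: evzB; first exact: iterate_evz_l.
    exact: sz2.
  + by apply: evzD; [exact: sz|apply: sz; exact: evz_succ].
  apply: eq_fsum => j; rewrite (linZ T_linear) T_act IH actDr actNr actZr.
  have -> : F j.+1 = act u (l - j%:Z - 1) (Y x (n + j%:Z) w).
    by congr (act _ _ (Y _ _ _)); lia.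
  rewrite !scalerBr !scalerA -/(F j) -!addrA; congr (_ + _).
  rewrite [in RHS]opprD [RHS]addrA; congr (_ - _).
  by rewrite -[RHS]opprD -scalerDl; congr (- (_ *: _)); rewrite rmorphD /=; ring.
have -> : fsum (fun j => T ((sbin l j * (-1) ^ l) *: Y (parity x) (l + n - j%:Z) (act u j w))) =
    fsum (fun j => (sbin l j * (-1) ^ l) *: Y (parity x) (l + n - j%:Z) (act u j (T w))) -
    n%:~R *: fsum (fun j => sbin l j *: G j).
  rewrite -fsumZ; last exact: sz.
  have E : fsum (fun j => (sbin l j * j%:R) *: H j) +
           fsum (fun j => (sbin l j * (l - j%:Z)%:~R) *: H j.+1) = 0.
    by rewrite sbin_shift // addrN.
  rewrite -fsumB; [|exact: iterate_evz_r|exact: sz2].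
  rewrite -[RHS]subr0 -E -fsumD; [|exact: sz|apply: sz; exact: evz_succ].
  rewrite -fsumB; last 2 first.
  + apply: evzB; first exact: iterate_evz_r.
    exact: sz2.
  + by apply: evzD; [exact: sz|apply: sz; exact: evz_succ].
  apply: eq_fsum => j; rewrite (linZ T_linear) IHp T_act YBr YZr.
  have -> : H j.+1 = G j.
    by congr (_ *: Y _ _ (act _ _ _)); lia.
  rewrite /G /H !scalerBr !scalerA opprD -!addrA; congr (_ + _).
  rewrite [RHS]addrCA; congr (- (_ *: _) + _).
    by rewrite mulrAC.
  rewrite -[RHS]opprD -scalerDl; congr (- (_ *: _)).
  rewrite !(rmorphD, rmorphN) /=; ring.
by rewrite scalerBr subrACA.
Qed.

(** * Skew-symmetry *)

(** The divided powers of the translation operator. *)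
Definition E (i : nat) (x : V) : V := Y x (- i%:Z - 1) vac.

Lemma E_linear i : linear (E i). Proof. exact: Y_linl. Qed.

Lemma E0 x : E 0 x = x.
Proof. by rewrite /E oppr0 add0r Y_creationN1. Qed.

Lemma E_T i x : E i (T x) = i.+1%:R *: E i.+1 x.
Proof.
rewrite /E Y_translate_state; congr (_ *: Y _ _ _); last by lia.
by rewrite -rmorphN /= -[i.+1%:R]/(i.+1%:Z%:~R); congr (_%:~R); lia.
Qed.

Lemma Y_E i x n w : Y (E i x) n w = sbin n i *: Y x (n - i%:Z) w.
Proof.
elim: i x n => [|i IH] x n; first by rewrite E0 binz0 mulr1 scale1r subr0.
apply: (scalerI (natC_neq0 R i)); rewrite -YZl -E_T IH Y_translate_state !scalerA.
congr (_ *: Y _ _ _); last by lia.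
by rewrite [RHS]mulrCA binz_absorb exprS; ring.
Qed.

Lemma E_E t q x : E t (E q x) = 'C(t + q, q)%:R *: E (t + q)%N x.
Proof.
rewrite {1}/E Y_E; congr (_ *: Y _ _ _); last by lia.
by rewrite binz_neg mulrA sign_sqrn mul1r -PoszD binz_nat.
Qed.

Lemma E_act i u l x : l < 0 ->
  E i (act u l x) = \sum_(s < i.+1) sbin l s *: act u (l - s%:Z) (E (i - s)%N x).
Proof.
move=> l0; rewrite /E act_state // (@fsumE _ _ i.+1) => [|j ij]; last first.
  by rewrite Y_creation ?act0r ?scaler0 //; lia.
apply: eq_bigr => s _; congr (_ *: act _ _ (Y _ _ _)).
by have := ltn_ord s; lia.
Qed.

Lemma iter_parity_act a u n x :
  iter a parity (act u n x) = (-1) ^+ a *: act u n (iter a parity x).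
Proof.
elim: a => [|a IH] /=; first by rewrite scale1r.
by rewrite IH (linZ parity_linear) parity_act exprS mulN1r scaleNr scalerN.
Qed.

(** Skew-symmetry for a state of length [a], whose parity sign [(-1)^(a b)] against
    an arbitrary [v] is encoded by applying the parity involution [a] times. *)
Definition skew a (u : V) := forall v k, Y u k v =
  - fsum (fun t => ((-1) ^ k * (-1) ^+ t) *: E t (Y (iter a parity v) (k + t%:Z) u)).

Lemma skew_evz (c : nat -> C) v k u :
  evz (fun t : nat => c t *: E t (Y v (k + t%:Z) u)).
Proof.
by have [N uN] := evz_Y v u k; exists N => t /uN ->; rewrite (lin0 (E_linear _)) scaler0.
Qed.

(** Both sides are [v] or zero: for [k < 0] the sum over [t] is a binomial expansion
    of [(1 - 1)^r] with [r = - k - 1]. *)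
Lemma skew_vac : skew 0 vac.
Proof.
move=> v k /=; rewrite Y_vac; case: (ltrP k 0) => k0; last first.
  rewrite ifF; last by lia.
  rewrite fsum_eq0 ?oppr0 // => t; rewrite Y_creation ?(lin0 (E_linear _)) ?scaler0 //.
  by lia.
pose r := `|k|.-1; have kr : k = - r%:Z - 1 by rewrite /r; lia.
rewrite (@fsumE _ _ r.+1) => [|t rt]; last first.
  by rewrite Y_creation ?(lin0 (E_linear _)) ?scaler0 //; lia.
have -> : \sum_(t < r.+1) ((-1) ^ k * (-1) ^+ t) *: E t (Y v (k + t%:Z) vac) =
    ((-1) ^ k * (1 - 1) ^+ r) *: E r v.
  rewrite exprBn mulr_sumr scaler_suml; apply: eq_bigr => t _.
  have tr : (t <= r)%N by rewrite -ltnS.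
  have -> : Y v (k + t%:Z) vac = E (r - t)%N v by rewrite /E; congr (Y _ _ _); lia.
  rewrite E_E subnKC // scalerA !expr1n mulr1 bin_sub //.
  by rewrite mulr_natr mulrnAr !mulr1.
have -> : (k == -1) = (r == 0%N) by rewrite /r; lia.
rewrite subrr expr0n; case: eqP kr => [-> ->|_ _]; last first.
  by rewrite mulr0 scale0r oppr0.
by rewrite oppr0 add0r mulr1 exprN1 invrN1 scaleN1r opprK E0.
Qed.

(** Skew-symmetry passes to [g_(l) u] by expanding the left-hand side with the
    iterate formula and the right-hand side with the commutator formula. *)
Lemma skew_symmetry : forall a u, level a u -> skew a u.
Proof.
apply: level_ind => [a| |a g p x xa IH v k].
- apply: subspace_all => v; apply: subspace_all => k; apply: subspace_eq.
    exact: Y_linl.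
  apply/linear_opp/linear_fsum => [t|u]; last exact: skew_evz.
  exact/linear_scale/(linear_comp (E_linear _))/Y_linr.
- exact: skew_vac.
set l : int := - p%:Z - 1; have l0 : l < 0 by rewrite /l; lia.
clearbody l; set v' := iter a parity v.
pose e t : C := (-1) ^ k * (-1) ^+ t.
pose G s t : V := (sbin l s * e (s + t)%N) *:
  act g (l - s%:Z) (E t (Y v' (k + (s + t)%N%:Z) x)).
pose H s t : V := (bin l s * e t) *: E t (Y (act g s v') (l + k - s%:Z + t%:Z) x).
have [N vN] := evz_Y v' x k; pose L := `|(l + k)%R|%N.
have [S gS] := evz_act g v'.
have [K gK] := Y_trunc_l x (evz_act g v').
have G0 s t : (N <= s + t)%N -> G s t = 0.
  by move=> st; rewrite /G vN // (lin0 (E_linear _)) act0r scaler0.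
have H0 s t : (S + K + L <= s)%N || (S + K + L <= t)%N -> H s t = 0.
  rewrite /H => st; case: (ltnP s S) => sS.
    by rewrite gK ?(lin0 (E_linear _)) ?scaler0 //; move: st; rewrite /L; lia.
  by rewrite gS // Y0l (lin0 (E_linear _)) scaler0.
have HzN : evz (fun t => fsum (H^~ t)).
  exists (S + K + L)%N => t tN.
  by apply: fsum_eq0 => s; rewrite H0 ?tN ?orbT.
have -> : fsum (fun t => e t *: E t (Y (iter a.+1 parity v) (k + t%:Z) (act g l x))) =
    fsum (fun i => \sum_(s < i.+1) G s (i - s)%N) - fsum (fun t => fsum (H^~ t)).
  rewrite -fsumB //; last first.
    exists N => i iN; apply: big1 => s _; rewrite G0 // subnKC // -ltnS.
    exact: ltn_ord.
  apply: eq_fsum => t /=.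
  have -> : Y (parity v') (k + t%:Z) (act g l x) = act g l (Y v' (k + t%:Z) x) -
      fsum (fun s => bin l s *: Y (act g s v') (l + (k + t%:Z) - s%:Z) x).
    by rewrite act_commutator addrK.
  rewrite (linB (E_linear t)) scalerBr E_act // scaler_sumr; congr (_ - _).
    apply: eq_bigr => s _; have st : (s <= t)%N by rewrite -ltnS.
    by rewrite /G subnKC // scalerA mulrC.
  rewrite (lin_fsum (E_linear t)); last exact: commutator_evz.
  rewrite -fsumZ; last by apply: (evz_lin (E_linear t)); exact: commutator_evz.
  apply: eq_fsum => s; rewrite (linZ (E_linear t)) scalerA mulrC /H.
  by congr (_ *: E _ (Y _ _ _)); lia.
rewrite (fsum_triangle G0) opprB act_iterate2 // addrC; congr (_ + _).
- rewrite (fsum_exchange (F := fun t s => H s t) (N := S + K + L)%N); last first.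
    by move=> i j; rewrite orbC; apply: H0.
  rewrite -fsumN; last exact: iterate_evz_r.
  apply: eq_fsum => s; rewrite (level_parity xa) YZl IH iter_parity_act.
  rewrite -/v' scalerN scalerN opprK !scalerA -fsumZ; last exact: skew_evz.
  apply: eq_fsum => t; rewrite YZl (linZ (E_linear t)) !scalerA /H.
  congr (_ *: _); rewrite sign_sub exprzDr ?unitrN1 // /e.
  transitivity (((-1) ^ l * (-1) ^ l) * ((-1) ^+ s * (-1) ^+ s) *
      ((-1) ^+ a * (-1) ^+ a) * (bin l s * ((-1) ^ k * (-1) ^+ t)) : C).
    by ring.
  by rewrite sign_sqr !sign_sqrn !mul1r.
- rewrite -fsumN; last first.
    exists N => s sN; apply: fsum_eq0 => t; rewrite G0 //.
    exact: leq_trans sN (leq_addr _ _).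
  apply: eq_fsum => s; rewrite IH -/v' actNr scalerN; congr (- _).
  rewrite (lin_fsum (act_linear _ _)); last exact: skew_evz.
  rewrite -fsumZ; last by apply: (evz_lin (act_linear _ _)); exact: skew_evz.
  apply: eq_fsum => t; rewrite actZr scalerA /G /e sign_add exprD PoszD addrA.
  by congr (_ *: _); ring.
Qed.

(** * The Borcherds identity *)

Section BorcherdsIdentity.

(** The two sides of the identity, [e] being the sign exchanging the states. *)
Definition lhs_term u v (l m n : int) w (j : nat) : V :=
  bin m j *: Y (Y u (l + j%:Z) v) (m + n - j%:Z) w.

Definition rhs_term (e : C) u v (l m n : int) w (j : nat) : V :=
  sbin l j *: (Y u (l + m - j%:Z) (Y v (n + j%:Z) w)
    - ((-1) ^ l * e) *: Y v (l + n - j%:Z) (Y u (m + j%:Z) w)).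

Definition lhs u v l m n w : V := fsum (lhs_term u v l m n w).
Definition rhs e u v l m n w : V := fsum (rhs_term e u v l m n w).

Definition borcherds_for e u v := forall l m n w,
  lhs u v l m n w = rhs e u v l m n w.

(** The case [m = 0], expressing the modes of [u_(l) v]. *)
Definition associates_for e u v := forall l n w,
  Y (Y u l v) n w = rhs e u v l 0 n w.

Lemma lhs_evz u v l m n w : evz (lhs_term u v l m n w).
Proof.
have [N vN] := evz_Y u v l; exists N => j /vN; rewrite /lhs_term => ->.
by rewrite Y0l scaler0.
Qed.

Lemma rhs_evz e u v l m n w : evz (rhs_term e u v l m n w).
Proof.
have [N vN] := evz_Y v w n; have [M uM] := evz_Y u w m.
exists (maxn N M) => j; rewrite geq_max /rhs_term => /andP[/vN -> /uM ->].
by rewrite !Y0r scaler0 subr0 scaler0.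
Qed.

Hint Resolve lhs_evz rhs_evz : core.

Lemma lhs0 u v l n w : lhs u v l 0 n w = Y (Y u l v) n w.
Proof.
rewrite /lhs (@fsum_single _ _ 0%N) => [|[|j] // _].
  by rewrite /lhs_term binz0 scale1r addr0 subr0 add0r.
by rewrite /lhs_term binz_small ?scale0r.
Qed.

Lemma borcherds_associates e u v : borcherds_for e u v -> associates_for e u v.
Proof. by move=> uv l n w; rewrite -uv lhs0. Qed.

(** Pascal's rule in [m] on the left and in [l] on the right make both sides of the
    identity satisfy the same three-term recursion. *)
Lemma lhs_pascal u v (l m n : int) w :
  lhs u v l (m + 1) n w = lhs u v (l + 1) m n w + lhs u v l m (n + 1) w.
Proof.
rewrite /lhs fsum_recl // [X in _ = _ + X]fsum_recl // addrCA; congr (_ + _).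
  by rewrite /lhs_term !binz0 !subr0 -addrA [1 + n]addrC.
rewrite -fsumD //; last exact: evz_succ.
apply: eq_fsum => j; rewrite /lhs_term binz_pascal scalerDl addrC.
congr (_ *: Y (Y _ _ _) _ _ + _ *: Y _ _ _); lia.
Qed.

Lemma rhs_pascal e u v (l m n : int) w :
  rhs e u v l (m + 1) n w = rhs e u v (l + 1) m n w + rhs e u v l m (n + 1) w.
Proof.
apply/eqP; rewrite -subr_eq; apply/eqP.
pose F j : V := Y u (l + m + 1 - j%:Z) (Y v (n + j%:Z) w)
  + ((-1) ^ l * e) *: Y v (l + n + 1 - j%:Z) (Y u (m + j%:Z) w).
have Fz (c : nat -> C) : evz (fun j => c j *: F j).
  have [N vN] := evz_Y v w n; have [M uM] := evz_Y u w m.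
  exists (maxn N M) => j; rewrite geq_max /F => /andP[/vN -> /uM ->].
  by rewrite !Y0r scaler0 addr0 scaler0.
have -> : rhs e u v (l + 1) m n w =
    fsum (fun j => sbin l j *: F j) - fsum (fun j => sbin l j *: F j.+1).
  have FE j : rhs_term e u v (l + 1) m n w j = sbin (l + 1) j *: F j.
    rewrite /rhs_term /F sign_add expr1 mulrN1 mulNr scaleNr opprK.
    by congr (_ *: (Y _ _ _ + _ *: Y _ _ _)); lia.
  rewrite /rhs (eq_fsum FE) fsum_recl // [X in _ = X - _]fsum_recl //.
  rewrite -addrA !binz0; congr (_ + _).
  rewrite -fsumB; last 2 first.
  - exact: (evz_succ (Fz (fun j => sbin l j))).
  - exact: (evz_succ (Fz (fun j => sbin l j.-1))).
  apply: eq_fsum => j; rewrite -scalerBl binz_pascal; congr (_ *: _).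
  by rewrite exprS; ring.
rewrite /rhs -!fsumB //; last first.
  exact: (evz_succ (Fz (fun j => sbin l j.-1))).
apply: eq_fsum => j; rewrite /rhs_term /F -!scalerBr; congr (_ *: _).
have -> : l + (m + 1) - j%:Z = l + m + 1 - j%:Z by lia.
have -> : l + m + 1 - j.+1%:Z = l + m - j%:Z by lia.
have -> : n + 1 + j%:Z = n + j.+1%:Z by lia.
have -> : l + (n + 1) - j%:Z = l + n + 1 - j%:Z by lia.
have -> : m + 1 + j%:Z = m + j.+1%:Z by lia.
have -> : l + n + 1 - j.+1%:Z = l + n - j%:Z by lia.
set a := Y u _ _; set b := Y v _ _; set c := Y u _ _; set d := Y v _ _.
set s := _ * e.
by rewrite !(opprD, opprK) addrACA [RHS]addrACA [- (s *: b) + _]addrC.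
Qed.

(** The recursion in [l] propagates the identity from the planes [m = 0] and
    [n = 0] to all indices. *)
Lemma borcherds_from_planes e u v :
  (forall l n w, lhs u v l 0 n w = rhs e u v l 0 n w) ->
  (forall l m w, lhs u v l m 0 w = rhs e u v l m 0 w) ->
  borcherds_for e u v.
Proof.
move=> m0 n0.
have mpos (m : nat) l n w : lhs u v l m n w = rhs e u v l m n w.
  elim: m l n => [|m IH] l n; first exact: m0.
  by rewrite -addn1 PoszD lhs_pascal rhs_pascal !IH.
have npos (n : nat) l m w : lhs u v l m n w = rhs e u v l m n w.
  elim: n l m => [|n IH] l m; first exact: n0.
  apply: (addrI (lhs u v (l + 1) m n w)).
  by rewrite -addn1 PoszD -lhs_pascal !IH rhs_pascal.
move=> l m n w; case: (lerP 0 m) => [m_ge0|mneg].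
  by rewrite -(gez0_abs m_ge0).
case: (lerP 0 n) => [n_ge0|nneg]; first by rewrite -(gez0_abs n_ge0).
have -> : m = - `|m|%N%:Z by lia.
have -> : n = - `|n|%N%:Z by lia.
elim: `|m|%N `|n|%N l => [|p IHp] q l; first by rewrite oppr0.
elim: q l => [|q IHq] l; first by rewrite oppr0.
have := lhs_pascal u v (l - 1) (- p.+1%:Z) (- q.+1%:Z) w.
have := rhs_pascal e u v (l - 1) (- p.+1%:Z) (- q.+1%:Z) w.
rewrite subrK.
have -> : - p.+1%:Z + 1 = - p%:Z by lia.
have -> : - q.+1%:Z + 1 = - q%:Z by lia.
by rewrite IHp IHq => -> /addIr.
Qed.

(** Exchanging the two states by skew-symmetry turns the product of index [l] into a
    sum over [t] of translates, whose modes are those of the left-hand side at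
    [n = 0]. *)
Lemma skew_plane e u v : e * e = 1 ->
  (forall l, Y v l u = (- e) *: fsum (fun t =>
     ((-1) ^ l * (-1) ^+ t) *: E t (Y u (l + t%:Z) v))) ->
  associates_for e v u ->
  forall l m w, lhs u v l m 0 w = rhs e u v l m 0 w.
Proof.
move=> ee vu assoc l m w; pose s : C := (-1) ^ l * e.
have ss : s * s = 1 by rewrite mulrACA sign_sqr ee mulr1.
have s0 : - s != 0.
  by rewrite oppr_eq0; apply: contra_eq_neq ss => ->; rewrite mulr0 eq_sym oner_eq0.
apply: (scalerI s0); transitivity (Y (Y v l u) m w).
  rewrite vu YZl Yfsuml; last exact: skew_evz.
  rewrite -fsumZ // -fsumZ; last first.
    have [N vN] := evz_Y u v l; exists N => t /vN ->.
    by rewrite (lin0 (E_linear _)) scaler0 Y0l.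
  apply: eq_fsum => t; rewrite /lhs_term YZl Y_E !scalerA addr0.
  congr (_ *: _); rewrite -[LHS]mul1r -{1}(sign_sqrn R t) /s.
  by ring.
rewrite assoc /rhs -fsumZ //; apply: eq_fsum => j; rewrite /rhs_term !addr0 add0r.
rewrite [RHS]scalerA [- s * _]mulrC -[RHS]scalerA; congr (_ *: _).
by rewrite -/s scalerBr scalerA mulNr ss scaleN1r opprK addrC scaleNr.
Qed.

End BorcherdsIdentity.

(** The associativity identity on the vacuum, by induction on the mode: the
    derivation [T] produces each coefficient from the previous one. *)
Lemma Y_state u v (l n : int) :
  Y (Y u l v) n vac = fsum (fun j => sbin l j *: Y u (l - j%:Z) (Y v (n + j%:Z) vac)).
Proof.
case: (lerP 0 n) => n0.
  rewrite Y_creation // fsum_eq0 // => j.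
  by rewrite Y_creation ?Y0r ?scaler0 //; lia.
have -> : n = - (`|n|.-1)%:Z - 1 by lia.
elim: (`|n|.-1) u v l => [|r IH] u v l.
  rewrite Y_creationN1 (@fsum_single _ _ 0%N) => [|[|j] // _].
    by rewrite binz0 mulr1 scale1r subr0 addr0 Y_creationN1.
  by rewrite Y_creation ?Y0r ?scaler0 //; lia.
apply: (scalerI (natC_neq0 R r)).
pose F j := Y u (l - j%:Z) (Y v (- r.+1%:Z - 1 + j%:Z) vac).
have Fz : evz F.
  by have [N vN] := evz_Y v vac (- r.+1%:Z - 1); exists N => j /vN; rewrite /F => ->; rewrite Y0r.
have sz c H : evz H -> evz (fun j => (c j : C) *: H j : V) by apply: evzZ.
have -> : r.+1%:R *: Y (Y u l v) (- r.+1%:Z - 1) vac = Y (T (Y u l v)) (- r%:Z - 1) vac.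
  exact/esym/E_T.
rewrite T_Y YBl YZl !IH.
have -> : l%:~R *: fsum (fun j => sbin (l - 1) j *:
     Y u (l - 1 - j%:Z) (Y v (- r%:Z - 1 + j%:Z) vac)) =
   - fsum (fun j => (sbin l j * j%:R) *: F j).
  rewrite -sbin_shift // -fsumZ.
    apply: eq_fsum => j; rewrite scalerA sbin_down; congr (_ *: Y _ _ (Y _ _ _)); lia.
  have [N vN] := evz_Y v vac (- r%:Z - 1); exists N => j /vN ->.
  by rewrite Y0r scaler0.
rewrite opprK -fsumD.
- rewrite -fsumZ; last exact: sz.
  apply: eq_fsum => j; rewrite Y_translate_state YZr scalerA.
  have -> : - r%:Z - 1 + j%:Z - 1 = - r.+1%:Z - 1 + j%:Z by lia.
  rewrite -/(F j) -scalerDl scalerA; congr (_ *: _).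
  rewrite !(rmorphD, rmorphN) /= -[r.+1]addn1 natrD; ring.
- have [N vN] := evz_Y (T v) vac (- r%:Z - 1); exists N => j /vN ->.
  by rewrite Y0r scaler0.
- exact: sz.
Qed.

(** Up to signs the generating modes act on both sides of the associativity identity
    as derivations, so the identity on [w] gives the identity on [g_(k) w], once it
    is known for the pairs of states in which an annihilation mode has been
    applied to [u] or to [v]. *)
Lemma associates_covariant (a b : nat) e u v :
  parity u = (-1) ^+ a *: u -> parity v = (-1) ^+ b *: v ->
  (forall g (i : nat), associates_for (e * (-1) ^+ a) u (act g i v)) ->
  (forall g (i : nat), borcherds_for (e * (-1) ^+ b) (act g i u) v) ->
  associates_for e u v.
Proof.
move=> pu pv Hv Hu l n w; move: w l n; apply: creation_ind => [||g p x IH].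
- do 2![apply: subspace_all => ?]; apply: subspace_eq; first exact: Y_linr.
  apply: linear_fsum => [j|w]; last exact: rhs_evz.
  apply/linear_scale/linear_sub; first exact: (linear_comp (Y_linr _ _) (Y_linr _ _)).
  exact/linear_scale/(linear_comp (Y_linr _ _) (Y_linr _ _)).
- move=> l n; rewrite Y_state /rhs; apply: eq_fsum => j.
  by rewrite /rhs_term [Y u (0 + _) _]Y_creation // Y0r scaler0 subr0 addr0.
move=> l n; set k : int := - p%:Z - 1; clearbody k.
have actY y q z (c : C) : parity y = c *: y ->
    act g k (Y y q z) = c *: Y y q (act g k z) +
    fsum (fun i => bin k i *: Y (act g i y) (k + q - i%:Z) z).
  by move=> py; rewrite act_commutator py YZl.
have g_evz y q z (c : nat -> C) : evz (fun i : nat => c i *: Y (act g i y) (k + q - i%:Z) z).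
  exact: commutator_evz.
have [I uI] := evz_act g u.
have [J vJ] := evz_act g v.
pose al : C := (-1) ^+ a; pose be : C := (-1) ^+ b.
have al2 : al * al = 1 by apply: sign_sqrn.
have be2 : be * be = 1 by apply: sign_sqrn.
(* The corrections that appear when [g_(k)] passes [v] and [u]; both are right-hand
   sides of instances of the identity with a shorter state. *)
pose X1 i := (bin k i * al) *: rhs (e * al) u (act g i v) l 0 (k + n - i%:Z) x.
pose X2 h := bin k h *: rhs (e * be) (act g h u) v l (k - h%:Z) n x.
have X1z : evz X1.
  exists J => i iJ; rewrite /X1 /rhs fsum_eq0 ?scaler0 // => j.
  by rewrite /rhs_term vJ // !Y0l Y0r scaler0 subr0 scaler0.
have X2z : evz X2.
  exists I => i iI; rewrite /X2 /rhs fsum_eq0 ?scaler0 // => j.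
  by rewrite /rhs_term uI // !Y0l Y0r scaler0 subr0 scaler0.
have pz : parity (Y u l v) = (al * be) *: Y u l v.
  by rewrite Y_parity pu pv YZl YZr scalerA.
have L : act g k (Y (Y u l v) n x) =
    (al * be) *: Y (Y u l v) n (act g k x) + (fsum X1 + fsum X2).
  rewrite (actY _ _ _ _ pz); congr (_ + _).
  pose G h t : V := (bin k h * bin (k - h%:Z) t) *:
    Y (Y (act g h u) (l + t%:Z) v) (k - h%:Z + n - t%:Z) x.
  have [K uK] := Y_trunc_l v (evz_act g u).
  have G0 h t : (I + K + `|l|%N <= h + t)%N -> G h t = 0.
    move=> ht; rewrite /G; case: (ltnP h I) => hI; last by rewrite uI // !Y0l scaler0.
    by rewrite uK ?Y0l ?scaler0 //; lia.
  have -> : fsum X2 = fsum (fun i => \sum_(h < i.+1) G h (i - h)%N).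
    rewrite (fsum_triangle G0); apply: eq_fsum => h.
    rewrite /X2 -Hu /lhs -fsumZ; last exact: lhs_evz.
    by apply: eq_fsum => t; rewrite /lhs_term scalerA.
  rewrite -fsumD //; last first.
    exists (I + K + `|l|%N)%N => i iN; apply: big1 => h _.
    by rewrite G0 // subnKC // -ltnS ltn_ord.
  apply: eq_fsum => i; rewrite act_commutator YDl scalerDr pu !YZl; congr (_ + _).
    by rewrite scalerA /X1 Hv.
  rewrite Yfsuml; last exact: commutator_evz.
  rewrite (@fsumE _ _ i.+1) => [|h ih]; last by rewrite binz_small // YZl scale0r.
  rewrite scaler_sumr; apply: eq_bigr => h _; have hi : (h <= i)%N by rewrite -ltnS.
  rewrite YZl scalerA /G -binz_trinomial subnKC //.
  by congr (_ *: Y (Y _ _ _) _ _); lia.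
have Rr : act g k (rhs e u v l 0 n x) =
    (al * be) *: rhs e u v l 0 n (act g k x) + (fsum X1 + fsum X2).
  have [K1 vK1] := Y_trunc_l x (evz_act g v).
  have [K2 uK2] := Y_trunc_l x (evz_act g u).
  have [N1 xN1] := Y_trunc u x.
  have [N2 xN2] := Y_trunc v x.
  pose M := (I + J + K1 + K2 + N1 + N2 + `|k| + `|n| + `|l|)%N.
  pose F1 i j : V := (bin k i * al) *:
    rhs_term (e * al) u (act g i v) l 0 (k + n - i%:Z) x j.
  pose F2 h j : V := bin k h *: rhs_term (e * be) (act g h u) v l (k - h%:Z) n x j.
  have F10 i j : (M <= i)%N || (M <= j)%N -> F1 i j = 0.
    rewrite /M /F1 /rhs_term => ij; case: (ltnP i J) => iJ; last first.
      by rewrite vJ // !Y0l Y0r scaler0 subr0 !scaler0.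
    rewrite vK1; last by lia.
    by rewrite xN1 ?Y0r ?scaler0 ?subr0 ?scaler0 //; lia.
  have F20 h j : (M <= h)%N || (M <= j)%N -> F2 h j = 0.
    rewrite /M /F2 /rhs_term => hj; case: (ltnP h I) => hI; last first.
      by rewrite uI // !Y0l Y0r scaler0 subr0 !scaler0.
    rewrite uK2; last by lia.
    by rewrite xN2 ?Y0r ?scaler0 ?subr0 ?scaler0 //; lia.
  have -> : fsum X1 = fsum (fun j => fsum (F1^~ j)).
    rewrite -(fsum_exchange F10); apply: eq_fsum => i.
    by rewrite /X1 /rhs -fsumZ //; exact: rhs_evz.
  have -> : fsum X2 = fsum (fun j => fsum (F2^~ j)).
    rewrite -(fsum_exchange F20); apply: eq_fsum => i.
    by rewrite /X2 /rhs -fsumZ //; exact: rhs_evz.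
  rewrite (lin_fsum (act_linear _ _)); last exact: rhs_evz.
  rewrite -fsumZ; last exact: rhs_evz.
  have F1z : evz (fun j => fsum (F1^~ j)).
    by exists M => j jM; apply: fsum_eq0 => i; rewrite F10 ?jM ?orbT.
  have F2z : evz (fun j => fsum (F2^~ j)).
    by exists M => j jM; apply: fsum_eq0 => i; rewrite F20 ?jM ?orbT.
  rewrite -fsumD // -fsumD; [|by apply: evzZ; exact: rhs_evz|exact: evzD].
  apply: eq_fsum => j; rewrite /rhs_term actZr.
  rewrite (linB (act_linear _ _)) actZr (actY _ _ _ _ pu) (actY _ _ _ _ pv).
  rewrite (actY _ _ _ _ pv) (actY _ _ _ _ pu) !YDr !YZr -/al -/be.
  set c : C := sbin l j; set s : C := (-1) ^ l * e.
  set A := Y u _ (Y v _ (act g k x)); set D := Y v _ (Y u _ (act g k x)).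
  set P := Y u _ (fsum _); set P' := Y v _ (fsum _).
  set Q := fsum _; set Q' := fsum _.
  have -> : fsum (F1^~ j) = c *: (al *: P - s *: Q').
    rewrite /P /Q' Yfsumr; last exact: g_evz.
    rewrite -!fsumZ; [|exact: g_evz|]; last first.
      by exists J => i iJ; rewrite vJ // Y0l scaler0 Y0r.
    rewrite -fsumB; last 2 first.
    + by exists J => i iJ; rewrite vJ // Y0l scaler0 Y0r scaler0.
    + by exists J => i iJ; rewrite vJ // Y0l !scaler0.
    rewrite -fsumZ; last first.
      by exists J => i iJ; rewrite vJ // !Y0l !scaler0 Y0r !scaler0 subr0.
    apply: eq_fsum => i; rewrite /F1 /rhs_term YZr !scalerBr !scalerA.
    congr (_ *: Y _ _ (Y _ _ _) - _ *: Y _ _ _); try lia; rewrite -/al -/c; first by ring.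
    rewrite /s; transitivity ((al * al) * (c * ((-1) ^ l * e) * bin k i)); last first.
      by rewrite al2; ring.
    by ring.
  have -> : fsum (F2^~ j) = c *: (Q - (s * be) *: P').
    rewrite /P' /Q Yfsumr; last exact: g_evz.
    have z : evz (fun i : nat => Y v (l + n - j%:Z) (bin k i *: Y (act g i u) (k + (0 + j%:Z) - i%:Z) x)).
      by exists I => i iI; rewrite uI // Y0l scaler0 Y0r.
    rewrite -[_ *: fsum _]fsumZ // -fsumB; [|exact: g_evz|exact: (evzZ (fun=> _))].
    rewrite -fsumZ; last first.
      by exists I => i iI; rewrite uI // !Y0l !scaler0 Y0r !scaler0 subr0.
    apply: eq_fsum => i; rewrite /F2 /rhs_term YZr !scalerBr !scalerA.
    congr (_ *: Y _ _ _ - _ *: Y _ _ (Y _ _ _)); try lia; rewrite -/be -/c; first by ring.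
    by rewrite /s; ring.
  rewrite [(al * be) *: (c *: _)]scalerA [al * be * c]mulrC.
  rewrite -[(c * (al * be)) *: _]scalerA -!scalerDr; congr (_ *: _).
  rewrite !(scalerDr, scalerBr) !scalerA.
  have -> : s * be * al = al * be * s by ring.
  have regroup (q1 q2 q3 q4 q5 q6 : V) :
      q1 + q2 + q3 - (q4 + q5 + q6) = q1 - q4 + (q2 - q6 + (q3 - q5)).
    by rewrite [q2 - _ + _]addrACA -opprD [q6 + _]addrC addrACA -opprD !addrA.
  by rewrite mulrN1 mulNr scaleNr regroup.
have : (al * be) *: Y (Y u l v) n (act g k x) = (al * be) *: rhs e u v l 0 n (act g k x).
  by apply: (addIr (fsum X1 + fsum X2)); rewrite -L -Rr IH.
apply: scalerI; rewrite mulf_eq0 /al /be !expf_eq0 oppr_eq0 oner_eq0.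
by rewrite !andbF.
Qed.

Lemma rhs_linl e l m n v w : linear (fun u => rhs e u v l m n w).
Proof.
apply: linear_fsum => [j|u]; last exact: rhs_evz.
apply/linear_scale/linear_sub; first exact: Y_linl.
exact/linear_scale/(linear_comp (Y_linr _ _) (Y_linl _ _)).
Qed.

Lemma rhs_linr e l m n u w : linear (fun v => rhs e u v l m n w).
Proof.
apply: linear_fsum => [j|v]; last exact: rhs_evz.
apply/linear_scale/linear_sub; first exact: (linear_comp (Y_linr _ _) (Y_linl _ _)).
exact/linear_scale/Y_linl.
Qed.

Lemma lhs_linl l m n v w : linear (fun u => lhs u v l m n w).
Proof.
apply: linear_fsum => [j|u]; last exact: lhs_evz.
exact/linear_scale/(linear_comp (Y_linl _ _) (Y_linl _ _)).
Qed.

Lemma lhs_linr l m n u w : linear (fun v => lhs u v l m n w).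
Proof.
apply: linear_fsum => [j|v]; last exact: lhs_evz.
exact/linear_scale/(linear_comp (Y_linl _ _) (Y_linr _ _)).
Qed.

Lemma borcherds_subspacel e v : is_subspace (fun u => borcherds_for e u v).
Proof.
do 4![apply: subspace_all => ?]; apply: subspace_eq.
  exact: lhs_linl.
exact: rhs_linl.
Qed.

Lemma borcherds_subspacer e u : is_subspace (fun v => borcherds_for e u v).
Proof.
do 4![apply: subspace_all => ?]; apply: subspace_eq.
  exact: lhs_linr.
exact: rhs_linr.
Qed.

Lemma iter_parity_level a b u : level a u -> iter b parity u = (-1) ^+ (a * b) *: u.
Proof.
move=> ua; elim: b => [|b IH]; first by rewrite muln0 scale1r.
rewrite iterS IH (linZ parity_linear) (level_parity ua) scalerA.
by rewrite -exprD mulnS addnC.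
Qed.

(** Annihilation modes lower the total length of the two states, and this is
    what the induction is on. *)
Lemma borcherds_levels a b u v : level a u -> level b v ->
  borcherds_for ((-1) ^+ (a * b)) u v.
Proof.
have [n] := ubnP (a + b)%N; elim: n a b u v => // n IH a b u v; rewrite ltnS => abn.
have assoc (c d : nat) x y : (c + d = a + b)%N -> level c x -> level d y ->
    associates_for ((-1) ^+ (c * d)) x y.
  move=> cd xc yd; apply: (associates_covariant (level_parity xc) (level_parity yd)).
  - move=> g i; apply: borcherds_associates.
    case: d yd cd => [|d] yd cd.
      by rewrite (act_level0 _ _ yd); case: (borcherds_subspacer ((-1) ^+ (c * 0) * (-1) ^+ c) x).
    have -> : (-1) ^+ (c * d.+1) * (-1) ^+ c = (-1) ^+ (c * d) :> C.
      by rewrite mulnS exprD mulrAC sign_sqrn mul1r.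
    by apply: IH => //; [lia | apply: act_level_ge0].
  - move=> g i; case: c xc cd => [|c] xc cd.
      by rewrite (act_level0 _ _ xc); case: (borcherds_subspacel ((-1) ^+ (0 * d) * (-1) ^+ d) y).
    have -> : (-1) ^+ (c.+1 * d) * (-1) ^+ d = (-1) ^+ (c * d) :> C.
      by rewrite mulSn exprD mulrAC sign_sqrn mul1r.
    by apply: IH => //; [lia | apply: act_level_ge0].
move=> ua vb; apply: borcherds_from_planes.
- by move=> l k w; rewrite lhs0; apply: assoc.
- apply: skew_plane.
  + exact: sign_sqrn.
  + move=> l; rewrite (skew_symmetry vb) (iter_parity_level _ ua) scaleNr -fsumZ; last first.
      exact: skew_evz.
    congr (- _); apply: eq_fsum => t; rewrite YZl (linZ (E_linear _)) !scalerA.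
    by rewrite mulrC.
  + by rewrite mulnC; apply: assoc; rewrite // addnC.
Qed.

Lemma fock_borcherds : borcherds_identity (@fock_gr R U B) Y Y.
Proof.
move=> p q u v w l m n up vq.
suff uv : borcherds_for ((-1) ^+ (p && q)) u v by apply: uv.
have /grP pu := up; move: u {up} pu.
apply: (parity_levels (borcherds_subspacel _ _)) => a u ua ap.
have /grP pv := vq; move: v {vq} pv.
apply: (parity_levels (borcherds_subspacer _ _)) => b v vb bq.
by rewrite -ap -bq -oddM signr_odd; apply: borcherds_levels.
Qed.

Lemma fock_vertex_algebra : is_vertex_algebra (@fock_gr R U B) Y vac.
Proof.
split; [split| |exact: Y_creation|exact: Y_creationN1].
- exact: fock_gr_grading.
- exact: Y_linl.
- exact: Y_linr.
- move=> p q v n w /grP pv /grP qw; apply/grP.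
  by rewrite Y_parity pv qw YZl YZr scalerA -signr_addb.
- by move=> v w; have [N vN] := Y_trunc v w; exists N%:Z.
- exact: Y_vac.
- exact: fock_borcherds.
- by apply/grP; rewrite parity_vac scale1r.
Qed.

(** * The conformal and the charge vectors *)

(** The families [c_] and [d_] play the part of dual bases of the isotropic
    summands [a] and [a^*], up to the normalisation 1/2 of the form. *)
Variables (N : nat) (c_ d_ : 'I_N -> U).
Hypothesis B_cc : forall i j, B (c_ i) (c_ j) = 0.
Hypothesis B_dd : forall i j, B (d_ i) (d_ j) = 0.
Hypothesis B_cd : forall i j, B (c_ i) (d_ j) = (i == j)%:R / 2%:R.
Hypothesis B_span : forall u, u =
  \sum_i ((2%:R * B u (d_ i)) *: c_ i + (2%:R * B u (c_ i)) *: d_ i).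

(** Both vectors are locked so that simplification does not open the sums. *)
Definition omega : V := locked (2%:R^-1 *: \sum_i
  (act (c_ i) (-1) (act (d_ i) (-2) vac) + act (d_ i) (-1) (act (c_ i) (-2) vac))).

Lemma omegaE : omega = 2%:R^-1 *: \sum_i
  (act (c_ i) (-1) (act (d_ i) (-2) vac) + act (d_ i) (-1) (act (c_ i) (-2) vac)).
Proof. by rewrite /omega -lock. Qed.

Definition charge : V :=
  locked ('i *: \sum_i act (d_ i) (-1) (act (c_ i) (-1) vac)).

Lemma chargeE : charge = 'i *: \sum_i act (d_ i) (-1) (act (c_ i) (-1) vac).
Proof. by rewrite /charge -lock. Qed.

(** The involution whose eigenspaces are the spans of the [c_ i] and of the
    [d_ i]. Up to the factor ['i] it is the action of the charge on [U]. *)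
Definition swap_sign (u : U) : U :=
  \sum_i ((2%:R * B u (d_ i)) *: c_ i - (2%:R * B u (c_ i)) *: d_ i).

Lemma act_linearl n x : linear (fun u => act u n x).
Proof. by move=> c u v; apply: fock_act_linearl. Qed.

Lemma actDl u v n x : act (u + v) n x = act u n x + act v n x.
Proof. exact: linD (act_linearl n x) u v. Qed.

Lemma actZl a u n x : act (a *: u) n x = a *: act u n x.
Proof. exact: linZ (act_linearl n x) a u. Qed.

Lemma act0l n x : act 0 n x = 0.
Proof. exact: lin0 (act_linearl n x). Qed.

Lemma actNl u n x : act (- u) n x = - act u n x.
Proof. exact: linN (act_linearl n x) u. Qed.

Lemma act_suml (I : Type) (r : seq I) (G : I -> U) n x :
  act (\sum_(i <- r) G i) n x = \sum_(i <- r) act (G i) n x.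
Proof. by rewrite (lin_sum (act_linearl n x)). Qed.

Lemma act_span u n x : act u n x = \sum_i
  ((2%:R * B u (d_ i)) *: act (c_ i) n x + (2%:R * B u (c_ i)) *: act (d_ i) n x).
Proof.
rewrite {1}[u]B_span act_suml; apply: eq_bigr => i _.
by rewrite actDl !actZl.
Qed.

Lemma omega_level : level 2 omega.
Proof.
rewrite omegaE; have s := level_subspace 2.
apply: subspaceZ => //; apply: subspace_sum => // i; apply: subspaceD => //.
  by apply: (level_mono [:: (c_ i, 0%N); (d_ i, 1%N)]).
by apply: (level_mono [:: (d_ i, 0%N); (c_ i, 1%N)]).
Qed.

Lemma charge_level : level 2 charge.
Proof.
rewrite chargeE; have s := level_subspace 2; apply: subspaceZ => //; apply: subspace_sum => // i.
by apply: (level_mono [:: (d_ i, 0%N); (c_ i, 0%N)]).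
Qed.

Lemma parity_omega : parity omega = omega.
Proof. by rewrite (level_parity omega_level) expr2 mulrNN mulr1 scale1r. Qed.

Lemma parity_charge : parity charge = charge.
Proof. by rewrite (level_parity charge_level) expr2 mulrNN mulr1 scale1r. Qed.

Lemma act_quadratic u v w (m n k : int) : 0 <= k ->
  act u k (act v m (act w n vac)) =
  (if k + m + 1 == 0 then (- 2%:R * B u v) *: act w n vac else 0) -
  (if k + n + 1 == 0 then (- 2%:R * B u w) *: act v m vac else 0).
Proof.
move=> k0; rewrite act_swap (act_swap u w) [act u k vac]fock_act_vac // act0r subr0.
by congr (_ - _); case: ifP; rewrite ?actZr ?act0r.
Qed.

(** Pairing [u] with the letters of [omega] yields its coordinates in the dual
    bases, which reassemble [u]. *)
Lemma act_omega u (j : nat) : act u j omega =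
  match j with
  | 0 => - 2%:R^-1 *: act u (-2) vac
  | 1 => 2%:R^-1 *: act u (-1) vac
  | _ => 0
  end.
Proof.
rewrite omegaE actZr (lin_sum (act_linear _ _)).
case: j => [|[|j]].
- rewrite [in RHS]act_span scaleNr -scalerN -sumrN; congr (_ *: _).
  apply: eq_bigr => i _; rewrite actDr !act_quadratic //= !subr0 addrC.
  by rewrite !mulNr !scaleNr [RHS]opprD.
- rewrite [in RHS]act_span; congr (_ *: _).
  apply: eq_bigr => i _; rewrite actDr !act_quadratic //= !sub0r.
  by rewrite !mulNr !scaleNr !opprK.
- rewrite big1 ?scaler0 // => i _; rewrite actDr !act_quadratic //.
  have -> : (j.+2%:Z + -1 + 1 == 0) = false by lia.
  have -> : (j.+2%:Z + -2 + 1 == 0) = false by lia.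
  by rewrite !subr0 addr0.
Qed.

Lemma act_charge u (j : nat) : act u j charge =
  if j is 0 then - ('i *: act (swap_sign u) (-1) vac) else 0.
Proof.
rewrite chargeE actZr (lin_sum (act_linear _ _)); case: j => [|j].
- rewrite -scalerN; congr (_ *: _); rewrite /swap_sign act_suml -sumrN.
  apply: eq_bigr => i _; rewrite act_quadratic //= actDl actNl !actZl.
  by rewrite !mulNr !scaleNr [RHS]opprD.
- rewrite big1 ?scaler0 // => i _; rewrite act_quadratic //.
  have -> : (j.+1%:Z + -1 + 1 == 0) = false by lia.
  by rewrite subr0.
Qed.

Lemma generator_T u : act u (-2) vac = T (act u (-1) vac).
Proof. by rewrite T_act T_vac act0r sub0r scaleN1r opprK. Qed.

(** The generating fields are primary of weight 1/2. *)
Lemma omega_act (n : int) u (k : int) w :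
  Y omega n (act u k w) =
  act u k (Y omega n w) - (k%:~R + n%:~R / 2%:R) *: act u (k + n - 1) w.
Proof.
rewrite act_commutator parity_omega.
rewrite (@fsumE _ _ 2) => [|[|[|j]] // _]; last by rewrite act_omega Y0l scaler0.
rewrite big_ord_recr big_ord1 /= !act_omega generator_T !YZl binz0 binz1.
rewrite Y_translate_state !Y_generator subr0 !scalerA -scalerDl.
set x := _ *: act u (k + n - 1) w; set y := _ *: act u (k + n - 1) w.
suff -> : x = y by rewrite addrK.
rewrite /x /y; congr (_ *: _); by rewrite rmorphD /=; field.
Qed.

Lemma charge_act (n : int) u (k : int) w :
  Y charge n (act u k w) =
  act u k (Y charge n w) + 'i *: act (swap_sign u) (k + n) w.
Proof.
rewrite act_commutator parity_charge.
rewrite (@fsumE _ _ 1) => [|[|j] // _]; last by rewrite act_charge Y0l scaler0.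
rewrite big_ord1 /= act_charge binz0 scale1r YNl
  [Y ('i *: _) _ w]YZl Y_generator subr0.
by rewrite subrK.
Qed.

Lemma omega0E x : Y omega 0 x = T x.
Proof.
move: x; apply: creation_ind => [||u m x IH].
- apply: subspace_eq; [exact: Y_linr | exact: T_linear].
- by rewrite T_vac Y_creation.
- by rewrite omega_act T_act IH mul0r addr0 addr0.
Qed.

Lemma swap_sign_c i : swap_sign (c_ i) = c_ i.
Proof.
rewrite {2}[c_ i]B_span; apply: eq_bigr => j _.
by rewrite B_cc mulr0 scale0r subr0 addr0.
Qed.

Lemma swap_sign_d i : swap_sign (d_ i) = - d_ i.
Proof.
rewrite {2}[d_ i]B_span -sumrN; apply: eq_bigr => j _.
by rewrite B_dd mulr0 scale0r !add0r.
Qed.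

Lemma omega_quadratic u v (n : nat) (k : int) :
  Y omega n (act u (-1) (act v k vac)) =
  - (k%:~R + n%:R / 2%:R) *: act u (-1) (act v (k + n%:Z - 1) vac) -
  (- 1 + n%:R / 2%:R) *: act u (n%:Z - 2) (act v k vac).
Proof.
rewrite !omega_act Y_creation // act0r sub0r actNr actZr -scaleNr.
by congr (_ - _ *: act _ _ _); lia.
Qed.

Lemma charge_quadratic u v (n : nat) (k : int) :
  Y charge n (act u (-1) (act v k vac)) =
  'i *: act u (-1) (act (swap_sign v) (k + n%:Z) vac) +
  'i *: act (swap_sign u) (n%:Z - 1) (act v k vac).
Proof.
rewrite !charge_act Y_creation // act0r add0r actZr.
by congr (_ + _ *: act _ _ _); lia.
Qed.

Lemma Y_sum v n (F : 'I_N -> V) : Y v n (\sum_i F i) = \sum_i Y v n (F i).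
Proof. by rewrite (lin_sum (Y_linr v n)). Qed.

Lemma act_kill2 u v (m n : int) : 0 <= m -> m + n + 1 != 0 ->
  act u m (act v n vac) = 0.
Proof.
by move=> m0 /negbTE mn; rewrite act_swap mn [act u m vac]fock_act_vac // act0r subr0.
Qed.

Lemma act_pair u v (m n : int) : 0 <= m -> m + n + 1 = 0 ->
  act u m (act v n vac) = (- 2%:R * B u v) *: vac.
Proof.
by move=> m0 mn; rewrite act_swap mn eqxx [act u m vac]fock_act_vac // act0r subr0.
Qed.

Lemma omega_omega (n : nat) : Y omega n omega =
  match n with
  | 0 => T omega
  | 1 => 2%:R *: omega
  | 3 => (N%:R / 2%:R) *: vac
  | _ => 0
  end.
Proof.
case: n => [|n]; first exact: omega0E.
rewrite [X in Y _ _ X = _]omegaE YZr Y_sum.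
under eq_bigr => i _ do rewrite YDr !omega_quadratic.
case: n => [|[|[|n]]].
- rewrite omegaE [RHS]scalerA [2%:R * _]mulrC -[RHS]scalerA; congr (_ *: _).
  rewrite scaler_sumr; apply: eq_bigr => i _; rewrite scalerDr -!scalerBl.
  by congr (_ *: _ + _ *: _); field.
- rewrite big1 ?scaler0 // => i _; rewrite mulfV ?pnatr_eq0 //.
  rewrite (addNr (1 : C)) !scale0r !subr0 -scalerDr.
  rewrite [act (c_ i) _ _]act_swap /=.
  by rewrite sub0r addNr scaler0.
- under eq_bigr => i _.
    rewrite !(fock_act_vac _ _ (isT : 0 <= - 2 + 3%:Z - 1)) !act0r !scaler0 !sub0r.
    rewrite !act_pair // [B (d_ i) _]B_sym B_cd eqxx !scalerA -!scaleNr -scalerDl.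
    over.
  rewrite sumr_const card_ord -[X in _ *: X]scaler_nat !scalerA -[true%:R]/(1 : C); congr (_ *: _); by field.
- rewrite big1 ?scaler0 // => i _; rewrite !(fock_act_vac _ _ (n := _ + n.+4%:Z - 1)); try lia.
  by rewrite !act_kill2 ?act0r ?scaler0 ?subr0 ?addr0 //; lia.
Qed.

Lemma omega_charge (n : nat) : Y omega n charge =
  match n with 0 => T charge | 1 => charge | _ => 0 end.
Proof.
case: n => [|n]; first exact: omega0E.
rewrite [X in Y _ _ X = _]chargeE YZr Y_sum.
under eq_bigr => i _ do rewrite omega_quadratic.
case: n => [|[|n]].
- rewrite chargeE; congr (_ *: _); apply: eq_bigr => i _.
  by rewrite -!scalerBl -[RHS]scale1r; congr (_ *: _); by field.
- rewrite big1 ?scaler0 // => i _; rewrite mulfV ?pnatr_eq0 //.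
  by rewrite (addNr (1 : C)) oppr0 !scale0r subr0.
- rewrite big1 ?scaler0 // => i _; rewrite (fock_act_vac _ _ (n := _ + n.+3%:Z - 1)); last by lia.
  by rewrite !act_kill2 ?act0r ?scaler0 ?subr0 //; lia.
Qed.

Lemma charge_charge (n : nat) : Y charge n charge =
  if n is 1 then - N%:R *: vac else 0.
Proof.
rewrite [X in Y _ _ X = _]chargeE YZr Y_sum.
under eq_bigr => i _ do rewrite charge_quadratic swap_sign_c swap_sign_d.
case: n => [|[|n]].
- rewrite big1 ?scaler0 // => i _; rewrite actNl scalerN.
  by rewrite addrN.
- under eq_bigr => i _.
    rewrite (fock_act_vac _ _ (isT : 0 <= - 1 + 1%:Z)) act0r scaler0 add0r actNl act_pair // B_sym B_cd eqxx.
    rewrite -scaleNr !scalerA.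
    over.
  rewrite sumr_const card_ord -[X in _ *: X]scaler_nat !scalerA -[true%:R]/(1 : C); congr (_ *: _).
  have -> : - (- 2%:R * (1 / 2%:R)) = 1 :> C by field.
  by rewrite mulr1 mulrAC -expr2 sqr_i mulN1r.
- rewrite big1 ?scaler0 // => i _; rewrite fock_act_vac; last by lia.
  by rewrite act_kill2 ?act0r ?scaler0 ?addr0 //; lia.
Qed.

Lemma charge_omega (n : nat) : Y charge n omega =
  if n is 1 then charge else 0.
Proof.
rewrite [X in Y _ _ X = _]omegaE YZr Y_sum.
under eq_bigr => i _ do rewrite YDr !charge_quadratic !swap_sign_c !swap_sign_d.
case: n => [|[|[|n]]].
- rewrite big1 ?scaler0 // => i _.
  by rewrite !actNl !actNr !scalerN addNr add0r addrN.
- have kill u v : act u (1%:Z - 1) (act v (-2) vac) = 0 by apply: act_kill2.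
  under eq_bigr => i _.
    rewrite !actNl !actNr !kill oppr0 !scaler0 !addr0.
    rewrite [act (c_ i) _ _]act_swap /= sub0r opprK -mulr2n -scaler_nat.
    over.
  by rewrite -scaler_sumr scalerA mulVf ?pnatr_eq0 // scale1r chargeE scaler_sumr.
- rewrite big1 ?scaler0 // => i _.
  rewrite !(fock_act_vac _ _ (isT : 0 <= - 2 + 2%:Z)) !act0r scaler0 !add0r.
  rewrite actNl !act_pair // [B (d_ i) _]B_sym scalerN.
  by rewrite addrN.
- rewrite big1 ?scaler0 // => i _.
  rewrite !(fock_act_vac _ _ (n := _ + n.+3%:Z)); try lia.
  by rewrite !act_kill2 ?act0r ?scaler0 ?addr0 //; lia.
Qed.

(** The Borcherds identity at [l = 0], where the right-hand side has a single
    term. *)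
Lemma even_commutator u v (m n : int) w : level 2 u ->
  Y u m (Y v n w) - Y v n (Y u m w) =
  fsum (fun j => bin m j *: Y (Y u j%:Z v) (m + n - j%:Z) w).
Proof.
move=> u2; move: v; apply: fock_ind_levels => [|b v vb].
  apply: subspace_eq.
    apply: linear_sub; first exact: (linear_comp (Y_linr _ _) (Y_linl _ _)).
    exact: Y_linl.
  apply: linear_fsum => [j|v].
    exact/linear_scale/(linear_comp (Y_linl _ _) (Y_linr _ _)).
  have [N' vN] := evz_Y u v 0; exists N' => j /vN; rewrite add0r => ->.
  by rewrite Y0l scaler0.
have := borcherds_levels u2 vb 0 m n w.
have -> : (-1) ^+ (2 * b) = 1 :> C by rewrite exprM sqrrN expr1n expr1n.
rewrite /lhs /rhs [fsum (rhs_term _ _ _ _ _ _ _)](@fsum_single _ _ 0%N); last first.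
  by move=> [|j] // _; rewrite /rhs_term binz_small // mulr0 scale0r.
rewrite /rhs_term binz0 expr0z !mulr1 !expr0 !scale1r !add0r.
have e1 (x : int) : x - 0%N%:Z = x by lia.
rewrite !e1 => <-.
by apply: eq_fsum => j; rewrite /lhs_term add0r.
Qed.

Lemma omega_commutator v (m n : int) w (K : nat) :
  (forall j : nat, (K <= j)%N -> Y omega j v = 0) ->
  Y omega m (Y v n w) - Y v n (Y omega m w) =
  \sum_(j < K) bin m j *: Y (Y omega j%:Z v) (m + n - j%:Z) w.
Proof.
move=> vK; rewrite even_commutator; last exact: omega_level.
by apply: fsumE => j /vK ->; rewrite Y0l scaler0.
Qed.

Lemma virasoro_relations (m n : int) v :
  vir Y omega m (vir Y omega n v) - vir Y omega n (vir Y omega m v) =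
  (m - n)%:~R *: vir Y omega (m + n) v +
  (if m + n == 0 then ((m ^+ 3 - m)%:~R / 12%:R * N%:R) *: v else 0).
Proof.
rewrite /vir (@omega_commutator _ _ _ _ 4) => [|[|[|[|[|j]]]] // _]; last first.
  exact: omega_omega.
rewrite 4!big_ord_recr big_ord0 /= add0r.
rewrite !omega_omega Y0l scaler0 addr0 binz0 scale1r binz1 Y_translate_state !YZl.
rewrite Y_vac.
have -> : m + 1 + (n + 1) - 0%N%:Z - 1 = m + n + 1 by lia.
have -> : m + 1 + (n + 1) - 1%N%:Z = m + n + 1 by lia.
have -> : (m + 1 + (n + 1) - 3%:Z == -1) = (m + n == 0) by lia.
rewrite scalerA -scalerDl; congr (_ *: _ + _).
  by rewrite !(rmorphD, rmorphN) /=; ring.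
case: eqP => _; last by rewrite !scaler0.
rewrite scalerA; congr (_ *: _).
have b3 : 3%:R * bin (m + 1) 3 = (m + 1 - 2)%:~R * bin (m + 1) 2 by rewrite binz_absorb.
have b2 : 2%:R * bin (m + 1) 2 = (m + 1 - 1)%:~R * (m + 1)%:~R.
  by rewrite binz_absorb binz1.
have b6 : bin (m + 1) 3 = (m + 1 - 2)%:~R * ((m + 1 - 1)%:~R * (m + 1)%:~R) / 6%:R.
  by rewrite -b2; apply: (mulfI (_ : 3%:R != 0 :> C)); rewrite ?pnatr_eq0 // b3; field.
by rewrite b6 !(rmorphD, rmorphN, rmorphXn) /=; field.
Qed.

Lemma omega_derivative u v (n : int) :
  vir Y omega (-1) (Y u n v) - Y u n (vir Y omega (-1) v) = (- n%:~R) *: Y u (n - 1) v.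
Proof. by rewrite /vir !omega0E T_Y addrC addKr scaleNr. Qed.

(** ** Conformal weights *)

(** Twice the conformal weight of a monomial. *)
Definition dwt (s : seq (U * nat)) : nat := \sum_(x <- s) x.2.*2.+1.

Definition gens : seq U := [seq c_ i | i <- enum 'I_N] ++ [seq d_ i | i <- enum 'I_N].

Definition in_gens (s : seq (U * nat)) : bool := all (fun x => x.1 \in gens) s.

(** The space of weight [k / 2], given by spanning monomials; that it is the whole
    eigenspace of [omega_(1)] is [eigen_piece]. *)
Definition piece (k : nat) : set V :=
  lspan [set v | exists2 s, in_gens s && (dwt s == k) & v = mono s].

Lemma piece_subspace k : is_subspace (piece k).
Proof. exact: lspan_subspace. Qed.

Lemma piece_min k (Q : V -> Prop) : is_subspace Q ->
  (forall s, in_gens s -> dwt s = k -> Q (mono s)) -> forall x, piece k x -> Q x.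
Proof.
by move=> Qs Qm; apply: (lspan_min Qs) => _ [s /andP[sg /eqP sk] ->]; apply: Qm.
Qed.

Lemma omega_mono s : Y omega 1 (mono s) = ((dwt s)%:R / 2%:R) *: mono s.
Proof.
elim: s => [|[u m] s IH].
  by rewrite /dwt big_nil mul0r scale0r Y_creation.
rewrite monoE omega_act IH actZr.
have -> : - m%:Z - 1 + 1 - 1 = - m%:Z - 1 by lia.
rewrite -scalerBl /dwt big_cons -/(dwt s); congr (_ *: _).
rewrite natrD /= -[m.*2.+1]addn1 natrD -mul2n natrM !(rmorphD, rmorphN) /=.
by field.
Qed.

Lemma piece_eigen k x : piece k x -> Y omega 1 x = (k%:R / 2%:R) *: x.
Proof.
move: x; apply: piece_min => [|s _ <-]; last exact: omega_mono.
apply: subspace_eq; [exact: Y_linr | exact/linear_scale/linear_id].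
Qed.

(** Eigenvectors for distinct eigenvalues are independent: applying [L - lam n]
    shortens a relation by its last term. *)
Lemma eigen_indep (L : V -> V) (lam : nat -> C) (y : nat -> V) :
  linear L -> injective lam -> evz y -> (forall k, L (y k) = lam k *: y k) ->
  fsum y = 0 -> forall k, y k = 0.
Proof.
move=> Ll laminj [n yn] Ly; rewrite (fsumE yn) => sy k.
case: (ltnP k n) => [kn|]; last exact: yn.
move: k kn; elim: n y {yn} Ly sy => // n IH y Ly; rewrite big_ord_recr /= => sy.
pose z k := (lam k - lam n) *: y k.
have Lz k : L (z k) = lam k *: z k by rewrite (linZ Ll) Ly !scalerA mulrC.
have sz : \sum_(k < n) z k = 0.
  have : L (\sum_(k < n) y k + y n) - lam n *: (\sum_(k < n) y k + y n) = 0.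
    by rewrite sy (lin0 Ll) scaler0 subr0.
  rewrite (linD Ll) (lin_sum Ll) scalerDr Ly opprD addrACA subrr addr0 scaler_sumr -sumrB => sy0.
  by rewrite -[RHS]sy0; apply: eq_bigr => j _; rewrite /z Ly scalerBl.
have yk k : (k < n)%N -> y k = 0.
  move=> kn; have /eqP := IH z Lz sz k kn.
  rewrite scaler_eq0 subr_eq0 => /orP[/eqP/laminj kn'|/eqP //].
  by rewrite kn' ltnn in kn.
move=> k; rewrite ltnS leq_eqVlt => /predU1P[->|]; last exact: yk.
by rewrite -[RHS]sy big1 ?add0r // => j _; apply: yk.
Qed.

Lemma eigen_sum (L : V -> V) (lam : nat -> C) (y : nat -> V) x :
  linear L -> injective lam -> evz y -> (forall k, L (y k) = lam k *: y k) ->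
  L (fsum y) = x *: fsum y -> forall k, (lam k - x) *: y k = 0.
Proof.
move=> Ll laminj yz Ly Lx; apply: (eigen_indep Ll laminj).
- exact: evzZ.
- by move=> k; rewrite (linZ Ll) Ly !scalerA mulrC.
- have : L (fsum y) - x *: fsum y = 0 by rewrite Lx subrr.
  rewrite (lin_fsum Ll) // -fsumZ // -fsumB; last 2 first.
  + exact: (evz_lin Ll yz).
  + exact: (evzZ (fun=> x)).
  by move=> <-; apply: eq_fsum => k; rewrite Ly scalerBl.
Qed.

Lemma gens_span v : lspan [set v | exists2 s, in_gens s & v = mono s] v.
Proof.
move: v; apply: creation_ind => [||u m x].
- exact: lspan_subspace.
- by apply: lspan_gen; exists [::].
set X := [set _ | _]; have Xs := lspan_subspace X.
move=> xX; rewrite act_span; apply: subspace_sum => // i.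
have gen g : g \in gens -> lspan X (act g (- m%:Z - 1) x).
  move=> gg; move: x xX; apply: (lspan_min (Q := fun x => lspan X (act g _ x))).
    split; first by rewrite act0r; case: Xs.
    by move=> a y z Xy Xz; rewrite fock_act_linear; case: Xs => _; apply.
  move=> _ [s sg ->]; apply: lspan_gen; exists ((g, m) :: s) => //.
  by rewrite /in_gens /= gg.
by apply: subspaceD => //; apply: subspaceZ => //; apply: gen;
  rewrite mem_cat map_f ?mem_enum ?orbT.
Qed.

Definition sums_of (Q : nat -> set V) : set V :=
  [set v | exists y, [/\ evz y, forall k, Q k (y k) & v = fsum y]].

Lemma sums_of_subspace Q :
  (forall k, is_subspace (Q k)) -> is_subspace (sums_of Q).
Proof.
move=> Qs; split.
  exists (fun=> 0); split; [exact: evz0 | by move=> k; apply: subspace0 |].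
  by rewrite fsum_eq0.
move=> a v w [y [yz yp ->]] [z [zz zp ->]]; exists (fun k => a *: y k + z k).
have ayz : evz (fun k => a *: y k) by exact: (evzZ (fun=> a)).
split; [exact: evzD | | by rewrite fsumD ?fsumZ].
by move=> k; have [_ Ql] := Qs k; apply: Ql.
Qed.

Lemma sums_of_gen Q k v : (forall k, is_subspace (Q k)) -> Q k v -> sums_of Q v.
Proof.
move=> Qs Qv; exists (fun j => if j == k then v else 0); split.
- by exists k.+1 => j kj; rewrite gtn_eqF.
- by move=> j; case: eqP => [->|_] //; apply: subspace0.
- by rewrite (@fsum_single _ _ k) ?eqxx // => j /negbTE ->.
Qed.

Lemma weight_decomposition v : sums_of piece v.
Proof.
move: v (gens_span v); apply: (lspan_min (sums_of_subspace piece_subspace)).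
move=> _ [s sg ->]; apply: (sums_of_gen (k := dwt s)); first exact: piece_subspace.
by apply: lspan_gen; exists s; rewrite ?sg ?eqxx.
Qed.

Lemma half_inj : injective (fun k : nat => k%:R / 2%:R : C).
Proof.
move=> j k e; apply/eqP; rewrite -(eqr_nat C); apply/eqP.
by apply: (mulIf _ e); rewrite invr_eq0 pnatr_eq0.
Qed.

Lemma eigen_piece x v : v <> 0 -> Y omega 1 v = x *: v ->
  exists2 k : nat, x = k%:R / 2%:R & piece k v.
Proof.
move=> v0 xv; have [y [yz yp vy]] := weight_decomposition v.
have z0 : forall k, (k%:R / 2%:R - x) *: y k = 0.
  apply: (eigen_sum (Y_linr omega 1) half_inj yz) => [k|]; last by rewrite -vy.
  exact: piece_eigen.
have [k yk] : exists k, y k <> 0.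
  apply/not_existsP => y0; apply: v0; rewrite vy; apply: fsum_eq0 => k.
  exact: contrapT (y0 k).
have xk : x = k%:R / 2%:R.
  have /eqP := z0 k; rewrite scaler_eq0 subr_eq0 => /orP[/eqP //|/eqP //].
exists k => //; suff -> : v = y k by [].
rewrite vy; apply: fsum_single => j jk; have /eqP := z0 j.
rewrite scaler_eq0 subr_eq0 xk => /orP[/eqP/half_inj jk'|/eqP //].
by rewrite jk' eqxx in jk.
Qed.

Lemma piece0 x : piece 0 x -> exists a, x = a *: vac.
Proof.
move: x; apply: piece_min.
  split; first by exists 0; rewrite scale0r.
  by move=> a v w [b ->] [c ->]; exists (a * b + c); rewrite scalerDl scalerA.
move=> [|x s] _; first by exists 1; rewrite scale1r.
by rewrite /dwt big_cons.
Qed.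

Lemma piece1 x : piece 1 x -> exists u, x = act u (-1) vac.
Proof.
move: x; apply: piece_min.
  split; first by exists 0; rewrite act0l.
  by move=> a v w [b ->] [c ->]; exists (a *: b + c); rewrite fock_act_linearl.
move=> [|[u [|m]] s] _; rewrite /dwt ?big_nil // big_cons /= ?doubleS //.
by case: s => [_|y s]; [exists u | rewrite big_cons].
Qed.

(** By the iterate formula [omega_(1)] has an annihilation mode on the right of
    each of its terms, so such a vector has weight 0. *)
Lemma annihilated_vac x : (forall u (n : nat), act u n x = 0) ->
  exists a, x = a *: vac.
Proof.
move=> xk; have w0 : Y omega 1 x = 0.
  have q u v : Y (act u (-1) (act v (-2) vac)) 1 x = 0.
    rewrite act_iterate //; apply: fsum_eq0 => j.
    rewrite xk Y0r scaler0 subr0 generator_T Y_translate_state Y_generator.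
    by rewrite -addrA addrC addrNK xk scaler0 act0r scaler0.
  rewrite omegaE YZl (lin_sum (Y_linl _ _)) big1 ?scaler0 // => i _.
  by rewrite YDl !q addr0.
have [->|/eqP x0] := eqVneq x 0; first by exists 0; rewrite scale0r.
have [k k0 xp] : exists2 k : nat, 0 = k%:R / 2%:R :> C & piece k x.
  by apply: eigen_piece => //; rewrite scale0r.
apply: piece0; move/eqP: k0; rewrite eq_sym mulf_eq0 invr_eq0 !pnatr_eq0 orbF.
by move=> /eqP <-.
Qed.

(** By [T_act] the mode [n >= 0] of [u] on a vector killed by [T] is a multiple of
    [T] applied to the mode [n + 1]; all large modes vanish, hence all of them. *)
Lemma T_kernel x : T x = 0 -> exists a, x = a *: vac.
Proof.
move=> Tx; apply: annihilated_vac => u; have [M xM] := act_truncation x.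
suff down k n : (M <= n + k)%N -> act u n%:Z x = 0 by move=> n; apply: (down M); rewrite leq_addl.
elim: k n => [|k IH] n; first by rewrite addn0 => nM; apply: xM.
rewrite addnS -addSn => /IH un.
have := T_act u n.+1%:Z x; rewrite un (lin0 T_linear) Tx act0r sub0r => /esym/eqP.
rewrite oppr_eq0 scaler_eq0 intr_eq0 /= => /eqP.
by have -> : n.+1%:Z - 1 = n by lia.
Qed.

(** * The vertex operator superalgebra *)

Fixpoint words (T : Type) (A : seq T) (n : nat) : seq (seq T) :=
  if n is n'.+1 then [seq x :: s | x <- A, s <- words A n'] else [:: [::]].

Lemma mem_words (T : eqType) (A s : seq T) :
  {subset s <= A} -> s \in words A (size s).
Proof.
elim: s => [|x s IH] sA //=; apply/allpairsP; exists (x, s); split=> //=.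
  by apply: sA; rewrite mem_head.
by apply: IH => y ys; apply: sA; rewrite in_cons ys orbT.
Qed.

Definition monomials_of_weight (k : nat) : seq V :=
  let A := [seq (u, m) | u <- gens, m <- iota 0 k] in
  [seq mono s | s <- flatten [seq words A n | n <- iota 0 k.+1]].

Lemma piece_finite k x : piece k x -> lspan [set w | w \in monomials_of_weight k] x.
Proof.
move: x; apply: piece_min => [|s sg sk]; first exact: lspan_subspace.
apply: lspan_gen => /=; apply: map_f; apply/flattenP.
have dwt_mem (t : seq (U * nat)) y : y \in t -> (y.2.*2.+1 <= dwt t)%N.
  by move=> yt; rewrite /dwt (big_rem y) //= leq_addr.
have dwt_size (t : seq (U * nat)) : (size t <= dwt t)%N.
  by elim: t => // y t IH; rewrite /dwt big_cons /= -/(dwt t); lia.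
exists (words [seq (u, m) | u <- gens, m <- iota 0 k] (size s)).
  by apply: map_f; rewrite mem_iota add0n ltnS -sk dwt_size.
apply: mem_words => -[u m] us; apply/allpairsP; exists (u, m); split=> //=.
  by have /allP/(_ _ us) := sg.
by rewrite mem_iota /= add0n -sk; have := dwt_mem s _ us; rewrite /=; lia.
Qed.

Lemma fock_VOA : is_VOA (@fock_gr R U B) Y vac omega N%:R.
Proof.
split.
- exact: fock_vertex_algebra.
- exact: (level_gr omega_level).
- exact: virasoro_relations.
- exact: omega_derivative.
- move=> v; move: v (monomials_span v); apply: monomials_min.
    exact: lspan_subspace.
  move=> s; apply: lspan_gen; exists ((dwt s)%:R / 2%:R).
  exact: omega_mono.
- exists 0 => x v v0 /(eigen_piece v0)[k -> _].
  exists (k%:R / 2%:R); first by rewrite divr_ge0.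
  by rewrite fmorph_div /= !ratr_nat.
- move=> x; case: (pselect (exists k : nat, x = k%:R / 2%:R)) => [[k xk]|xk].
    exists (monomials_of_weight k) => v xv.
    have [->|/eqP v0] := eqVneq v 0.
      exact: (subspace0 (lspan_subspace _)).
    have [j jx jv] := eigen_piece v0 xv.
    by apply: piece_finite; rewrite -(half_inj (etrans (esym jx) xk)).
  exists [::] => v xv; have [->|/eqP v0] := eqVneq v 0.
    exact: (subspace0 (lspan_subspace _)).
  by have [j jx _] := eigen_piece v0 xv; case: xk; exists j.
Qed.

(** ** The vertex Lie algebra generated by the two vectors *)

Local Notation Omega := [set omega; charge].

(** Closing the two vectors under translation, together with the vacuum,
    already gives a space closed under all the products. *)
Inductive translates : V -> Prop :=
| translates_omega : translates omega
| translates_charge : translates charge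
| translates_vac : translates vac
| translates0 : translates 0
| translates_lin a x y : translates x -> translates y -> translates (a *: x + y)
| translates_T x : translates x -> translates (T x).

Lemma translatesZ a x : translates x -> translates (a *: x).
Proof.
by move=> tx; rewrite -[_ *: x]addr0; apply: translates_lin tx translates0.
Qed.

Lemma translates_products x y (n : nat) :
  translates x -> translates y -> translates (Y x n y).
Proof.
have base g : (forall h (m : nat), h = omega \/ h = charge -> translates (Y g m h)) ->
    forall z, translates z -> forall m : nat, translates (Y g m z).
  move=> gh z; elim=> {z} [m|m|m|m|a z z' _ IH _ IH' m|z _ IH m].
  - by apply: gh; left.
  - by apply: gh; right.
  - by rewrite Y_creation //; apply: translates0.
  - by rewrite Y0r; apply: translates0.
  - by rewrite Y_linr; apply: translates_lin.
  - have -> : Y g m (T z) = m%:~R *: Y g (m%:Z - 1) z + T (Y g m z).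
      by rewrite T_Y addrCA subrr addr0.
    case: m => [|m].
      by rewrite scale0r add0r; apply/translates_T/IH.
    have -> : m.+1%:Z - 1 = m by lia.
    by apply: translates_lin; [apply: IH | apply/translates_T/IH].
move=> tx ty; elim: tx n => {x} [n|n|n|n|a x x' _ IH _ IH' n|x _ IH n].
- apply: base ty n => h m [->|->].
    rewrite omega_omega; case: m => [|[|[|[|m]]]]; try exact: translates0.
    + exact/translates_T/translates_omega.
    + exact/translatesZ/translates_omega.
    + exact/translatesZ/translates_vac.
  rewrite omega_charge; case: m => [|[|m]]; try exact: translates0.
    exact/translates_T/translates_charge.
  exact: translates_charge.
- apply: base ty n => h m [->|->].
    rewrite charge_omega; case: m => [|[|m]]; try exact: translates0.
    exact: translates_charge.
  rewrite charge_charge; case: m => [|[|m]]; try exact: translates0.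
  exact/translatesZ/translates_vac.
- by rewrite Y_vac (_ : (n%:Z == -1) = false) //; apply: translates0.
- by rewrite Y0l; apply: translates0.
- by rewrite Y_linl; apply: translates_lin.
- rewrite Y_translate_state; case: n => [|n].
    by rewrite oppr0 scale0r; apply: translates0.
  have -> : n.+1%:Z - 1 = n by lia.
  exact/translatesZ/IH.
Qed.

Lemma vertex_lie_translates x : vertex_lie Y vac Omega x -> translates x.
Proof.
elim=> {x} [x [->|->]||||x y [n|n] // _ _ xt _ yt].
- exact: translates_omega.
- exact: translates_charge.
- exact: translates0.
- by move=> a x y _ ? _ ?; apply: translates_lin.
- by move=> x _; apply: translates_T.
- exact: translates_products.
Qed.

(** [T x] has mode 0 equal to zero and mode 1 equal to minus the mode 0 of [x], so
    the first two modes stay within the span of those of [omega] and [charge]. *)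
Lemma translates_modes x : translates x -> exists a b a1 b1 : C,
  (forall w, Y x 0 w = a *: T w + b *: Y charge 0 w) /\
  (forall w, Y x 1 w = a *: Y omega 1 w + b *: Y charge 1 w
                       - (a1 *: T w + b1 *: Y charge 0 w)).
Proof.
elim=> {x} [|||| a x y _ [p [q [p1 [q1 [x0 x1]]]]] _ [r [s [r1 [s1 [y0 y1]]]]]
            | x _ [p [q [p1 [q1 [x0 x1]]]]]].
- exists 1, 0, 0, 0; split=> w; rewrite ?omega0E !scale1r !scale0r ?addr0 ?subr0 //.
- exists 0, 1, 0, 0; split=> w; rewrite !scale1r !scale0r ?add0r ?addr0 ?subr0 //.
- exists 0, 0, 0, 0; split=> w; by rewrite Y_vac !scale0r !addr0 ?subr0.
- exists 0, 0, 0, 0; split=> w; by rewrite Y0l !scale0r !addr0 ?subr0.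
- exists (a * p + r), (a * q + s), (a * p1 + r1), (a * q1 + s1); split=> w.
    by rewrite Y_linl x0 y0 !scalerDl scalerDr !scalerA addrACA.
  rewrite Y_linl x1 y1 !scalerDl scalerBr !scalerDr !scalerA.
  by rewrite addrACA -opprD; congr (_ - _); rewrite addrACA.
- exists 0, 0, p, q; split=> w; rewrite Y_translate_state.
    by rewrite oppr0 !scale0r addr0.
  by rewrite subrr x0 !scale0r addr0 sub0r scaleN1r.
Qed.

Lemma omega1_T x : Y omega 1 (T x) = T (Y omega 1 x) + T x.
Proof. by rewrite T_Y subrr omega0E scale1r subrK. Qed.

Lemma charge0_T x : Y charge 0 (T x) = T (Y charge 0 x).
Proof. by rewrite T_Y scale0r subr0. Qed.

(** Since [T] raises the weight by one and kills the vacuum, the parts of weight 1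
    and 2 contain nothing but multiples of [charge] and combinations of [omega] and
    [T charge]. *)
Definition component (k : nat) : set V := [set x | [/\ Y omega 1 x = k%:R *: x,
  Y charge 0 x = 0 & match k with
    | 0 => exists a, x = a *: vac
    | 1 => exists a, x = a *: charge
    | 2 => exists a b, x = a *: omega + b *: T charge
    | _ => True
    end]].

Lemma component_subspace k : is_subspace (component k).
Proof.
split.
  split; rewrite ?Y0r ?scaler0 //.
  by case: k => [|[|[|k]]] //; [exists 0 | exists 0 | exists 0, 0];
    rewrite !scale0r ?addr0.
move=> a x y [x1 x0 xk] [y1 y0 yk]; split.
- by rewrite Y_linr x1 y1 scalerDr !scalerA mulrC.
- by rewrite Y_linr x0 y0 scaler0 addr0.
case: k xk yk {x1 y1} => [|[|[|k]]] //.
- by move=> [p ->] [q ->]; exists (a * p + q); rewrite scalerDl scalerA.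
- by move=> [p ->] [q ->]; exists (a * p + q); rewrite scalerDl scalerA.
- move=> [p [r ->]] [q [t ->]]; exists (a * p + q), (a * r + t).
  by rewrite !scalerDl scalerDr !scalerA addrACA.
Qed.

Lemma component_T k x : component k x -> component k.+1 (T x).
Proof.
move=> [x1 x0 xk]; split.
- rewrite omega1_T x1 (linZ T_linear) -[X in _ + X]scale1r -scalerDl.
  by rewrite -[k.+1]addn1 natrD.
- by rewrite charge0_T x0 (lin0 T_linear).
case: k xk {x1} => [|[|k]] // [a ->]; rewrite (linZ T_linear).
  by exists 0; rewrite T_vac scaler0 scale0r.
by exists 0, a; rewrite scale0r add0r.
Qed.

Lemma translates_graded x : translates x -> sums_of component x.
Proof.
have gen := sums_of_gen component_subspace; have sub := sums_of_subspace component_subspace.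
elim=> {x} [|||| a x y _ xs _ ys| x _ [y [[M yM] yc ->]]].
- apply: (gen 2%N); split; [exact: (omega_omega 1) | exact: (charge_omega 0) |].
  by exists 1, 0; rewrite scale1r scale0r addr0.
- apply: (gen 1%N); split; [by rewrite scale1r (omega_charge 1) | exact: (charge_charge 0) |].
  by exists 1; rewrite scale1r.
- apply: (gen 0%N); split; rewrite ?Y_creation ?scale0r //.
  by exists 1; rewrite scale1r.
- exact: subspace0.
- by case: sub => _; apply.
- have Tz : evz (fun k => if k is k'.+1 then T (y k') else 0).
    by exists M.+1 => -[|k] // /yM ->; rewrite (lin0 T_linear).
  exists (fun k => if k is k'.+1 then T (y k') else 0); split=> //.
    by case=> [|k]; [exact: (subspace0 (component_subspace 0)) | exact/component_T/yc].
  rewrite [RHS]fsum_recl // add0r (lin_fsum T_linear) //; by exists M.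
Qed.

Lemma lie_omega : vertex_lie Y vac Omega omega.
Proof. by apply: VL_gen; left. Qed.

Lemma lie_charge : vertex_lie Y vac Omega charge.
Proof. by apply: VL_gen; right. Qed.

Lemma graded_eigen (y : nat -> V) (x : V) (k : nat) : evz y -> x = fsum y ->
  (forall j, Y omega 1 (y j) = j%:R *: y j) -> Y omega 1 x = k%:R *: x -> x = y k.
Proof.
move=> yz xy y1 xk; have z0 : forall j, (j%:R - k%:R) *: y j = 0.
  apply: (eigen_sum (Y_linr omega 1) _ yz y1); last by rewrite -xy.
  by move=> i j /eqP; rewrite eqr_nat => /eqP.
rewrite xy; apply: fsum_single => j jk; have /eqP := z0 j.
by rewrite scaler_eq0 subr_eq0 eqr_nat (negbTE jk) => /eqP.
Qed.

Lemma translates_weight1 u : translates u -> Y omega 1 u = u ->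
  exists a, u = a *: charge.
Proof.
move=> /translates_graded[y [yz yc uy]] u1; have [_ _ [a ya]] := yc 1%N.
exists a; rewrite -ya; apply: graded_eigen yz uy _ _; last by rewrite scale1r.
by move=> k; case: (yc k).
Qed.

Lemma omega_conformal : is_conformal (@fock_gr R U B) Y vac Omega omega.
Proof.
split; first exact: lie_omega.
  by exists N%:R; apply: fock_VOA.
move=> u /vertex_lie_translates ut u1 [n|n] // n2.
have [a ->] := translates_weight1 ut u1.
by rewrite YZr omega_charge; case: n n2 => [|[|n]] //; rewrite scaler0.
Qed.

Lemma T_generator_neq0 (i : 'I_N) : T (act (c_ i) (-1) vac) <> 0.
Proof.
rewrite -generator_T => /(congr1 (act (d_ i) 1)).
rewrite act0r act_pair // B_sym B_cd eqxx => /eqP.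
rewrite scaler_eq0 (negbTE vac_neq0) orbF mulf_eq0 oppr_eq0.
by rewrite mulf_eq0 invr_eq0 !pnatr_eq0.
Qed.

(** [T] moves a generating state to the mode [-2] while [charge_(0)] keeps it in the
    mode [-1], and pairing with the modes of [d_ i] tells them apart. The index [i]
    asserts that [N] is positive. *)
Lemma T_charge0_indep (i : 'I_N) a b :
  (forall w, T w = a *: T w + b *: Y charge 0 w) -> a = 1 /\ b = 0.
Proof.
move=> Tw; have := Tw (act (c_ i) (-1) vac).
have v0 : vac != 0 := vac_neq0.
rewrite -generator_T charge_act Y_creation // act0r add0r swap_sign_c.
have h : - 2%:R * B (d_ i) (c_ i) = -1.
  by rewrite B_sym B_cd eqxx -[true%:R]/(1 : C); field.
move=> e; split.
- have := congr1 (act (d_ i) 1) e; rewrite actDr !actZr act_pair // h.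
  rewrite act_kill2 // !scaler0 addr0 => /eqP; rewrite scalerA -subr_eq0 -scalerBl.
  rewrite scaler_eq0 (negbTE v0) orbF mulrN1 opprK addrC subr_eq0 => /eqP //.
- have := congr1 (act (d_ i) 0) e; rewrite actDr !actZr act_kill2 // act_pair // h.
  rewrite scaler0 add0r => /esym/eqP.
  rewrite !scaler_eq0 (negbTE v0) oppr_eq0 oner_eq0 !orbF.
  by rewrite (negbTE (i_neq0 R)) orbF => /eqP.
Qed.

(** The translation operator of a conformal vector [w] is [T], and its weight
    operator differs from that of [omega] by [a1 T + b1 charge_(0)], where
    [charge_(0)] kills [w]. Hence [w_(1) w = 2 w] relates consecutive homogeneous
    components of [w]; as [T] is injective in positive weight, a nonzero [a1] would
    make infinitely many of them nonzero. So [w = omega + t T charge], and the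
    second condition on [w], tested on [charge], forces [t = 0]. *)
Lemma conformal_unique (i : 'I_N) w :
  is_conformal (@fock_gr R U B) Y vac Omega w -> w = omega.
Proof.
move=> [/vertex_lie_translates wt [r wVOA] w_cond].
have w0 x : Y w 0 x = T x.
  have := voa_derivative wVOA x vac (-1); rewrite /vir addNr Y_creationN1.
  by rewrite Y_creation // Y0r subr0 opprK scale1r.
have w1w : Y w 1 w = 2%:R *: w.
  have := voa_virasoro wVOA 0 (-2) vac; rewrite /vir add0r.
  have -> : - 2 + 1 = -1 :> int by lia.
  rewrite Y_creationN1 Y_creation // Y0r subr0 => ->.
  by rewrite -[X in _ + X]/(0 : V) addr0 add0r opprK.
have [a [b [a1 [b1 [e0 e1]]]]] := translates_modes wt.
have [a_1 b_0] : a = 1 /\ b = 0.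
  by apply: (T_charge0_indep i) => x; rewrite -e0 w0.
have {}e1 x : Y w 1 x = Y omega 1 x - (a1 *: T x + b1 *: Y charge 0 x).
  by rewrite e1 a_1 b_0 scale1r scale0r addr0.
have [y [yz ycomp wy]] := translates_graded wt.
have y1 k : Y omega 1 (y k) = k%:R *: y k by case: (ycomp k).
have yc k : Y charge 0 (y k) = 0 by case: (ycomp k).
have [_ _ [s [t yst]]] := ycomp 2%N.
have wc : Y charge 0 w = 0 by rewrite wy Yfsumr // fsum_eq0.
pose z k := (k%:R - 2%:R) *: y k - a1 *: (if k is k'.+1 then T (y k') else 0).
have Tyz : evz (fun k => if k is k'.+1 then T (y k') else 0).
  by have [M yM] := yz; exists M.+1 => -[|k] // /yM ->; rewrite (lin0 T_linear).
have z0 : forall k, z k = 0.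
  apply: (eigen_indep (Y_linr omega 1) (lam := fun j => j%:R)).
  - by move=> j k /eqP; rewrite eqr_nat => /eqP.
  - by apply: evzB; [apply: evzZ | exact: (evzZ (fun=> a1))].
  - move=> k; rewrite /z YBr !YZr y1; case: k => [|k].
      by rewrite mulr0n Y0r !scale0r !scaler0 subr0.
    rewrite omega1_T y1 (linZ T_linear) -[X in _ *: (_ + X)]scale1r -scalerDl.
    rewrite scalerBr !scalerA -[1]/(1%:R) -natrD addn1.
    by rewrite mulrC [_ * a1]mulrC.
  - have : Y w 1 w - 2%:R *: w = 0 by rewrite w1w subrr.
    rewrite e1 wc scaler0 addr0 {1 2 3}wy Yfsumr // (lin_fsum T_linear) //.
    rewrite addrAC -[2%:R *: _]fsumZ // -fsumB; last 2 first.
    + exact: (evz_lin (Y_linr omega 1)).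
    + exact: (evzZ (fun=> 2%:R)).
    move=> <-; rewrite /z [LHS]fsumB; last 2 first.
    + exact: evzZ.
    + exact: (evzZ (fun=> a1)).
    congr (_ - _); first by apply: eq_fsum => k; rewrite y1 scalerBl.
    rewrite fsumZ // fsum_recl // add0r //.
have y00 : y 0%N = 0.
  have /eqP := z0 0%N; rewrite /z scaler0 subr0 sub0r scaleNr oppr_eq0 scaler_eq0.
  by rewrite pnatr_eq0 => /eqP.
have y10 : y 1%N = 0.
  have /eqP := z0 1%N; rewrite /z y00 (lin0 T_linear) scaler0 subr0 scaler_eq0.
  by rewrite subr_eq0 eqr_nat => /eqP.
have yS (k : nat) : (k.+1)%:R *: y k.+3 = a1 *: T (y k.+2).
  have /eqP := z0 k.+3; rewrite /z subr_eq0 => /eqP <-; congr (_ *: _).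
  by rewrite -addn2 natrD addrK.
have y2n : y 2%N <> 0.
  move=> y20; apply: (@T_generator_neq0 i).
  have yk k : y k = 0.
    case: k => [|[|k]] //; elim: k => // k IH; have /eqP := yS k.
    by rewrite IH (lin0 T_linear) scaler0 scaler_eq0 pnatr_eq0 => /eqP.
  by rewrite -w0 wy fsum_eq0 ?Y0l.
have a10 : a1 = 0.
  apply/eqP/negPn/negP => a1n; have [M yM] := yz.
  have yn k : y k.+2 <> 0.
    elim: k => // k IH y0; apply: IH; have /eqP := yS k.
    rewrite y0 scaler0 eq_sym scaler_eq0 (negbTE a1n) => /eqP/T_kernel[f yf].
    have := y1 k.+2; rewrite {1}yf YZr Y_creation // scaler0 => /esym/eqP.
    by rewrite scaler_eq0 pnatr_eq0 => /eqP.
  exact/(yn M)/yM/leqW/leqW.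
have w2 : w = s *: omega + t *: T charge.
  rewrite wy -yst; apply: fsum_single => -[|[|[|k]]] // _.
  have /eqP := yS k; rewrite a10 scale0r scaler_eq0 pnatr_eq0 => /eqP //.
have s1 : s = 1.
  have [] // := @T_charge0_indep i s 0.
  move=> x; rewrite scale0r addr0 -[LHS]w0 w2 YDl !YZl omega0E Y_translate_state.
  by rewrite oppr0 scale0r scaler0 addr0.
suff t0 : t = 0 by rewrite w2 s1 t0 scale1r scale0r addr0.
have c1 : Y w 1 charge = charge.
  rewrite w2 YDl !YZl (omega_charge 1) Y_translate_state (charge_charge 0).
  by rewrite !scaler0 s1 scale1r addr0.
have := w_cond _ lie_charge c1 2 erefl.
rewrite w2 YDl !YZl (omega_charge 2) Y_translate_state (charge_charge 1).
rewrite scaler0 add0r !scalerA => /eqP; rewrite scaler_eq0.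
rewrite (negbTE vac_neq0) orbF.
rewrite !mulf_eq0 !oppr_eq0 !(intr_eq0, pnatr_eq0) (negbTE (lt0n_neq0 (leq_ltn_trans (leq0n i) (ltn_ord i)))).
by rewrite /= !orbF => /eqP.
Qed.

Lemma charge_U1 : is_U1_vector Y vac Omega omega charge.
Proof.
split; first exact: lie_charge.
exists (fun v => N%:R *: v); split.
- split; first exact/linear_scale/linear_id.
  by move=> m v; rewrite /vir !YZr.
- by move=> m n v; rewrite virasoro_relations; case: ifP; rewrite ?scalerA.
- move=> m n v.
  have charge2 (j : nat) : (2 <= j)%N -> Y omega j charge = 0.
    by rewrite omega_charge; case: j => [|[|j]].
  rewrite /vir (omega_commutator _ _ _ charge2) big_ord_recr big_ord1 /= !omega_charge binz0 scale1r binz1.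
  rewrite Y_translate_state.
  have -> : m + 1 + n - 0%N%:Z - 1 = m + n by lia.
  have -> : m + 1 + n - 1%N%:Z = m + n by lia.
  by rewrite -scalerDl; congr (_ *: _); rewrite !(rmorphD, rmorphN) /=; ring.
- move=> m n v; rewrite even_commutator; last exact: charge_level.
  rewrite (@fsum_single _ _ 1%N) => [|j j1]; last first.
    by rewrite charge_charge; case: j j1 => [|[|j]] //; rewrite Y0l scaler0.
  rewrite charge_charge binz1 YZl Y_vac.
  have -> : (m + n - 1%N%:Z == -1) = (m + n == 0) by lia.
  by case: ifP => _; rewrite ?scaler0 // !scalerA mulrN mulNr.
Qed.

(** The commutator with [L(0)] puts [j] in weight 1, where it is a multiple of
    [charge]; the two relations involving the central element give it the same
    value [N] and so make the square of the factor equal to 1. *)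
Lemma U1_vector_unique (i : 'I_N) j : is_U1_vector Y vac Omega omega j ->
  j = charge \/ j = - charge.
Proof.
move=> [/vertex_lie_translates jt [K [[Kl _] LL LJ JJ]]].
have N0 : N%:R != 0 :> C.
  by rewrite pnatr_eq0 -lt0n (leq_ltn_trans (leq0n i)).
have Kvac : K vac = N%:R *: vac.
  have := LL 2 (-2) vac; rewrite virasoro_relations => /addrI LL2.
  have : (((2 : int) ^+ 3 - 2)%:~R / 12%:R * N%:R) *: vac =
      (((2 : int) ^+ 3 - 2)%:~R / 12%:R) *: K vac := LL2.
  rewrite -scalerA => /scalerI -> //.
  by rewrite mulf_neq0 ?invr_eq0 ?pnatr_eq0 // intr_eq0.
have [a ja] : exists a, j = a *: charge.
  apply: translates_weight1 jt _.
  have := LJ 0 (-1) vac; rewrite /vir add0r Y_creationN1 [Y omega 1 vac]Y_creation //.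
  by rewrite Y0r subr0 opprK scale1r.
have := JJ 1 (-1) vac; rewrite Y_creationN1 [Y j 1 vac]Y_creation // Y0r subr0.
rewrite subrr eqxx Kvac ja YZl YZr (charge_charge 1) !scalerA => /eqP.
rewrite -subr_eq0 -scalerBl scaler_eq0 (negbTE vac_neq0) orbF.
rewrite mulrN -mulNr -mulrBl mulf_eq0 (negbTE N0) orbF opprK addrC subr_eq0 eq_sym.
rewrite -expr2 sqrf_eq1 => /orP[/eqP ->|/eqP ->].
  by left; rewrite scale1r.
by right; rewrite scaleN1r.
Qed.

Lemma fock_U1_VOA (i : 'I_N) : is_U1_VOA (@fock_gr R U B) Y vac Omega.
Proof.
have pair : is_U1_pair (@fock_gr R U B) Y vac Omega omega charge.
  split; [exact: omega_conformal | exact: charge_U1 |].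
  by move=> j; apply: U1_vector_unique.
split; last by exists omega, charge.
split; last by exists omega, charge.
exists omega; split; first exact: omega_conformal.
by move=> w /(conformal_unique i) ->.
Qed.

Lemma fock_rank : has_rank (@fock_gr R U B) Y vac Omega N%:R.
Proof. by exists omega; [exact: omega_conformal | exact: fock_VOA]. Qed.

(** * Irreducible modules *)

Section VacuumVectors.
Variables (M : lmodType C) (A : U -> int -> M -> M) (P : M -> Prop).
Hypothesis A_linr : forall u n, linear (A u n).
Hypothesis A_linl : forall n w, linear (fun u => A u n w).
Hypothesis A_anti : forall u v (m n : nat) w,
  A u m (A v n w) = - A v n (A u m w).
Hypothesis A_trunc : forall u w, exists K : nat, forall n : nat, (K <= n)%N -> A u n w = 0.
Hypothesis P_A : forall u n w, P w -> P (A u n w).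

Lemma gens_annihilate w : (forall g, g \in gens -> forall n : nat, A g n w = 0) ->
  forall u (n : nat), A u n w = 0.
Proof.
move=> gw u n; rewrite [u]B_span (lin_sum (A_linl n w)) big1 // => i _.
rewrite (linD (A_linl n w)) !(linZ (A_linl n w)) !gw ?scaler0 ?addr0 //.
  by rewrite mem_cat map_f ?orbT // mem_enum.
by rewrite mem_cat map_f // mem_enum.
Qed.

Lemma annihilators_square u (n : nat) w : A u n (A u n w) = 0.
Proof.
apply/eqP; have /eqP := A_anti u u n n w; rewrite -addr_eq0 -mulr2n -scaler_nat.
by rewrite scaler_eq0 pnatr_eq0.
Qed.

(** Only finitely many of the anticommuting annihilation operators act
    nontrivially on a given vector; applying in turn each of those that does not
    kill it yields a nonzero vector killed by all of them. *)
Lemma vacuum_vector w : P w -> w <> 0 ->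
  exists w', [/\ P w', w' <> 0 & forall u (n : nat), A u n w' = 0].
Proof.
move=> Pw w0.
have [K gK] : exists K : nat, forall g, g \in gens -> forall n : nat, (K <= n)%N -> A g n w = 0.
  elim: gens => [|h s [K sK]]; first by exists 0%N.
  have [K' hK] := A_trunc h w; exists (maxn K K') => g.
  rewrite in_cons => gs n; rewrite geq_max => /andP[nK nK'].
  by case/orP: gs => [/eqP -> |gs]; [apply: hK | apply: sK].
suff kill (s : seq (U * nat)) : exists w', [/\ P w', w' <> 0,
    forall g, g \in gens -> forall n : nat, (K <= n)%N -> A g n w' = 0
    & forall x, x \in s -> A x.1 x.2 w' = 0].
  have [w' [Pw' w'0 gw' sw']] := kill [seq (g, n) | g <- gens, n <- iota 0 K].
  exists w'; split=> //; apply: gens_annihilate => g gg n.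
  case: (leqP K n) => [|nK]; first exact: gw'.
  apply: (sw' (g, n)); apply/allpairsP; exists (g, n); split=> //.
  by rewrite mem_iota.
elim: s => [|x s [w1 [Pw1 w10 gw1 sw1]]]; first by exists w.
case: (pselect (A x.1 x.2 w1 = 0)) => [xw|xw].
  by exists w1; split=> // y; rewrite in_cons => /predU1P[->|/sw1].
exists (A x.1 x.2 w1); split=> // [|g gg n nK|y].
- exact: P_A.
- by rewrite A_anti gw1 // (lin0 (A_linr _ _)) oppr0.
- rewrite in_cons => /predU1P[->|/sw1 ys]; first exact: annihilators_square.
  by rewrite A_anti ys (lin0 (A_linr _ _)) oppr0.
Qed.

End VacuumVectors.

Lemma act_anti u v (m n : nat) (w : V) : act u m (act v n w) = - act v n (act u m w).
Proof. by rewrite act_swap ifF ?sub0r //; lia. Qed.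

(** A nonzero submodule contains a vacuum vector, which is a multiple of [vac], and
    the vacuum generates everything. *)
Lemma fock_irreducible : is_irreducible (@fock_gr R U B) Y.
Proof.
split; first by exists vac; exact/eqP/vac_neq0.
move=> W [Ws _ WY]; case: (pselect (forall w, W w -> w = 0)) => [|nW]; first by left.
have [w [Ww w0]] : exists w, W w /\ w <> 0.
  apply: contrapT => nw; apply: nW => w Ww; apply: contrapT => w0.
  by apply: nw; exists w.
right; have [|||||w' [Ww' w'0 w'k]] := @vacuum_vector _ (fun u n x => act u n x) W _ _ _ _ _ w Ww w0.
- exact: act_linear.
- by move=> n x a u v; apply: fock_act_linearl.
- exact: act_anti.
- by move=> u x; have [K xK] := act_truncation x; exists K => n nK; apply: xK.
- by move=> u n x Wx; rewrite -Y_generator; apply: WY.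
have [a w'a] := annihilated_vac w'k.
have a0 : a != 0 by apply: contra_notN w'0 => /eqP a0; rewrite w'a a0 scale0r.
move=> x; rewrite -[x]Y_creationN1; apply: WY.
have -> : vac = a^-1 *: w' by rewrite w'a scalerA mulVf ?scale1r.
exact: subspaceZ.
Qed.

Section Modules.
Variables (M : lmodType C) (grM : bool -> set M) (YM : V -> int -> M -> M).
Hypothesis YM_mod : is_vertex_module (@fock_gr R U B) Y vac grM YM.

Local Notation gen u := (act u (-1) vac).

Lemma gen_gr u : fock_gr true (gen u).
Proof. exact: (level_gr (level_mono [:: (u, 0%N)])). Qed.

Lemma YM_linl n w : linear (fun v => YM v n w).
Proof. by case: YM_mod => _ Yl _ _ _ _ _; apply: Yl. Qed.

Lemma YM_linr v n : linear (YM v n).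
Proof. by case: YM_mod => _ _ Yl _ _ _ _; apply: Yl. Qed.

Lemma YM_gen_linl n w : linear (fun u => YM (gen u) n w).
Proof. by move=> a u v; rewrite fock_act_linearl (YM_linl n w). Qed.

Lemma YM_clifford u v (m n : int) w :
  YM (gen u) m (YM (gen v) n w) + YM (gen v) n (YM (gen u) m w) =
  if m + n + 1 == 0 then (- 2%:R * B u v) *: w else 0.
Proof.
case: YM_mod => _ _ _ _ _ YMvac /(_ _ _ _ _ w 0 m n (gen_gr u) (gen_gr v)).
rewrite -!/(fsum _) (@fsum_single _ _ 0%N) => [|j j0]; last first.
  rewrite Y_generator act_kill2 ?(lin0 (YM_linl _ _)) ?scaler0 //; lia.
rewrite (@fsum_single _ _ 0%N) => [|[|j] // _]; last first.
  by rewrite binz_small // mulr0 scale0r.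
rewrite !binz0 expr0z !mulr1 !expr0 !scale1r mul1r expr1 scaleN1r opprK !add0r.
rewrite Y_generator act_pair // (linZ (YM_linl _ _)) YMvac.
have e1 (x : int) : x - 0%N%:Z = x by lia.
rewrite !e1 => <-.
have -> : (m + n == -1) = (m + n + 1 == 0) by lia.
by case: ifP => _; rewrite ?scaler0.
Qed.

Lemma grading_unique a0 a1 b0 b1 : grM false a0 -> grM false b0 ->
  grM true a1 -> grM true b1 -> a0 + a1 = b0 + b1 -> a0 = b0 /\ a1 = b1.
Proof.
case: YM_mod => -[grs _ gr0] _ _ _ _ _ _ a0g b0g a1g b1g e.
have e' : a0 - b0 = b1 - a1.
  by apply/eqP; rewrite subr_eq addrAC eq_sym subr_eq addrC e addrC.
have z : a0 - b0 = 0.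
  apply: gr0; first by apply: subspaceB.
  by rewrite e'; apply: subspaceB.
split; first exact/subr0_eq.
by apply/esym/subr0_eq; rewrite -e'.
Qed.

(** The universal property of the Fock space gives a map to [M] from a vacuum
    vector of [M]; it is a morphism because both actions of [u_(l) v] are
    determined by those of [u] and [v]. *)
Lemma module_map w : (forall u (n : int), 0 <= n -> YM (gen u) n w = 0) ->
  exists f : V -> M, [/\ linear f, f vac = w,
    forall u n x, f (act u n x) = YM (gen u) n (f x)
    & forall v n x, f (Y v n x) = YM v n (f x)].
Proof.
move=> w0; have [|||||||f [fl fvac fA _]] :=
    @clifford_universal M (fun u n => YM (gen u) n) (fun=> True) w.
- by split.
- by [].
- by [].
- by move=> u n a x y _ _; apply: YM_linr.
- by move=> a u v n x _; apply: YM_gen_linl.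
- by move=> u v m n x _; apply: YM_clifford.
- exact: w0.
suff fYk : forall k v, level k v -> forall n x, f (Y v n x) = YM v n (f x).
  exists f; split=> // v n x; move: v; apply: fock_ind_levels => [|k v vk].
    apply: subspace_eq; first exact: (linear_comp fl (Y_linl _ _)).
    exact: YM_linl.
  exact: (fYk _ _ vk).
apply: level_ind => [k|n x|k u m y yk IH n x].
- do 2![apply: subspace_all => ?]; apply: subspace_eq.
    exact: (linear_comp fl (Y_linl _ _)).
  exact: YM_linl.
- case: YM_mod => _ _ _ _ _ YMvac _; rewrite Y_vac YMvac.
  by case: ifP => // _; rewrite (lin0 fl).
set l : int := - m%:Z - 1; have l0 : l < 0 by rewrite /l; lia.
clearbody l; case: YM_mod => _ _ _ _ _ _ /(_ _ _ _ _ (f x) l 0 n (gen_gr u) (level_gr yk)).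
rewrite -!/(fsum _) (@fsum_single _ _ 0%N) => [|[|j] // _]; last first.
  by rewrite binz_small // scale0r.
have e1 (z : int) : z - 0%N%:Z = z by lia.
rewrite binz0 scale1r add0r !e1 Y_generator => ->.
rewrite act_iterate // (lin_fsum fl); last first.
  have [K1 h1] := evz_Y y x n; have [K2 h2] := evz_act u x.
  exists (maxn K1 K2) => j; rewrite geq_max => /andP[/h1 -> /h2 ->].
  by rewrite act0r Y0r scaler0 subr0 scaler0.
apply: eq_fsum => j; rewrite (linZ fl) (linB fl) (linZ fl) fA IH add0r.
rewrite (level_parity yk) YZl (linZ fl) IH fA scalerA /=.
by rewrite signr_odd.
Qed.

(** The kernel and the image of the map given by a homogeneous vacuum vector are
    submodules. Its parity decides whether the isomorphism is even or odd. *)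
Lemma module_isomorphism : is_irreducible grM YM ->
  exists (p : bool) (f : V -> M),
    [/\ linear f, bijective f, forall q v, fock_gr q v -> grM (p (+) q) (f v)
      & forall u n v, f (Y u n v) = YM u n (f v)].
Proof.
have [[grs grD gr0] _ _ YMpar YMtr _ _] := YM_mod.
move=> [[x x0] irr].
have [y [[q yq] y0]] : exists y, (exists q, grM q y) /\ y <> 0.
  have [x1 [x2 [x1g x2g xE]]] := grD x.
  have [x10|/eqP x10] := eqVneq x1 0; last by exists x1; split=> //; exists false.
  exists x2; split; first by exists true.
  by move=> x20; apply: x0; rewrite xE x10 x20 addr0.
have [|||||w [[p wp] w0 wk]] := @vacuum_vector _ (fun u n => YM (gen u) n)
  (fun z => exists q, grM q z) _ _ _ _ _ y (ex_intro _ q yq) y0.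
- by move=> u n; apply: YM_linr.
- exact: YM_gen_linl.
- move=> u v m n z; apply/eqP; rewrite -addr_eq0 YM_clifford (_ : (m%:Z + n%:Z + 1 == 0) = false) //; lia.
- move=> u z; have [n0 un] := YMtr (gen u) z; exists `|n0|%N => n nn; apply: un; lia.
- by move=> u n z [r zr]; exists (true (+) r); apply: YMpar (gen_gr u) zr.
have [|f [fl fvac fA fY]] := @module_map w.
  by move=> u [n|n] // _; apply: wk.
have fgr r v : fock_gr r v -> grM (p (+) r) (f v).
  move=> /grP; move: v; apply: parity_levels => [|k v].
    split; first by rewrite (lin0 fl); case: (grs (p (+) r)).
    by move=> a z z' zr z'r; rewrite fl; case: (grs (p (+) r)) => _; apply.
  move=> vk <-; move: k v vk; apply: level_ind => [k||k u m v _ IH].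
  - split; first by rewrite (lin0 fl); case: (grs (p (+) odd k)).
    by move=> a z z' zr z'r; rewrite fl; case: (grs (p (+) odd k)) => _; apply.
  - by rewrite fvac addbF.
  - by rewrite fA /= -[~~ odd k]addTb addbCA; apply: YMpar (gen_gr u) IH.
have kernel v : f v = 0 -> v = 0.
  case: (fock_irreducible) => _ /(_ (fun v => f v = 0))[]; last 1 first.
  - by move=> all0; case: w0; rewrite -fvac.
  - split.
    + split; first exact: lin0 fl.
      by move=> a z z' fz fz'; rewrite fl fz fz' scaler0 addr0.
    + move=> v0 v1 v0g v1g; rewrite (linD fl).
      have := fgr _ _ v0g; have := fgr _ _ v1g.
      have z r : grM r 0 by case: (grs r).
      case: (p) => /= g1 g0 e.
        by have [] := grading_unique g1 (z false) g0 (z true); rewrite ?addr0 // addrC.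
      by have [] := grading_unique g0 (z false) g1 (z true); rewrite ?addr0.
    + by move=> z n v1 fv; rewrite fY fv (lin0 (YM_linr _ _)).
  - by move=> K0; apply: K0.
have surj z : exists v, f v = z.
  have sub : is_vertex_submodule grM YM (fun z => exists v, f v = z).
    split.
    + split; first by exists 0; rewrite (lin0 fl).
      by move=> a _ _ [v1 <-] [v2 <-]; exists (a *: v1 + v2); rewrite fl.
    + move=> z0 z1 z0g z1g [v fv].
      have [_ vD _] := fock_gr_grading; have [v0 [v1 [v0g v1g vE]]] := vD v.
      move: fv (fgr _ _ v0g) (fgr _ _ v1g); rewrite vE (linD fl).
      case: (p) => /= e g0 g1.
        have [] := grading_unique g1 z0g g0 z1g; first by rewrite addrC.
        by move=> <- <-; split; [exists v1 | exists v0].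
      have [] := grading_unique g0 z0g g1 z1g; first by [].
      by move=> <- <-; split; [exists v0 | exists v1].
    + by move=> v n _ [v' <-]; exists (Y v n v'); rewrite fY.
  have [all0|all_im] := irr _ sub; last exact: all_im.
  by case: w0; apply: all0; exists vac.
exists p, f; split=> //.
pose g z := projT1 (cid (surj z)).
have gK z : f (g z) = z by rewrite /g; case: cid.
exists g => // v; apply/subr0_eq/kernel.
by rewrite (linB fl) gK subrr.
Qed.

End Modules.

Lemma fock_self_dual : self_dual (@fock_gr R U B) Y vac.
Proof.
split; first exact: fock_irreducible.
by move=> M grM YM YM_mod; apply: module_isomorphism.
Qed.

(** * Automorphisms *)

(** The difference is a multiple of the vacuum, of weight 0. This identifies the
    images of [omega] and [charge] under an isometry without expanding them in
    another basis. *)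
Lemma annihilators_determine x y (k : nat) :
  (forall u (n : nat), act u n x = act u n y) ->
  Y omega 1 x = k.+1%:R *: x -> Y omega 1 y = k.+1%:R *: y -> x = y.
Proof.
move=> xy x1 y1; have [u n|a xya] := @annihilated_vac (x - y).
  by rewrite (linB (act_linear _ _)) xy subrr.
apply/subr0_eq; have := congr1 (Y omega 1) xya.
rewrite YBr x1 y1 -scalerBr YZr Y_creation // scaler0 => /eqP.
by rewrite scaler_eq0 pnatr_eq0 => /eqP.
Qed.

Lemma generator_inj u : act u (-1) vac = 0 -> u = 0.
Proof.
move=> gu; have Bu v : B v u = 0.
  have := congr1 (act v 0) gu; rewrite act0r act_pair // => /eqP.
  rewrite scaler_eq0 (negbTE vac_neq0) orbF mulf_eq0 oppr_eq0.
  by rewrite pnatr_eq0 => /eqP.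
by rewrite [u]B_span big1 // => i _; rewrite !(B_sym u) !Bu !mulr0 !scale0r addr0.
Qed.

Section Isometries.
Variables (h h' : U -> U).
Hypotheses (h_lin : linear h) (h_iso : forall u v, B (h u) (h v) = B u v).
Hypotheses (hK : cancel h h') (h'K : cancel h' h).
Hypothesis h_swap : forall u, h (swap_sign u) = swap_sign (h u).

Local Notation f := (@fock_map R U B h).

Let f_linear : linear f. Proof. exact: fock_map_linear. Qed.
Let f_act u n x : f (act u n x) = act (h u) n (f x).
Proof. exact: fock_map_act. Qed.
Let f_vac : f vac = vac. Proof. exact: fock_map_vac. Qed.

Lemma isometry_parity x : f (parity x) = parity (f x).
Proof.
move: x; apply: fock_gen_ind => [||u n x IH].
- apply: subspace_eq; [exact: (linear_comp f_linear parity_linear)|].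
  exact: (linear_comp parity_linear f_linear).
- by rewrite parity_vac f_vac parity_vac.
- by rewrite parity_act (linN f_linear) !f_act IH parity_act.
Qed.

Lemma isometry_Y u n v : f (Y u n v) = Y (f u) n (f v).
Proof.
move: u n v; apply: creation_ind => [|n v|u m x IH n v].
- do 2![apply: subspace_all => ?]; apply: subspace_eq.
    exact: (linear_comp f_linear (Y_linl _ _)).
  exact: (linear_comp (Y_linl _ _) f_linear).
- by rewrite f_vac !Y_vac; case: ifP => // _; rewrite (lin0 f_linear).
- rewrite f_act !act_iterate; try lia.
  rewrite (lin_fsum f_linear); last first.
    have [K1 h1] := evz_Y x v n; have [K2 h2] := evz_act u v.
    exists (maxn K1 K2) => j; rewrite geq_max => /andP[/h1 -> /h2 ->].
    by rewrite act0r Y0r scaler0 subr0 scaler0.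
  apply: eq_fsum => j; rewrite (linZ f_linear) (linB f_linear) (linZ f_linear).
  rewrite f_act IH; congr (_ *: (_ - _ *: _)).
  have IHp q z : f (Y (parity x) q z) = Y (parity (f x)) q (f z).
    by rewrite -{1}[z]parityK -Y_parity isometry_parity IH Y_parity isometry_parity parityK.
  by rewrite IHp f_act.
Qed.

Lemma omega1_quadratic u v (k : int) :
  Y omega 1 (act u (-1) (act v k vac)) = (- k%:~R) *: act u (-1) (act v k vac).
Proof.
rewrite (omega_quadratic u v 1) -[1%N%:Z]/(1 : int) addrK.
have -> : (1 - 2 : int) = -1 by lia.
by rewrite -scalerBl; congr (_ *: _); field.
Qed.

Lemma isometry_omega : f omega = omega.
Proof.
apply: (@annihilators_determine _ _ 1).
- move=> u n; rewrite -{1}[u]h'K -f_act !act_omega.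
  case: n => [|[|n]]; last exact: lin0 f_linear.
  + by rewrite (linZ f_linear) f_act h'K f_vac.
  + by rewrite (linZ f_linear) f_act h'K f_vac.
- rewrite [f omega](_ : _ = 2%:R^-1 *: \sum_i
    (act (h (c_ i)) (-1) (act (h (d_ i)) (-2) vac) +
     act (h (d_ i)) (-1) (act (h (c_ i)) (-2) vac))); last first.
    rewrite omegaE (linZ f_linear) (lin_sum f_linear); congr (_ *: _).
    by apply: eq_bigr => i _; rewrite (linD f_linear) !f_act f_vac.
  rewrite YZr Y_sum scalerA mulrC -scalerA; congr (_ *: _).
  rewrite scaler_sumr; apply: eq_bigr => i _.
  by rewrite YDr !omega1_quadratic -scalerDr; congr (_ *: _); rewrite rmorphN opprK.
- exact: (omega_omega 1).
Qed.

Lemma isometry_charge : f charge = charge.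
Proof.
apply: (@annihilators_determine _ _ 0).
- move=> u n; rewrite -{1}[u]h'K -f_act !act_charge.
  case: n => [|n]; last exact: lin0 f_linear.
  by rewrite (linN f_linear) (linZ f_linear) f_act h_swap h'K f_vac.
- rewrite [f charge](_ : _ = 'i *: \sum_i
     act (h (d_ i)) (-1) (act (h (c_ i)) (-1) vac)); last first.
    rewrite chargeE (linZ f_linear) (lin_sum f_linear); congr (_ *: _).
    by apply: eq_bigr => i _; rewrite !f_act f_vac.
  rewrite YZr Y_sum scale1r; congr (_ *: _); apply: eq_bigr => i _.
  by rewrite omega1_quadratic rmorphN opprK scale1r.
- by rewrite (omega_charge 1) scale1r.
Qed.

Lemma isometry_automorphism : is_automorphism (@fock_gr R U B) Y vac Omega f.
Proof.
have h'_lin : linear h' by move=> a u v; rewrite -[RHS]hK h_lin !h'K.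
have h'_iso u v : B (h' u) (h' v) = B u v by rewrite -h_iso !h'K.
pose f' := @fock_map R U B h'.
have f'l : linear f' by apply: fock_map_linear.
have fK : cancel f f'.
  apply: fock_gen_ind => [||u n x IH].
  - exact: (subspace_eq (linear_comp f'l f_linear) (linear_id (V := V))).
  - by rewrite f_vac /f' fock_map_vac.
  - by rewrite f_act /f' fock_map_act // hK -/f' IH.
have f'K : cancel f' f.
  apply: fock_gen_ind => [||u n x IH].
  - exact: (subspace_eq (linear_comp f_linear f'l) (linear_id (V := V))).
  - by rewrite /f' fock_map_vac // f_vac.
  - by rewrite /f' fock_map_act // f_act h'K -/f' IH.
split.
- by split; [exact: f_linear | exists f'].
- by move=> p v /grP pv; apply/grP; rewrite -isometry_parity pv (linZ f_linear).
- exact: f_vac.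
- exact: isometry_Y.
- by move=> x [->|->]; [exact: isometry_omega | exact: isometry_charge].
Qed.

End Isometries.

(** An automorphism preserves the space of conformal weight 1/2, which is a copy
    of [U]; it preserves the form because [v_(0) u] is a multiple of the vacuum,
    and commutes with [swap_sign] because it fixes the charge vector. *)
Lemma automorphism_isometry phi :
  is_automorphism (@fock_gr R U B) Y vac Omega phi ->
  exists h : U -> U, [/\ linear h, forall u v, B (h u) (h v) = B u v,
    forall u, h (swap_sign u) = swap_sign (h u) & phi = @fock_map R U B h].
Proof.
move=> [[phil _] _ phi_vac phiY phiO].
have phi_omega : phi omega = omega by apply: phiO; left.
have phi_charge : phi charge = charge by apply: phiO; right.
have gen1 u : exists v, phi (act u (-1) vac) = act v (-1) vac.
  have [->|/eqP pu0] := eqVneq (phi (act u (-1) vac)) 0; first by exists 0; rewrite act0l.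
  have [|k k1 pk] := @eigen_piece (1%:R / 2%:R) (phi (act u (-1) vac)) pu0.
    rewrite -phi_omega -phiY -(linZ phil); congr (phi _).
    by have := omega_mono [:: (u, 0%N)]; rewrite /dwt big_seq1.
  have k_1 : 1%N = k := half_inj k1.
  by move: pk; rewrite -k_1; apply: piece1.
pose h u := projT1 (cid (gen1 u)).
have hE u : phi (act u (-1) vac) = act (h u) (-1) vac by rewrite /h; case: cid.
have hinj u v : act u (-1) vac = act v (-1) vac -> u = v.
  move=> uv; apply/subr0_eq/generator_inj.
  by rewrite actDl actNl uv subrr.
have h_lin : linear h.
  move=> a u v; apply: hinj; rewrite -hE actDl actZl phil !hE.
  by rewrite actDl actZl.
have phi_act u n x : phi (act u n x) = act (h u) n (phi x).
  by rewrite -[act u n x]Y_generator phiY hE Y_generator.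
have h_iso u v : B (h u) (h v) = B u v.
  have := congr1 phi (@act_pair u v 0 (-1) isT erefl).
  rewrite phi_act hE (linZ phil) phi_vac act_pair // => /eqP.
  rewrite -subr_eq0 -scalerBl scaler_eq0 (negbTE vac_neq0) orbF.
  rewrite -mulrBr mulf_eq0 oppr_eq0 pnatr_eq0 /= subr_eq0 => /eqP //.
have h_swap u : h (swap_sign u) = swap_sign (h u).
  have e v : Y charge 0 (act v (-1) vac) = 'i *: act (swap_sign v) (-1) vac.
    by rewrite charge_act Y_creation // act0r add0r addr0.
  apply/hinj/(scalerI (i_neq0 R)).
  by rewrite -hE -(linZ phil) -e phiY phi_charge hE e.
exists h; split=> //; apply/funext; apply: fock_gen_ind => [||u n x IH].
- by apply: subspace_eq => //; apply: fock_map_linear.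
- by rewrite phi_vac fock_map_vac.
- by rewrite phi_act fock_map_act // IH.
Qed.

End FockSpace.

(** * The Clifford module of a polarised space *)

Section Polarisation.
Variables (R : realType) (a : vectType R[i]) (N : nat) (b : N.-tuple a).
Hypothesis b_basis : basis_of {: a} b.
Local Notation C := R[i].
Local Notation B := (@uform R a).
Local Notation V := (fock B).
Local Notation act := (@fock_act R _ B).
Local Notation vac := (fock_vac B).

Lemma uform_linl c (u v w : uspace a) : B (c *: u + v) w = c * B u w + B v w.
Proof.
case: u v w => [x f] [y g] [z k].
have sc (r s : C) : r *: (s : C^o) = r * s by [].
have kl : k (c *: x + y) = c * k x + k y by rewrite linearP.
by rewrite /uform /= add_lfunE scale_lfunE kl !sc; ring.
Qed.

Lemma uform_sym u v : B u v = B v u.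
Proof. by rewrite /uform addrC. Qed.

Lemma uform_ua i j : B (ua b i) (ua b j) = 0.
Proof. by rewrite /uform /= !lfunE /= addr0 mulr0. Qed.

Lemma uform_ua_dual i j : B (ua_dual b i) (ua_dual b j) = 0.
Proof. by rewrite /uform /= !linear0 addr0 mulr0. Qed.

Lemma coord_b i j : coord b j (tnth b i) = (j == i)%:R.
Proof.
by rewrite (tnth_nth 0) coord_free ?(basis_free b_basis) // eq_sym.
Qed.

Lemma uform_ua_ua_dual i j : B (ua b i) (ua_dual b j) = (i == j)%:R / 2%:R.
Proof.
by rewrite /uform /= !lfunE /= add0r coord_b eq_sym mulrC.
Qed.

Let half2 (s : C) : 2%:R * (2%:R^-1 * s) = s.
Proof. by rewrite mulrA mulfV ?mul1r ?pnatr_eq0. Qed.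

Let uform_coord x f i : 2%:R * B (x, f) (ua_dual b i) = coord b i x.
Proof. by rewrite /uform half2 /= linear0 lfunE /= add0r. Qed.

Let uform_value x f i : 2%:R * B (x, f) (ua b i) = f (tnth b i).
Proof. by rewrite /uform half2 /= lfunE /= addr0. Qed.

Let coord_sum x : x = \sum_i coord b i x *: tnth b i.
Proof.
rewrite {1}(coord_basis b_basis (memvf x)); apply: eq_bigr => i _.
by rewrite (tnth_nth 0).
Qed.

Let dual_sum (f : 'Hom(a, C^o)) :
  f = \sum_i (f (tnth b i) : C) *: linfun (coord b i : a -> C^o).
Proof.
apply/lfunP => x; rewrite sum_lfunE {1}[x]coord_sum linear_sum.
apply: eq_bigr => i _; rewrite scale_lfunE lfunE /= linearZ.
exact: mulrC.
Qed.

Let fst_sum (F : 'I_N -> uspace a) : (\sum_i F i).1 = \sum_i (F i).1.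
Proof. exact: (big_morph fst). Qed.

Let snd_sum (F : 'I_N -> uspace a) : (\sum_i F i).2 = \sum_i (F i).2.
Proof. exact: (big_morph snd). Qed.

(** Twice the form pairs the basis [b] with its dual basis. *)
Lemma uspace_span u : u =
  \sum_i ((2%:R * B u (ua_dual b i)) *: ua b i + (2%:R * B u (ua b i)) *: ua_dual b i).
Proof.
case: u => [x f]; under eq_bigr => i _ do rewrite uform_coord uform_value.
rewrite [RHS]surjective_pairing fst_sum snd_sum; congr (_, _).
  rewrite {1}[x]coord_sum; apply: eq_bigr => i _.
  by rewrite /= scaler0 addr0.
rewrite {1}[f]dual_sum; apply: eq_bigr => i _.
by rewrite /= scaler0 add0r.
Qed.

Lemma swap_signE x f : swap_sign B (ua b) (ua_dual b) (x, f) = (x, - f).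
Proof.
rewrite /swap_sign; under eq_bigr => i _ do rewrite uform_coord uform_value.
rewrite [LHS]surjective_pairing fst_sum snd_sum; congr (_, _).
  rewrite [RHS]coord_sum; apply: eq_bigr => i _.
  by rewrite /= scaler0 subr0.
rewrite [in RHS](dual_sum f) -sumrN; apply: eq_bigr => i _.
by rewrite /= scaler0 sub0r.
Qed.

Local Notation act_linl := (@fock_act_linearl R _ B).

(** In the orthonormal basis the terms in two vectors [ua i] or in two vectors
    [ua_dual i] cancel, since [ue (inr i)] carries the factor ['i]. *)
Lemma Au_omegaE : Au_omega b = omega B (ua b) (ua_dual b).
Proof.
rewrite omegaE /Au_omega big_sumType /= -big_split /=.
have -> : 4%:R^-1 = 2%:R^-1 * 2%:R^-1 :> C by rewrite -invfM -natrM.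
rewrite -scalerA; congr (_ *: _); rewrite scaler_sumr; apply: eq_bigr => i _.
have m2 (u : uspace a) : fock_monomial B [:: (u, 0%N); (u, 1%N)] =
  act u (-1) (act u (-2) vac) by [].
rewrite !m2 !(actDl, actZl, actNl, actDr, actZr, actNr).
rewrite -scalerDr scalerA -expr2 sqr_i scaleN1r opprK.
set p := act (ua b i) _ (act (ua b i) _ _); set q := act (ua b i) _ (act _ _ _).
set r := act (ua_dual b i) _ _; set s := act (ua_dual b i) _ _.
have -> : p + q + (r + s) - (p - q + (- r + s)) = 2%:R *: (q + r).
  rewrite !opprD !opprK [LHS]addrACA [p + q + _]addrACA subrr add0r.
  by rewrite [r + s + _]addrACA subrr addr0 scaler_nat mulr2n addrACA.
by rewrite scalerA mulVf ?pnatr_eq0 // scale1r.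
Qed.

Lemma Au_jE : Au_j b = charge B (ua b) (ua_dual b).
Proof.
rewrite chargeE /Au_j.
have square (u : uspace a) : act u (-1) (act u (-1) vac) = 0.
  have /eqP := act_swap u u (-1) (-1) vac; rewrite /= sub0r -addr_eq0 -mulr2n.
  by rewrite -scaler_nat scaler_eq0 pnatr_eq0 => /eqP.
have m2 (u v : uspace a) : fock_monomial B [:: (u, 0%N); (v, 0%N)] =
  act u (-1) (act v (-1) vac) by [].
rewrite !scaler_sumr; apply: eq_bigr => i _.
rewrite /= m2 actDl !(actZl, actZr) -scalerDr !(actDl, actNl, actDr, actNr) !square.
have -> : act (ua b i) (-1) (act (ua_dual b i) (-1) vac) =
    - act (ua_dual b i) (-1) (act (ua b i) (-1) vac).
  by rewrite act_swap /= sub0r.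
rewrite add0r opprK oppr0 addr0 -mulr2n -[X in _ *: (_ *: X) = _]scaler_nat !scalerA.
by congr (_ *: _); field.
Qed.

(** ** The action of [GL(a)] *)

Local Notation swap := (swap_sign B (ua b) (ua_dual b)).

Lemma GL_swap g u : GL_uspace g (swap u) = swap (GL_uspace g u).
Proof.
by case: u => x f; rewrite /GL_uspace !swap_signE /= comp_lfunNl.
Qed.

Lemma GL_inverse g : g \in GL (a := a) ->
  let h' := fun u : uspace a => ((g^-1)%VF u.1, (u.2 \o g)%VF) : uspace a in
  cancel (GL_uspace g) h' /\ cancel h' (GL_uspace g).
Proof.
move=> gG h'; have gK := lker0_lfunK gG; have gVK := lker0_lfunVK gG.
split=> -[x f]; rewrite /h' /GL_uspace /=; congr (_, _); rewrite ?gK ?gVK //.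
  by apply/lfunP => y; rewrite !comp_lfunE gK.
by apply/lfunP => y; rewrite !comp_lfunE gVK.
Qed.

Lemma GL_comp : {in GL (a := a) &, forall g h, (g \o h)%VF \in GL (a := a)}.
Proof.
move=> g h gG hG; apply/lker0P => y z; rewrite !comp_lfunE.
by move/(can_inj (lker0_lfunK gG))/(can_inj (lker0_lfunK hG)).
Qed.

Lemma GL_uspace_comp g h : g \in GL (a := a) -> h \in GL (a := a) ->
  forall u, GL_uspace (g \o h)%VF u = GL_uspace g (GL_uspace h u).
Proof.
move=> gG hG [x f]; have gK := lker0_lfunK gG; have gVK := lker0_lfunVK gG.
have hK := lker0_lfunK hG; have hVK := lker0_lfunVK hG.
have ghE y : (g \o h)%VF y = g (h y) by exact: (comp_lfunE g h y).
have ghK := GL_comp gG hG.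
have ghV y : ((g \o h)^-1)%VF y = (h^-1)%VF ((g^-1)%VF y).
  apply: (can_inj hK); apply: (can_inj gK); move: (lker0_lfunVK ghK y).
  move: ((g \o h)^-1)%VF => k ghk.
  exact: (etrans (esym (ghE (k y))) (etrans ghk (esym (etrans (congr1 g (hVK _)) (gVK y))))).
apply: (f_equal2 (fun y k => (y, k) : uspace a)); first exact: ghE.
apply/lfunP => y; move: (ghV y); move: ((g \o h)^-1)%VF => k ghk.
apply: etrans (comp_lfunE f k y) (etrans (congr1 f ghk) (esym _)).
exact: (etrans (comp_lfunE (f \o h^-1)%VF _ y) (comp_lfunE f _ ((g^-1)%VF y))).
Qed.

(** Commuting with the involution makes [h] preserve both summands, and the duality
    between them determines the action on functionals by that on vectors. *)
Lemma isometry_GL (h : uspace a -> uspace a) :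
  linear h -> (forall u v, B (h u) (h v) = B u v) ->
  (forall u, h (swap u) = swap (h u)) ->
  exists2 g, g \in GL (a := a) & h = GL_uspace g.
Proof.
move=> hl hB hs.
have twice (W : lmodType C) (x : W) : - x = x -> x = 0.
  move=> /eqP; rewrite eq_sym -addr_eq0 -mulr2n -scaler_nat scaler_eq0 pnatr_eq0.
  by move=> /eqP.
have h1 x : h (x, 0) = ((h (x, 0)).1, 0).
  have := hs (x, 0); rewrite swap_signE oppr0 [h _]surjective_pairing swap_signE.
  by move=> /(congr1 snd) /= /esym /twice ->.
have h2 f : h (0, f) = (0, (h (0, f)).2).
  have := hs (0, f); rewrite swap_signE.
  have -> : (0, - f) = - ((0, f) : uspace a) by congr (_, _); rewrite oppr0.
  rewrite (linN hl) [h _]surjective_pairing swap_signE.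
  by move=> /(congr1 fst) /= /twice ->.
have g_lin : linear (fun x => (h (x, 0)).1).
  move=> c x y; have -> : (c *: x + y, 0) = c *: ((x, 0) : uspace a) + (y, 0).
    by congr (_, _); rewrite /= scaler0 addr0.
  by rewrite hl.
pose gL := GRing.isLinear.Build _ _ _ _ _ g_lin.
pose gS : {linear a -> a} := HB.pack (fun x => (h (x, 0)).1) gL.
pose g := linfun gS.
have gE x : g x = (h (x, 0)).1 by rewrite lfunE.
have pair (x : a) (f : 'Hom(a, C^o)) : (h (0, f)).2 (g x) = f x.
  have := hB (x, 0) (0, f); rewrite h1 h2 /uform /= -gE !lfunE /= !add0r.
  by apply: mulfI; rewrite invr_eq0 pnatr_eq0.
have gG : g \in GL (a := a).
  apply/lker0P => x y gxy; rewrite [x]coord_sum [y]coord_sum; apply: eq_bigr => i _.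
  have e z : coord b i z = (h (0, linfun (coord b i : a -> C^o))).2 (g z).
    by rewrite pair lfunE.
  by rewrite (e x) (e y) gxy.
exists g => //; apply/funext => -[x f].
have -> : (x, f) = (x, 0) + ((0, f) : uspace a).
  by congr (_, _); rewrite ?addr0 ?add0r.
rewrite (linD hl) h1 h2 /GL_uspace /=; congr (_, _); first by rewrite !addr0 gE.
rewrite !add0r; apply/lfunP => y; rewrite comp_lfunE.
by rewrite -[in LHS](lker0_lfunVK gG y) pair.
Qed.

End Polarisation.

Section LinearGroupAction.
Variables (R : realType) (a : vectType R[i]).
Local Notation B := (@uform R a).
Local Notation vac := (fock_vac B).

Lemma GL_Au_linear g : g \in GL (a := a) -> linear (GL_Au g).
Proof.
by move=> gG; apply: fock_map_linear (GL_uspace_isometry gG); apply: GL_uspace_linear.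
Qed.

Lemma GL_Au_vac g : g \in GL (a := a) -> GL_Au g vac = vac.
Proof.
by move=> gG; apply: fock_map_vac (GL_uspace_isometry gG); apply: GL_uspace_linear.
Qed.

Lemma GL_Au_act g u n x : g \in GL (a := a) ->
  GL_Au g (fock_act u n x) = fock_act (GL_uspace g u) n (GL_Au g x).
Proof.
by move=> gG; apply: fock_map_act (GL_uspace_isometry gG) _ _ _; apply: GL_uspace_linear.
Qed.

Lemma GL_Au_generator g u : g \in GL (a := a) ->
  GL_Au g (fock_act u (-1) vac) = fock_act (GL_uspace g u) (-1) vac.
Proof.
move=> gG; apply: etrans (GL_Au_act u (-1) vac gG) _.
exact: (f_equal (@fock_act R _ B (GL_uspace g u) (-1)) (GL_Au_vac gG)).
Qed.

Lemma GL_Au_comp :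
  {in GL (a := a) &, forall g h x, GL_Au (g \o h)%VF x = GL_Au g (GL_Au h x)}.
Proof.
move=> g h gG hG; have ghG := GL_comp gG hG.
apply: fock_gen_ind => [|| u n x e].
- apply: subspace_eq (GL_Au_linear ghG) _.
  exact: linear_comp (GL_Au_linear gG) (GL_Au_linear hG).
- apply: etrans (GL_Au_vac ghG) (esym _).
  exact: etrans (congr1 (GL_Au g) (GL_Au_vac hG)) (GL_Au_vac gG).
- apply: etrans (GL_Au_act u n x ghG) (esym _).
  apply: etrans (congr1 (GL_Au g) (GL_Au_act u n x hG)) (etrans (GL_Au_act _ n _ gG) _).
  exact: (f_equal2 (fun v y => fock_act v n y) (esym (GL_uspace_comp gG hG u)) (esym e)).
Qed.

(** The linear map is recovered from its action on the generating states. *)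
Lemma GL_Au_inj : {in GL (a := a) &, injective (@GL_Au R a)}.
Proof.
move=> g h gG hG gh; apply/lfunP => x.
have : fock_act (GL_uspace g (x, 0)) (-1) vac = fock_act (GL_uspace h (x, 0)) (-1) vac.
  apply: etrans (esym (GL_Au_generator (x, 0) gG)) (etrans _ (GL_Au_generator (x, 0) hG)).
  exact: (congr1 (fun f => f (fock_act (x, 0) (-1) vac)) gh).
move=> /eqP; rewrite -subr_eq0 -actNl -actDl => /eqP.
move=> /(generator_inj (@uform_linl R a) (@uform_sym R a)
  (uspace_span (vbasisP {:a})))/eqP; rewrite subr_eq0 => /eqP.
exact: (congr1 fst).
Qed.

End LinearGroupAction.

Theorem theorem4p6 (R : realType) (N : nat) (a : vectType R[i])
    (herm : {dot a for Num.conj}) (b : N.-tuple a)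
    (N_gt0 : (0 < N)%N) (dim_a : \dim {: a} = N)
    (b_basis : basis_of {: a} b) (b_orthonormal : orthonormal herm b) :
  (exists! Y, is_fock_vertex_operator (B := @uform R a) Y) /\
  forall Y : Au a -> int -> Au a -> Au a,
    is_fock_vertex_operator (B := @uform R a) Y ->
    let gr := fock_gr (B := @uform R a) in
    let vac := fock_vac (@uform R a) in
    let Omega := Au_Omega b in
    [/\ is_U1_VOA gr Y vac Omega,
        has_rank gr Y vac Omega N%:R,
        self_dual gr Y vac
      & is_iso_from_GL (@GL_Au R a) (is_automorphism gr Y vac Omega)].
Proof.
have linl := @uform_linl R a; have sym := @uform_sym R a.
split=> [|Y]; first exact: fock_vertex_operator_unique.
move=> /(fock_vertex_operatorP linl sym) Y_no gr vac Omega.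
have cc := uform_ua b; have dd := uform_ua_dual b.
have cd := uform_ua_ua_dual b_basis; have sp := uspace_span b_basis.
have OmegaE : Omega = [set omega (@uform R a) (ua b) (ua_dual b);
                           charge (@uform R a) (ua b) (ua_dual b)]%classic.
  by rewrite /Omega /Au_Omega Au_omegaE Au_jE.
rewrite OmegaE; split.
- exact: (fock_U1_VOA linl sym Y_no cc dd cd sp (Ordinal N_gt0)).
- exact: (fock_rank linl sym Y_no cc dd cd sp).
- exact: (fock_self_dual linl sym Y_no sp).
split.
- move=> g gG; have [gK Kg] := GL_inverse gG.
  apply: (isometry_automorphism linl sym Y_no cd sp _ _ gK Kg _).
  + exact: GL_uspace_linear.
  + exact: GL_uspace_isometry.
  + by move=> u; rewrite GL_swap.
- exact: GL_Au_comp.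
- exact: GL_Au_inj.
- move=> phi /(automorphism_isometry linl sym Y_no sp)[h [h_lin h_iso h_swap ->]].
  have [g gG ->] := isometry_GL b_basis h_lin h_iso h_swap.
  by exists g.
Qed.
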